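(* Let $m\ge 1$ be an integer. Let $\varphi\in C^0([0,\infty))\cap C^1((0,\infty))$ with $\varphi(0)=0$, $\varphi'>0$ on $(0,\infty)$, and $t\varphi'(t)\in L^1(0^+)$. Suppose that there are constants $D>0$ and $\tau\ge 0$ such that $$s\varphi'(st)\le D s^{\tau}\varphi'(t)\qquad \forall\, s\in(0,1],\ t\in(0,\infty),$$ and constants $B>0$, $\theta\in(-\infty,2)$ such that $$\varphi'(ts)\ge B\,\varphi'(t)\,s^{-\theta}\qquad\forall\,t\in(0,\infty),\ s\in[1,\infty).$$ Let $f\in C^0([0,\infty))$ be strictly increasing on $[0,\infty)$ with $f>0$ on $(0,\infty)$. Let $h\in C^0((0,\infty))$ be non-negative and monotone non-increasing, with $h\in L^1(0^+)$. Let $g\in C^0([0,\infty))$ be non-negative and suppose that for some constant $\widetilde D>0$ (and with $\tau$ the same constant as in the inequality $s\varphi'(st)\le D s^{\tau}\varphi'(t)$) $$g(st)\le\widetilde D\,s^{\tau+1}t^2\varphi'(t)\qquad\forall\,s\in[0,1],\ t\in(0,\infty).$$ Set, for $t\ge 0$, $K(t)=\int_0^t s\varphi'(s)\,ds$ and $\widehat F(t)=\int_0^t f(s)\,e^{(2-\theta)\int_0^s h(x)\,dx}\,ds$, and assume the generalized Keller-Osserman condition $$\frac{e^{\int_0^t h(x)\,dx}}{K^{-1}(\widehat F(t))}\in L^1(+\infty).$$ Let $u$ be a non-negative weak $C^1$-solution of $$\Delta^\varphi_{H^m}u\ \ge\ f(u)-h(u)\,g(|\nabla_{H^m}u|_{H^m})\qquad\text{on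 }H^m .$$ Then $u\equiv 0$.
   Context: $H^m$ is the Heisenberg group: the manifold $\mathbb{R}^{2m+1}$ with points $q=(z,t)=(x_1,\dots,x_m,y_1,\dots,y_m,t)$ and group law $q\circ q'=\left(z+z',\,t+t'+2\sum_{i=1}^m (y_ix_i'-x_iy_i')\right)$. Its horizontal left-invariant vector fields are $X_j=\frac{\partial}{\partial x_j}+2y_j\frac{\partial}{\partial t}$, $Y_j=\frac{\partial}{\partial y_j}-2x_j\frac{\partial}{\partial t}$, $j=1,\dots,m$. For $C^1$ functions $u,v$: $\nabla_{H^m}u=\sum_j (X_ju)X_j+(Y_ju)Y_j$, $\nabla_{H^m}u\cdot\nabla_{H^m}v=\sum_j (X_ju)(X_jv)+(Y_ju)(Y_jv)$, and $|\nabla_{H^m}u|_{H^m}^2=\nabla_{H^m}u\cdot\nabla_{H^m}u$. The $\varphi$-Laplacian is $\Delta^\varphi_{H^m}u=\sum_{j}\left[X_j\left(|\nabla_{H^m}u|_{H^m}^{-1}\varphi(|\nabla_{H^m}u|_{H^m})X_ju\right)+Y_j\left(|\nabla_{H^m}u|_{H^m}^{-1}\varphi(|\nabla_{H^m}u|_{H^m})Y_ju\right)\right]$. The differential inequality is understood weakly: $u\in C^1(H^m)$ and, for all $\zeta\in C_0^\infty(H^m)$ with $\zeta\ge 0$, $$-\int_{\mathbb{R}^{2m+1}}|\nabla_{H^m}u|_{H^m}^{-1}\varphi(|\nabla_{H^m}u|_{H^m})\,\nabla_{H^m}u\cdot\nabla_{H^m}\zeta\ \ge\ \int_{\mathbb{R}^{2m+1}}\left[f(u)-h(u)\,g(|\nabla_{H^m}u|_{H^m})\right]\zeta$$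 (Lebesgue measure; the integrand on the left is $0$ where $\nabla_{H^m}u=0$). At points where $u=0$ one has $\nabla_{H^m}u=0$, while $g(0)=0$ by the bound on $g$; there the product $h(u)g(|\nabla_{H^m}u|_{H^m})$ is taken to be $0$. $L^1(0^+)$, resp. $L^1(+\infty)$, means integrable in a right neighbourhood of $0$, resp. in a neighbourhood of $+\infty$. Under the hypotheses $K$ is an increasing bijection of $[0,\infty)$ onto itself, with inverse $K^{-1}$. *)

(* Defs.v *)
From HB Require Import structures.
From mathcomp Require Import all_boot all_order all_algebra.
From mathcomp Require Import all_classical all_reals all_analysis.

Set Implicit Arguments.
Unset Strict Implicit.
Unset Printing Implicit Defensive.

Import Order.TTheory GRing.Theory Num.Theory.
Import numFieldNormedType.Exports.

Local Open Scope ring_scope.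
Local Open Scope classical_set_scope.

Section lebesgue_tuple.
Context {R : realType}.
Local Open Scope ereal_scope.
Notation RT := (measurableTypeR R).

Definition cons_pair n (p : RT * n.-tuple RT) : n.+1.-tuple RT :=
  [tuple of p.1 :: p.2].

(* The n-fold product of the one-dimensional Lebesgue measure; it is shown below
   to be a sigma-finite measure giving boxes the product of their sides. *)
Fixpoint lebesgue_tuple n : set (n.-tuple RT) -> \bar R :=
  match n with
  | 0 => \d_ [tuple]
  | n'.+1 =>
      pushforward (lebesgue_measure \x @lebesgue_tuple n') (@cons_pair n')
  end.

Lemma measurable_cons_pair n : measurable_fun setT (@cons_pair n).
Proof. exact: measurable_cons. Qed.

Section step.
Variables (n : nat) (m : {sigma_finite_measure set (n.-tuple RT) -> \bar R}).

Let mS := pushforward (lebesgue_measure \x m) (@cons_pair n).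

Let mS0 : mS set0 = 0.
Proof. by rewrite /mS /pushforward preimage_set0 measure0. Qed.

Let mS_ge0 A : 0 <= mS A.
Proof. exact: (measure_ge0 (lebesgue_measure \x m)). Qed.

Let mS_additive : semi_sigma_additive mS.
Proof.
have mc := @measurable_cons_pair n.
move=> F mF tF mUF; rewrite /mS /pushforward preimage_bigcup.
apply: measure_semi_sigma_additive.
- by move=> i; rewrite -[X in measurable X]setTI; exact: mc.
- apply/trivIsetP => /= i j _ _ ij; rewrite -preimage_setI.
  by move/trivIsetP : tF => /(_ _ _ _ _ ij) ->//; rewrite preimage_set0.
- by rewrite -preimage_bigcup -[X in measurable X]setTI; exact: mc.
Qed.

HB.instance Definition _ := isMeasure.Build _ _ _ mS mS0 mS_ge0 mS_additive.

Let mS_sigma_finite : sigma_finite setT mS.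
Proof.
pose G (s : n.+1.-tuple RT) : RT * n.-tuple RT := (thead s, [tuple of behead s]).
have mG : measurable_fun setT G.
  apply/measurable_fun_pairP; split; first exact: measurable_tnth.
  exact: measurable_behead.
have GK : cancel (@cons_pair n) G.
  by move=> [x s]; rewrite /G/=; congr pair; apply: val_inj.
have /sigma_finiteP[A [AT ndA Aoo]] := sigma_finiteT (@lebesgue_measure R).
have /sigma_finiteP[B [BT ndB Boo]] := sigma_finiteT m.
exists (fun k => G @^-1` (A k `*` B k)).
  rewrite -preimage_bigcup -[LHS](preimage_setT G); congr (_ @^-1` _).
  apply/seteqP; split=> [[x s] _|//].
  have [i _ Aix] : (\bigcup_i A i) x by rewrite -AT.
  have [j _ Bjs] : (\bigcup_i B i) s by rewrite -BT.
  exists (maxn i j) => //; split.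
  - by move: x Aix; exact/subsetPset/ndA/leq_maxl.
  - by move: s Bjs; exact/subsetPset/ndB/leq_maxr.
move=> k; have [mA Ak] := Aoo k; have [mB Bk] := Boo k; split.
  by rewrite -[X in measurable X]setTI; apply: mG => //; exact: measurableX.
rewrite /mS /pushforward -comp_preimage (_ : G \o _ = id); last exact/funext.
by rewrite preimage_id product_measure1E// lte_mul_pinfty// ge0_fin_numE.
Qed.

HB.instance Definition _ :=
  Measure_isSigmaFinite.Build _ _ _ mS mS_sigma_finite.

Lemma lebesgue_tuple_step :
  exists m' : {sigma_finite_measure set (n.+1.-tuple RT) -> \bar R},
    m' = mS :> (set _ -> _).
Proof. by exists mS. Qed.

End step.

Lemma lebesgue_tuple_ex n :
  exists m : {sigma_finite_measure set (n.-tuple RT) -> \bar R},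
    m = @lebesgue_tuple n :> (set _ -> _).
Proof.
elim: n => [|n [m /= <-]]; last exact: lebesgue_tuple_step.
by exists (\d_ [tuple]).
Qed.

Section instances.
Variable n : nat.

Let lebesgue_tuple0 : @lebesgue_tuple n set0 = 0.
Proof. by have [m <-] := lebesgue_tuple_ex n; rewrite measure0. Qed.

Let lebesgue_tuple_ge0 A : 0 <= @lebesgue_tuple n A.
Proof. by have [m <-] := lebesgue_tuple_ex n; exact: measure_ge0. Qed.

Let lebesgue_tuple_additive : semi_sigma_additive (@lebesgue_tuple n).
Proof.
by have [m <-] := lebesgue_tuple_ex n; exact: measure_semi_sigma_additive.
Qed.

HB.instance Definition _ := isMeasure.Build _ _ _ (@lebesgue_tuple n)
  lebesgue_tuple0 lebesgue_tuple_ge0 lebesgue_tuple_additive.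

Let lebesgue_tuple_sigma_finite : sigma_finite setT (@lebesgue_tuple n).
Proof. by have [m <-] := lebesgue_tuple_ex n; exact: sigma_finiteT. Qed.

HB.instance Definition _ := Measure_isSigmaFinite.Build _ _ _
  (@lebesgue_tuple n) lebesgue_tuple_sigma_finite.

End instances.

Lemma lebesgue_tuple_box n (A : 'I_n -> set RT) :
  (forall i, measurable (A i)) ->
  lebesgue_tuple [set s | forall i, A i (tnth s i)] =
  \prod_(i < n) lebesgue_measure (A i).
Proof.
elim: n A => [|n IH] A mA.
  by rewrite big_ord0 /= diracE mem_set//= => -[].
have mB k (C : 'I_k -> set RT) : (forall i, measurable (C i)) ->
    measurable [set s : k.-tuple RT | forall i, C i (tnth s i)].
  move=> mC; rewrite [X in measurable X](_ : _ =
    \bigcap_(i in [set: 'I_k]) ((@tnth k RT ^~ i) @^-1` C i)).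
    apply: fin_bigcap_measurable => // i _.
    by have := @measurable_tnth _ RT k i measurableT _ (mC i); rewrite setTI.
  by apply/seteqP; split=> [s Cs i _|s Cs i]; [exact: Cs|exact: (Cs i I)].
have mA' i : measurable (A (lift ord0 i)) by exact: mA.
rewrite big_ord_recl -IH// -product_measure1E//; last exact: (mB _ _ mA').
rewrite /= /pushforward; apply: (congr1 (lebesgue_measure \x _)).
apply/seteqP; split=> [[x s] As|[x s] [Ax As] i] /=.
  split=> [|i]; first exact: (As ord0).
  by have := As (lift ord0 i); rewrite tnthS.
by have [j ->|->//] := unliftP ord0 i; rewrite tnthS; exact: As.
Qed.

End lebesgue_tuple.

Section calculus.
Context {R : realType} {n : nat}.
Implicit Types u : 'rV[R]_n -> R.

Definition partial (i : 'I_n) u : 'rV[R]_n -> R := 'D_(delta_mx 0 i) u.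

Fixpoint Ck k u : Prop :=
  continuous u /\
  if k is k'.+1 then
    forall i, (forall q, derivable u q (delta_mx 0 i)) /\ Ck k' (partial i u)
  else True.

Definition Cinfty u := forall k, Ck k u.

Definition test_function u := Cinfty u /\ compact (closure [set q | u q != 0]).

(* Extended-real valued: the integral of the positive part minus that of the
   negative part, with no finiteness requirement. *)
Definition int_Rn u : \bar R :=
  (\int[@lebesgue_tuple R n]_s (u (\row_i tnth s i))%:E)%E.

End calculus.

Section Heisenberg.
Context {R : realType} {m : nat}.
Implicit Types (u v : 'rV[R]_(m + m + 1) -> R) (q : 'rV[R]_(m + m + 1)).

Definition ix (j : 'I_m) : 'I_(m + m + 1) := lshift 1 (lshift m j).
Definition iy (j : 'I_m) : 'I_(m + m + 1) := lshift 1 (rshift m j).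
Definition it : 'I_(m + m + 1) := rshift (m + m) ord0.

Definition XH j u q := partial (ix j) u q + 2 * q 0 (iy j) * partial it u q.
Definition YH j u q := partial (iy j) u q - 2 * q 0 (ix j) * partial it u q.

Definition hdot u v q := \sum_(j < m) (XH j u q * XH j v q + YH j u q * YH j v q).
Definition hnorm u q := Num.sqrt (hdot u u q).

(* Since 0^-1 = 0, the integrand with phi vanishes where hnorm u does.
   The value of h at 0 is junk. Where a non-negative u vanishes it is minimal, so
   hnorm u = 0 and h (u q) is multiplied by g 0, which is 0 in the theorem. *)
Definition weak_solution (phi f h g : R -> R) u :=
  Ck 1 u /\
  forall zeta, test_function zeta -> (forall q, 0 <= zeta q) ->
    (- int_Rn (fun q =>
         (hnorm u q)^-1 * phi (hnorm u q) * hdot u zeta q)%R >=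
     int_Rn (fun q => (f (u q) - h (u q) * g (hnorm u q)) * zeta q)%R)%E.

End Heisenberg.

Section one_variable.
Context {R : realType}.
Implicit Types F h f phi : R -> R.

Definition L1_0 F := exists2 e, 0 < e &
  (@lebesgue_measure R).-integrable `]0, e[ (EFin \o F).
Definition L1_infty F := exists a,
  (@lebesgue_measure R).-integrable `]a, +oo[ (EFin \o F).

Definition int0 F t : R := \int[lebesgue_measure]_(s in `[0, t]) F s.

Definition K phi := int0 (fun s => s * derive1 phi s).
(* K phi is a bijection of [0, +oo[ in the theorem, and Kinv phi its inverse. *)
Definition Kinv phi : R -> R := pinv (`[0, +oo[ : set R) (K phi).
Definition Fhat theta f h :=
  int0 (fun s => f s * expR ((2 - theta) * int0 h s)).

End one_variable.

(* Main.v *)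
Require Import Defs.
From HB Require Import structures.
From mathcomp Require Import all_boot all_order all_algebra.
From mathcomp Require Import all_classical all_reals all_analysis.
From mathcomp Require Import measurable_realfun.
From mathcomp Require Import ring lra.

(* Put lam = 2 - theta, H t = int_0^t h and E = exp(- lam H) Fhat.  Since f
   increases and h decreases, 0 < E' <= f and lam h E <= f.  Letting V solve
   V' = p with K(p) = E(V) - E(eps), V(0) = eps, p(0) = 0, the lower bound on phi'
   turns the Keller-Osserman condition into finiteness of the travel time: V
   blows up at a finite radius.  Composing with a small multiple of the Koranyi
   gauge gives v = V(c |q|) with Delta^phi v <= f(v) / 2, while h(v) g(|grad v|) <=
   f(v) / 4.  If u exceeded v somewhere, then at a maximum of u - v both gradients
   agree, so f(u) - h(u) g(|grad u|) - f(v) / 2 is positive there, hence on some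
   set {u - v >= l}.  Testing the difference of the two inequalities against
   max(u - v - l, 0)^2 contradicts the monotonicity of the flux; the test function
   is cut off near the center of the group, where v is not smooth, with an error
   O(delta), and mollification makes it an admissible one.  So u(q0) <= v(q0), which
   is less than u(q0) for eps = u(q0) / 2 and c small. *)

Set Implicit Arguments.
Unset Strict Implicit.
Unset Printing Implicit Defensive.

Import Order.TTheory GRing.Theory Num.Theory.
Import numFieldNormedType.Exports.

Local Open Scope ring_scope.
Local Open Scope classical_set_scope.

(** * Compactly supported integrands on R^n *)

(** The term [h(u) g(|grad u|)] enters with the unfavourable sign, and nothing compares [g] at two
    different gradients, so the inequalities for [u] and for the barrier cannot be subtracted
    everywhere. They can where the gradients agree, hence the passage through a maximum and then, by
    continuity and compactness, to a superlevel set close to it. Blow-up at a finite radius replaces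
    any growth assumption on [u]: on a compact gauge ball [u] is bounded, and the barrier exceeds it
    on the boundary. E is the solution of E' = f - lam h E that vanishes at 0. The bound K(t s) >= B
    s^lam K(t) trades the factor exp(H) outside the inverse of K for exp(lam H) inside it, which is
    how the Keller-Osserman condition becomes integrability of 1 / K^-1(E / B) at infinity. A factor
    c on the gauge leaves at least one factor c in both the operator and the gradient term, because
    s phi'(s t) <= D phi'(t) for s <= 1. The fractions of f(v) are therefore reached by shrinking c
    alone, with V fixed. *)

Section continuity.
Context {R : realType} {T : topologicalType}.
Implicit Types (f g : T -> R) (x : T).

Lemma ctsC (k : R) x : continuous_at x (fun _ : T => k).
Proof. exact: cvg_cst. Qed.

Lemma ctsD f g x : continuous_at x f -> continuous_at x g ->
  continuous_at x (fun y => f y + g y).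
Proof. exact: continuousD. Qed.

Lemma ctsN f x : continuous_at x f -> continuous_at x (fun y => - f y).
Proof. exact: continuousN. Qed.

Lemma ctsB f g x : continuous_at x f -> continuous_at x g ->
  continuous_at x (fun y => f y - g y).
Proof. exact: continuousB. Qed.

Lemma ctsM f g x : continuous_at x f -> continuous_at x g ->
  continuous_at x (fun y => f y * g y).
Proof. exact: continuousM. Qed.

Lemma ctsX f k x : continuous_at x f ->
  continuous_at x (fun y => f y ^+ k).
Proof.
by move=> fx; exact: (continuous_comp fx (@exprn_continuous R k (f x))).
Qed.

Lemma ctsV f x : f x != 0 -> continuous_at x f ->
  continuous_at x (fun y => (f y)^-1).
Proof. exact: continuousV. Qed.

Lemma cts_norm f x : continuous_at x f ->
  continuous_at x (fun y => `|f y|).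
Proof. by move=> fx; exact: (continuous_comp fx (@norm_continuous _ _ (f x))). Qed.

Lemma cts_max f g x : continuous_at x f -> continuous_at x g ->
  continuous_at x (fun y => Num.max (f y) (g y)).
Proof. exact: continuous_max. Qed.

Lemma cts_min f g x : continuous_at x f -> continuous_at x g ->
  continuous_at x (fun y => Num.min (f y) (g y)).
Proof. exact: continuous_min. Qed.

Lemma cts_sqrt f x : continuous_at x f ->
  continuous_at x (fun y => Num.sqrt (f y)).
Proof. by move=> fx; exact: (continuous_comp fx (@sqrt_continuous R (f x))). Qed.

Lemma cts_comp (h : R -> R) f x : continuous_at x f ->
  continuous_at (f x) h -> continuous_at x (fun y => h (f y)).
Proof. by move=> fx hx; exact: (continuous_comp fx hx). Qed.

Lemma cts_sum (I : Type) (r : seq I) (P : pred I) (F : I -> T -> R) x :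
  (forall i, continuous_at x (F i)) ->
  continuous_at x (fun y => \sum_(i <- r | P i) F i y).
Proof.
move=> cF; elim: r => [|i r IH].
  by under eq_fun do rewrite big_nil; exact: ctsC.
by under eq_fun do rewrite big_cons; case: (P i) => //; exact: ctsD.
Qed.

End continuity.

Section row_vectors.
Context {R : realType} {n : nat}.
Implicit Types q : 'rV[R]_n.

Lemma rV_coord_le q i : `|q 0 i| <= `|q|.
Proof.
rewrite [leRHS]/Num.norm/= mx_normrE.
by apply: (le_bigmax _ (fun i => `|q i.1 i.2|) (0, i)).
Qed.

Lemma rV_norm_le q e : 0 <= e -> (forall i, `|q 0 i| <= e) -> `|q| <= e.
Proof.
move=> e0 qe; rewrite [leLHS]/Num.norm/= mx_normrE.
by apply: bigmax_le => //= -[i j] _; rewrite ord1; exact: qe.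
Qed.

Lemma rV_norm_gt q e : 0 <= e -> e < `|q| -> exists i, e < `|q 0 i|.
Proof.
move=> e0 eq; apply: contrapT => /forallNP h.
have : `|q| <= e by apply: rV_norm_le => // i; rewrite leNgt; apply/negP/h.
by rewrite leNgt eq.
Qed.

Lemma cvg_rV (T : Type) (F : set_system T) {FF : Filter F} (f : T -> 'rV[R]_n) q :
  (forall i, f x 0 i @[x --> F] --> q 0 i) -> f @ F --> q.
Proof.
move=> fq; apply/cvgrPdist_le => e e0.
have : \forall x \near F, forall i, i \in enum 'I_n -> `|q 0 i - f x 0 i| <= e.
  elim: (enum 'I_n) => [|i s IH]; first by near=> x => i; rewrite in_nil.
  have /cvgrPdist_le/(_ e e0) hi := fq i.
  near=> x => j; rewrite inE => /orP[/eqP ->|js]; first by near: x.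
  by move: j js; near: x.
apply: filterS => x hx; apply: rV_norm_le => [|i]; first exact: ltW.
by rewrite !mxE hx// mem_enum.
Unshelve. all: by end_near. Qed.

Implicit Types F G : 'rV[R]_n -> R.

(** The support is controlled by a sup-norm ball, with no sign condition on the radius; [Cc_bound]
    makes it positive. *)
Definition Cc (F : 'rV[R]_n -> R) :=
  continuous F /\ exists b, forall q, b < `|q| -> F q = 0.

Lemma Cc_bound (F : 'rV[R]_n -> R) : Cc F ->
  exists2 b, 0 < b & forall q, b < `|q| -> F q = 0.
Proof.
move=> [_ [b hb]]; exists (Num.max b 1); first by rewrite lt_max ltr01 orbT.
by move=> q; rewrite gt_max => /andP[bq _]; exact: hb.
Qed.

Lemma compact_ball_rV (b : R) : compact [set q : 'rV[R]_n | `|q| <= b].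
Proof.
apply: bounded_closed_compact.
  exists b; split; first exact: num_real.
  by move=> x bx y /= yb; apply: (le_trans yb); exact: ltW.
apply: (@closed_comp _ _ (fun q : 'rV[R]_n => `|q|) [set x | x <= b]).
  by move=> q _; exact: norm_continuous.
exact: closed_le.
Qed.

Lemma Cc_bounded (F : 'rV[R]_n -> R) : Cc F ->
  exists2 M, 0 < M & forall q, `|F q| <= M.
Proof.
move=> hF; have [b b0 hb] := Cc_bound hF.
have A0 : [set q : 'rV[R]_n | `|q| <= b] !=set0.
  by exists 0; rewrite /= normr0 ltW.
have [|q0 q0b hq0] := compact_EVT_max (f := fun q => `|F q|) A0 (@compact_ball_rV b).
  apply: continuous_subspaceT => q; apply: (continuous_comp (hF.1 q)).
  exact: norm_continuous.
exists (`|F q0| + 1) => [|q]; first by rewrite ltr_wpDl.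
have [qb|qb] := leP `|q| b; last by rewrite hb// normr0 addr_ge0.
by rewrite ler_wpDr//; apply: hq0; rewrite inE.
Qed.

Lemma CcD F G : Cc F -> Cc G -> Cc (fun q => F q + G q).
Proof.
move=> hF hG; have [[cF _] [cG _]] := (hF, hG).
split; first by move=> q; exact: ctsD.
have [[_ [b hb]] [_ [c hc]]] := (hF, hG).
exists (Num.max b c) => q; rewrite gt_max => /andP[bq cq].
by rewrite hb// hc// addr0.
Qed.

Lemma CcMl F G : continuous F -> Cc G -> Cc (fun q => F q * G q).
Proof.
move=> cF [cG [b hb]]; split; first by move=> q; exact: ctsM.
by exists b => q bq; rewrite hb// mulr0.
Qed.

Lemma CcMr F G : Cc F -> continuous G -> Cc (fun q => F q * G q).
Proof.
by move=> cF cG; under eq_fun do rewrite mulrC; exact: CcMl.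
Qed.

Lemma CcZ k F : Cc F -> Cc (fun q => k * F q).
Proof. by move=> hF; apply: CcMl => // q; exact: ctsC. Qed.

Lemma CcN F : Cc F -> Cc (fun q => - F q).
Proof. by move=> /(CcZ (-1)); under eq_fun do rewrite mulN1r. Qed.

Lemma CcB F G : Cc F -> Cc G -> Cc (fun q => F q - G q).
Proof. by move=> hF /CcN; exact: CcD. Qed.

Lemma Cc0 : Cc (fun=> 0).
Proof. by split; [move=> q; exact: ctsC|exists 0]. Qed.

Lemma Cc_sum (I : Type) (r : seq I) (P : pred I) (F : I -> 'rV[R]_n -> R) :
  (forall i, Cc (F i)) -> Cc (fun q => \sum_(i <- r | P i) F i q).
Proof.
move=> hF; elim: r => [|i r IH].
  by under eq_fun do rewrite big_nil; exact: Cc0.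
under eq_fun do rewrite big_cons.
by case: (P i) => //; exact: CcD.
Qed.

End row_vectors.

Section row_measurability.
Context {R : realType}.
Notation RT := (measurableTypeR R).

Definition t2r n (s : n.-tuple R) : 'rV[R]_n := \row_i tnth s i.

Lemma measurable_tuple_box n (C : 'I_n -> set RT) :
  (forall i, measurable (C i)) ->
  measurable [set s : n.-tuple RT | forall i, C i (tnth s i)].
Proof.
move=> mC; rewrite [X in measurable X](_ : _ =
  \bigcap_(i in [set: 'I_n]) ((@tnth n RT ^~ i) @^-1` C i)).
  apply: fin_bigcap_measurable => // i _.
  by have := @measurable_tnth _ RT n i measurableT _ (mC i); rewrite setTI.
by apply/seteqP; split=> [s Cs i _|s Cs i]; [exact: Cs|exact: (Cs i I)].
Qed.

Lemma measurable_fun_countable d (T : measurableType d) (I : countType)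
    (fl : T -> I) (G : I -> R) :
  (forall z, measurable (fl @^-1` [set z])) ->
  measurable_fun setT (G \o fl : T -> RT).
Proof.
move=> mfl _ Y _; rewrite setTI [X in measurable X](_ : _ =
  \bigcup_(k : nat) if unpickle k is Some z then
     (if G z \in Y then fl @^-1` [set z] else set0) else set0).
  apply: bigcupT_measurable => k; case: (unpickle k) => // z.
  by case: ifPn.
apply/seteqP; split => [x /= Yx|x /= [k _]].
  by exists (pickle (fl x)) => //=; rewrite pickleK (mem_set Yx).
case: (unpickle k) => // z; case: ifPn => // /set_mem Gz /= xz.
by rewrite /preimage/= xz.
Qed.

(** Tuples carry the product sigma-algebra, so continuity does not give measurability at once. [F]
    is the pointwise limit of its values at the grid points of mesh 1/(k+1) just below the argument,
    and each of these approximations takes countably many values, on boxes. *)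
Lemma measurable_Cc_t2r n (F : 'rV[R]_n -> R) : continuous F ->
  measurable_fun setT (F \o @t2r n : n.-tuple RT -> RT).
Proof.
move=> cF.
pose fl k (s : n.-tuple RT) : {ffun 'I_n -> int} :=
  [ffun i => Num.floor (k.+1%:R * tnth s i)%R].
pose G k (z : {ffun 'I_n -> int}) : R := F (\row_i ((z i)%:~R / k.+1%:R)%R).
apply/measurable_EFinP.
apply: (emeasurable_fun_cvg (fun k => EFin \o (G k \o fl k))).
- move=> k; apply/measurable_EFinP; apply: measurable_fun_countable => z.
  rewrite [X in measurable X](_ : _ = [set s : n.-tuple RT | forall i,
     [set x : RT | Num.floor (k.+1%:R * x)%R = z i] (tnth s i)]).
    apply: (@measurable_tuple_box n
      (fun i => [set x : RT | Num.floor (k.+1%:R * x)%R = z i])) => i.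
    rewrite [X in measurable X](_ : _ =
      `[(z i)%:~R / k.+1%:R, (z i + 1)%:~R / k.+1%:R[%classic); first exact: measurable_itv.
    apply/seteqP; split => x /=.
      move=> <-; rewrite in_itv/= ler_pdivrMr// ltr_pdivlMr// mulrC.
      exact: floor_itv.
    rewrite in_itv/= ler_pdivrMr// ltr_pdivlMr// mulrC => h.
    by apply: floor_def.
  apply/seteqP; split => s /=.
    by move=> <- i; rewrite ffunE.
  by move=> h; apply/ffunP => i; rewrite ffunE.
- move=> s _; apply: cvg_EFin; first by near=> k.
  apply: (@cvg_comp _ _ _ (fun k => \row_i ((fl k s i)%:~R / k.+1%:R)%R) F
    _ (nbhs (t2r s))); last exact: cF.
  apply: cvg_rV => i; rewrite mxE; under eq_fun do rewrite mxE ffunE.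
  apply/cvgrPdist_lt => e e0; have := near_infty_natSinv_lt (PosNum e0).
  apply: filterS => k /=; apply: le_lt_trans.
  have /andP[h1 h2] := floor_itv (k.+1%:R * tnth s i)%R.
  rewrite ler_distlC; apply/andP; split.
    rewrite -(ler_pM2l (x := k.+1%:R)) ?ltr0Sn// mulrBr mulfV ?pnatr_eq0//.
    rewrite mulrCA mulfV ?pnatr_eq0// mulr1.
    by move: h2; rewrite intrD1; lra.
  rewrite -(ler_pM2l (x := k.+1%:R)) ?ltr0Sn// mulrDr mulfV ?pnatr_eq0//.
  rewrite mulrCA mulfV ?pnatr_eq0// mulr1.
  by move: h1; lra.
Unshelve. all: by end_near. Qed.

End row_measurability.

Section row_integral.
Context {R : realType}.
Notation RT := (measurableTypeR R).

Section fixed_dimension.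
Variable n : nat.
Implicit Types F G : 'rV[R]_n -> R.
Notation mu := (@lebesgue_tuple R n).

Let box (b : 'I_n -> R) := [set s : n.-tuple RT | forall i, `[- b i, b i] (tnth s i)].

Let mbox b : measurable (box b).
Proof.
apply: (@measurable_tuple_box _ _ (fun i => `[- b i, b i]%classic)) => i.
exact: measurable_itv.
Qed.

Let boxE b : (forall i, 0 <= b i) -> mu (box b) = (\prod_i (2 * b i))%:E.
Proof.
move=> b0; rewrite /box (@lebesgue_tuple_box _ _ (fun i => `[- b i, b i]%classic)).
  rewrite -prodEFin; apply: eq_bigr => i _.
  rewrite lebesgue_measure_itv/= lte_fin.
  have := b0 i; rewrite le_eqVlt => /predU1P[<-|bi].
    by rewrite oppr0 ltxx mulr0.
  by rewrite gt0_cp// opprK -EFinD mulr2n mulrDl mul1r.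
by move=> i; exact: measurable_itv.
Qed.

Lemma integrable_Cc F : Cc F -> mu.-integrable setT (EFin \o (F \o @t2r R n)).
Proof.
move=> hF; have [b b0 hb] := Cc_bound hF; have [M M0 hM] := Cc_bounded hF.
pose B := box (fun=> b).
have iB : mu.-integrable setT (EFin \o (fun s => M * \1_B s)).
  under [X in _.-integrable _ X]eq_fun do rewrite /= EFinM.
  apply: integrableZl => //; apply/integrableP; split.
    by apply/measurable_EFinP; apply: measurable_indic; exact: mbox.
  under eq_integral do rewrite gee0_abs ?lee_fin//.
  rewrite integral_indic//; last exact: mbox.
  rewrite setIT [X in (X < _)%E](boxE (fun=> ltW b0)).
  exact: ltry.
apply: le_integrable iB => //.
  by apply/measurable_EFinP; apply: measurable_Cc_t2r; case: hF.
move=> s _ /=; rewrite lee_fin.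
have [sB|/negP sB] := boolP (s \in B); rewrite indicE.
  by rewrite sB mulr1 (gtr0_norm M0).
have [i si] : exists i, b < `|(t2r s) 0 i|.
  apply: contrapT => /forallNP h; apply: sB; apply/mem_set => i /=.
  by have /negP := h i; rewrite -leNgt mxE ler_norml in_itv.
rewrite (negbTE (introN idP sB)) mulr0.
by rewrite hb ?normr0// (lt_le_trans si)// rV_coord_le.
Qed.

(** On [Cc] functions the integral is finite, so [fine] loses nothing ([int_Rn_RI]) and the
    estimates become real arithmetic. *)
Definition RI F : R := fine (int_Rn F).

Lemma int_Rn_RI F : Cc F -> int_Rn F = (RI F)%:E.
Proof.
move=> /integrable_Cc h; rewrite /RI fineK//.
by apply: integrable_fin_num => //.
Qed.

Lemma RIE F : RI F = \int[mu]_s F (t2r s).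
Proof. by []. Qed.

Lemma RID F G : Cc F -> Cc G -> RI (fun q => F q + G q) = RI F + RI G.
Proof. by move=> /integrable_Cc iF /integrable_Cc iG; rewrite !RIE RintegralD. Qed.

Lemma RIZ k F : Cc F -> RI (fun q => k * F q) = k * RI F.
Proof. by move=> /integrable_Cc iF; rewrite !RIE RintegralZl. Qed.

Lemma RIN F : Cc F -> RI (fun q => - F q) = - RI F.
Proof. by move=> /(RIZ (-1)); under eq_fun do rewrite mulN1r; rewrite mulN1r. Qed.

Lemma RIB F G : Cc F -> Cc G -> RI (fun q => F q - G q) = RI F - RI G.
Proof. by move=> hF hG; rewrite RID// ?RIN//; exact: CcN. Qed.

Lemma RI0 : RI (fun=> 0) = 0.
Proof. by rewrite RIE Rintegral_cst// mul0r. Qed.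

Lemma RI_le F G : Cc F -> Cc G -> (forall q, F q <= G q) -> RI F <= RI G.
Proof.
by move=> /integrable_Cc iF /integrable_Cc iG FG; rewrite !RIE; exact: le_Rintegral.
Qed.

Lemma RI_sum (I : Type) (r : seq I) (P : pred I) (F : I -> 'rV[R]_n -> R) :
  (forall i, Cc (F i)) ->
  RI (fun q => \sum_(i <- r | P i) F i q) = \sum_(i <- r | P i) RI (F i).
Proof.
move=> hF; elim: r => [|i r IH].
  by under eq_fun do rewrite big_nil; rewrite big_nil RI0.
under eq_fun do rewrite big_cons; rewrite big_cons.
by case: (P i) => //; rewrite RID ?IH//; exact: Cc_sum.
Qed.

(** Each coordinate has its own half-width: the cutoff near the center is estimated on a box with
    two short sides. *)
Lemma RI_bound F (b : 'I_n -> R) (M : R) : (forall i, 0 <= b i) -> Cc F ->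
  (forall q, `|F q| <= M) -> (forall (q : 'rV[R]_n) i, b i < `|q 0 i| -> F q = 0) ->
  `|RI F| <= M * \prod_i (2 * b i).
Proof.
move=> b0 hF FM Fb; have iF := integrable_Cc hF.
have M0 : 0 <= M by rewrite (le_trans _ (FM 0)).
rewrite RIE; apply: (le_trans (le_normr_Rintegral _ iF)) => //.
rewrite -lee_fin EFinM -boxE// [X in (X <= _)%E](_ : _ =
   \int[mu]_s (`|F (t2r s)|)%:E)%E; last first.
  by rewrite /Rintegral fineK//; apply: integrable_fin_num => //; exact: integrable_norm.
rewrite -[in leRHS](setIT (box b)) -integral_indic//.
rewrite -ge0_integralZl//; last first.
  by apply/measurable_EFinP; exact: measurable_indic.
apply: ge0_le_integral => //.
- by apply/measurable_EFinP; apply: measurableT_comp => //; exact: (measurable_Cc_t2r hF.1).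
- apply: emeasurable_funM => //; apply/measurable_EFinP; apply: measurable_indic; exact: mbox.
- move=> s _; rewrite -EFinM lee_fin indicE; have [sB|/negP sB] := boolP (s \in box b).
    by rewrite mulr1.
  have [i si] : exists i, b i < `|(t2r s) 0 i|.
    apply: contrapT => /forallNP h; apply: sB; apply/mem_set => i /=.
    by have /negP := h i; rewrite -leNgt mxE ler_norml in_itv.
  by rewrite (Fb _ i)// normr0 mulr0.
Qed.

End fixed_dimension.
End row_integral.

(** A directional derivative depends only on difference quotients, so equality along the increments
    transports it, even between different spaces. *)
Lemma is_derive_reparam (R : realType) (V W : normedModType R) (f : V -> R)
    (g : W -> R) q v p w d :
  (forall h : R, f (h *: v + q) = g (h *: w + p)) ->
  is_derive p w g d -> is_derive q v f d.
Proof.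
move=> fg [gw gd].
have E : (fun h : R => h^-1 *: ((f \o shift q) (h *: v) - f q)) =
         (fun h : R => h^-1 *: ((g \o shift p) (h *: w) - g p)).
  apply/funext => h /=; rewrite fg; congr (_ *: (_ - _)).
  by have := fg 0; rewrite !scale0r !add0r.
by split; rewrite /derivable /derive E.
Qed.

Lemma is_derive1_line (R : realType) (V : normedModType R) (f : V -> R) q v d (x : R) :
  is_derive (q + x *: v) v f d -> is_derive x 1 (fun t : R => f (q + t *: v)) d.
Proof.
apply: is_derive_reparam => h; congr f.
by rewrite [h *: (1 : R)]mulr1 scalerDl addrCA.
Qed.

(** * Integration by parts *)

Section divergence.
Context {R : realType}.
Notation RT := (measurableTypeR R).
Notation leb := (@lebesgue_measure R).

Lemma integral_derive0 (f d : R -> R) (b : R) : continuous d ->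
  (forall x, is_derive x (1 : R) f (d x)) -> (forall x, b < `|x| -> f x = 0) ->
  (\int[leb]_x (d x)%:E = 0)%E.
Proof.
(* The endpoints of the segment must lie strictly beyond [b], which may be negative, for [f] to
   vanish there. *)
move=> cd fd fb; pose c := `|b| + 1.
have c0 : 0 < c by rewrite /c ltr_wpDl.
have bc : b < c by rewrite /c (le_lt_trans (ler_norm b))// ltrDl.
have db x : c < `|x| -> d x = 0.
  move=> cx; have [_ <-] := fd x.
  have : \forall y \near x, f y = (cst 0 : R -> R) y.
    have : \forall y \near x, c < `|y|.
      exact: (cvgr_gt (`|x|) (@norm_continuous _ _ x)).
    by apply: filterS => y cy; rewrite fb// (lt_trans bc).
  by move=> h; rewrite (near_eq_derive _ h) ?derive_cst// oner_eq0.
have -> : (\int[leb]_x (d x)%:E = \int[leb]_(x in `[(- c)%R, c]) (d x)%:E)%E.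
  rewrite [RHS]integral_mkcond; apply: eq_integral => x _.
  rewrite patchE; case: ifPn => // /negP xc.
  rewrite db// ltNge ler_norml; apply/negP => h; apply: xc.
  by apply/mem_set; rewrite /= in_itv.
rewrite (@continuous_FTC2 _ d f); first last.
- by move=> x _; rewrite derive1E; have [_ ->] := fd x.
- split; first by move=> x _; have [] := fd x.
    apply: cvg_at_right_filter; apply: differentiable_continuous.
    by apply/derivable1_diffP; have [] := fd (- c).
  apply: cvg_at_left_filter; apply: differentiable_continuous.
  by apply/derivable1_diffP; have [] := fd c.
- exact: continuous_subspaceT.
- by rewrite gtrN.
by rewrite !fb ?subee// ?normrN (gtr0_norm c0).
Qed.

(** Row-vector counterpart of [cons_pair], used to differentiate and integrate along slices. *)
Definition consr n (x : R) (q : 'rV[R]_n) : 'rV[R]_n.+1 :=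
  \row_i oapp (fun j => q 0 j) x (unlift ord0 i).

Lemma consr0 n x (q : 'rV[R]_n) : consr x q 0 ord0 = x.
Proof. by rewrite mxE unlift_none. Qed.

Lemma consrS n x (q : 'rV[R]_n) j : consr x q 0 (lift ord0 j) = q 0 j.
Proof. by rewrite mxE liftK. Qed.

Lemma t2r_cons n (p : RT * n.-tuple RT) : t2r (cons_pair p) = consr p.1 (t2r p.2).
Proof.
apply/rowP => i; have [j ->|->] := unliftP ord0 i.
  by rewrite consrS !mxE tnthS.
by rewrite consr0 mxE.
Qed.

Lemma consrD0 n x h (q : 'rV[R]_n) :
  consr (h + x) q = h *: delta_mx 0 ord0 + consr x q.
Proof.
apply/rowP => i; have [j ->|->] := unliftP ord0 i.
  rewrite consrS [RHS]mxE [X in _ = X + _]mxE [X in _ = _ * X + _]mxE consrS.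
  by rewrite andbC eq_sym eq_liftF mulr0 add0r.
rewrite consr0 [RHS]mxE [X in _ = X + _]mxE [X in _ = _ * X + _]mxE consr0.
by rewrite !eqxx mulr1.
Qed.

Lemma consrDS n x h (q : 'rV[R]_n) j :
  consr x (h *: delta_mx 0 j + q) = h *: delta_mx 0 (lift ord0 j) + consr x q.
Proof.
apply/rowP => i; have [k ->|->] := unliftP ord0 i.
  rewrite consrS [LHS]mxE [RHS]mxE consrS; congr (_ + _).
  by rewrite !mxE (inj_eq lift_inj).
rewrite consr0 [RHS]mxE [X in _ = X + _]mxE [X in _ = _ * X + _]mxE consr0.
by rewrite andbC eq_liftF mulr0 add0r.
Qed.

Lemma consr_norm1 n x (q : 'rV[R]_n) : `|x| <= `|consr x q|.
Proof. by rewrite -[in leLHS](consr0 x q) rV_coord_le. Qed.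

Lemma consr_norm2 n x (q : 'rV[R]_n) : `|q| <= `|consr x q|.
Proof.
by apply: rV_norm_le => // i; rewrite -(consrS x) rV_coord_le.
Qed.

Lemma continuous_consrl n (q : 'rV[R]_n) : continuous (fun x => consr x q).
Proof.
move=> x; apply: cvg_rV => i; have [k ->|->] := unliftP ord0 i.
  by under eq_fun do rewrite consrS; rewrite consrS; exact: cvg_cst.
by under eq_fun do rewrite consr0; rewrite consr0; exact: cvg_id.
Qed.

Lemma continuous_consrr n x : continuous (fun q : 'rV[R]_n => consr x q).
Proof.
move=> q; apply: (@cvg_rV _ _ _ _ (nbhs_filter q)) => i; have [k ->|->] := unliftP ord0 i.
  by under eq_fun do rewrite consrS; rewrite consrS; exact: coord_continuous.
by under eq_fun do rewrite consr0; rewrite consr0; exact: cvg_cst.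
Qed.

Lemma Cc_consr n x (F : 'rV[R]_n.+1 -> R) : Cc F -> Cc (fun q => F (consr x q)).
Proof.
move=> [cF [b hb]]; split.
  by move=> q; exact: (continuous_comp (@continuous_consrr _ _ q) (cF _)).
by exists b => q bq; rewrite hb// (lt_le_trans bq)// consr_norm2.
Qed.

Lemma integrable_Cc_cons n (F : 'rV[R]_n.+1 -> R) : Cc F ->
  (leb \x @lebesgue_tuple R n)%E.-integrable setT
    (fun p => (F (consr p.1 (t2r p.2)))%:E).
Proof.
move=> hF; have iF := integrable_Cc hF; have [cF _] := hF.
have mF : measurable_fun setT (EFin \o (F \o @t2r R n.+1)).
  by apply/measurable_EFinP; exact: measurable_Cc_t2r.
have E : (fun p : RT * n.-tuple RT => (F (consr p.1 (t2r p.2)))%:E) =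
    (EFin \o (F \o @t2r R n.+1)) \o @cons_pair R n.
  by apply/funext => p /=; rewrite t2r_cons.
apply/integrableP; split.
  by rewrite E; exact: (measurableT_comp mF (@measurable_cons_pair R n)).
move/integrableP : iF => [_]; apply: le_lt_trans.
(* [lebesgue_tuple n.+1] unfolds to this pushforward, so the change of variables starts with a
   conversion. *)
rewrite -[leRHS]/(\int[pushforward (leb \x @lebesgue_tuple R n)%E (@cons_pair R n)]_s
  `|(F (t2r s))%:E|)%E.
rewrite [leRHS](ge0_integral_pushforward (@measurable_cons_pair R n))//; last first.
  exact: (measurableT_comp _ mF).
rewrite preimage_setT le_eqVlt; apply/orP; left; apply/eqP.
by apply: eq_integral => p _ /=; rewrite t2r_cons.
Qed.

Lemma int_Rn_cons n (F : 'rV[R]_n.+1 -> R) : Cc F ->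
  (int_Rn F = \int[leb \x @lebesgue_tuple R n]_p (F (consr p.1 (t2r p.2)))%:E)%E.
Proof.
move=> hF; have [cF _] := hF.
have mF : measurable_fun setT (EFin \o (F \o @t2r R n.+1)).
  by apply/measurable_EFinP; exact: measurable_Cc_t2r.
have E : (fun p : RT * n.-tuple RT => (F (consr p.1 (t2r p.2)))%:E) =
    (EFin \o (F \o @t2r R n.+1)) \o @cons_pair R n.
  by apply/funext => p /=; rewrite t2r_cons.
rewrite -[LHS]/(\int[pushforward (leb \x @lebesgue_tuple R n)%E (@cons_pair R n)]_s
  (EFin \o (F \o @t2r R n.+1)) s)%E.
rewrite [LHS](integral_pushforward (@measurable_cons_pair R n) mF)//.
  by rewrite preimage_setT -E.
by rewrite preimage_setT -E; exact: integrable_Cc_cons.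
Qed.

(** Fubini and induction on the dimension. Along the first coordinate, integrating in that variable
    first leaves the integral of a derivative on the line; along another one, every slice vanishes
    by induction. *)
Lemma RI_derive0 n (i : 'I_n) (F D : 'rV[R]_n -> R) : Cc F -> Cc D ->
  (forall q, is_derive q (delta_mx 0 i) F (D q)) -> RI D = 0.
Proof.
move=> hF hD FD; rewrite /RI; suff -> : int_Rn D = 0%E by [].
elim: n i F D hF hD FD => [[]//|n IH] i F D hF hD FD.
rewrite int_Rn_cons//; have iD := integrable_Cc_cons hD.
have [j ij|i0] := unliftP ord0 i.
  rewrite -(integral12_prod_meas1 iD); apply: integral0_eq => x _.
  apply: (IH j (fun q => F (consr x q)) (fun q => D (consr x q))).
  - exact: Cc_consr.
  - exact: Cc_consr.
  - move=> q; apply: is_derive_reparam (FD (consr x q)) => h.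
    by rewrite consrDS ij.
rewrite -(integral21_prod_meas1 iD); apply: integral0_eq => s _.
have [b b0 hb] := Cc_bound hF.
apply: (@integral_derive0 (fun x => F (consr x (t2r s))) _ b).
- move=> x; apply: (continuous_comp (@continuous_consrl _ _ x)).
  by have [cD _] := hD; exact: cD.
- move=> x; apply: is_derive_reparam (FD (consr x (t2r s))) => h.
  by rewrite [h *: (1 : R)]mulr1 consrD0 i0.
- by move=> x bx; rewrite hb// (lt_le_trans bx)// consr_norm1.
Qed.

End divergence.

(** * Calculus of directional derivatives *)

Section derivative_rules.
Context {R : realType} {V : normedModType R}.
Implicit Types (f g : V -> R) (q v : V).

Lemma is_derive_cvg f q v d :
  h^-1 *: (f (h *: v + q) - f q) @[h --> (0 : R)^'] --> d -> is_derive q v f d.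
Proof.
move=> fd; split; first by apply/cvg_ex; exists d.
by apply/cvg_lim => //; exact: norm_hausdorff.
Qed.

Lemma derC (k : R) q v : is_derive q v (fun=> k) 0.
Proof. exact: is_derive_cst. Qed.

Lemma derD f g q v df dg : is_derive q v f df -> is_derive q v g dg ->
  is_derive q v (fun y => f y + g y) (df + dg).
Proof. by move=> hf hg; exact: is_deriveD. Qed.

Lemma derN f q v df : is_derive q v f df -> is_derive q v (fun y => - f y) (- df).
Proof. by move=> hf; exact: is_deriveN. Qed.

Lemma derB f g q v df dg : is_derive q v f df -> is_derive q v g dg ->
  is_derive q v (fun y => f y - g y) (df - dg).
Proof. by move=> hf hg; exact: is_deriveB. Qed.

Lemma derM f g q v df dg : is_derive q v f df -> is_derive q v g dg ->
  is_derive q v (fun y => f y * g y) (f q * dg + g q * df).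
Proof. by move=> hf hg; exact: is_deriveM. Qed.

Lemma derZ k f q v df : is_derive q v f df ->
  is_derive q v (fun y => k * f y) (k * df).
Proof.
by move=> hf; apply: is_derive_eq (derM (derC k q v) hf) _; rewrite mulr0 addr0.
Qed.

(** Partial derivatives alone do not make [f] differentiable, so the chain rule is applied to the
    restriction of [f] to the line through [q] directed by [v]. *)
Lemma der_comp (h : R -> R) f q v dh df : is_derive q v f df ->
  is_derive (f q) 1 h dh -> is_derive q v (fun y => h (f y)) (dh * df).
Proof.
move=> hf hh; pose F t := f (q + t *: v).
have hF : is_derive (0 : R) 1 F df by apply: is_derive1_line; rewrite scale0r addr0.
have hF0 : is_derive (F 0) 1 h dh by rewrite /F scale0r addr0.
apply: (@is_derive_reparam _ _ _ _ (h \o F) _ _ 0 1) => t.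
by rewrite /F/= [t *: (1 : R)]mulr1 addr0 addrC.
Qed.

Lemma derV f q v df : f q != 0 -> is_derive q v f df ->
  is_derive q v (fun y => (f y)^-1) (- (f q) ^- 2 * df).
Proof.
move=> f0 hf; apply: (der_comp (h := fun y => y^-1) hf).
have /is_derive_eq := @is_deriveV R id (f q) 1 1 f0 (is_derive_id _ _).
by apply; rewrite [_ *: (1 : R)]mulr1.
Qed.

Lemma derX k f q v df : is_derive q v f df ->
  is_derive q v (fun y => f y ^+ k.+1) (k.+1%:R * f q ^+ k * df).
Proof.
move=> hf; apply: (der_comp (h := fun y => y ^+ k.+1) hf).
split; first exact: exprn_derivable.
by rewrite exp_derive [_ *: (1 : R)]mulr1.
Qed.

Lemma der_sqrt f q v df : 0 < f q -> is_derive q v f df ->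
  is_derive q v (fun y => Num.sqrt (f y)) ((2 * Num.sqrt (f q))^-1 * df).
Proof. by move=> f0 hf; apply: der_comp hf _; exact: is_derive1_sqrt. Qed.

Lemma der_sum (I : Type) (r : seq I) (P : pred I) (F : I -> V -> R) dF q v :
  (forall i, is_derive q v (F i) (dF i)) ->
  is_derive q v (fun y => \sum_(i <- r | P i) F i y) (\sum_(i <- r | P i) dF i).
Proof.
move=> hF; elim: r => [|i r IH].
  by under eq_fun do rewrite big_nil; rewrite big_nil; exact: derC.
under eq_fun do rewrite big_cons; rewrite big_cons.
by case: (P i) => //; exact: derD.
Qed.

Lemma near_eq_der f g q v d : (\forall y \near q, f y = g y) ->
  is_derive q v f d -> is_derive q v g d.
Proof. exact: near_eq_is_derive. Qed.

Lemma der_continuous1 (f : R -> R) (x d : R) : is_derive x (1 : R) f d -> continuous_at x f.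
Proof.
by move=> [h _]; apply: differentiable_continuous; apply/derivable1_diffP.
Qed.

(** The intermediate point is bounded through [|t|] because difference quotients take increments of
    either sign. *)
Lemma MVT_line f q v (dF : V -> R) (t : R) :
  (forall y, is_derive y v f (dF y)) ->
  exists2 s, `|s| <= `|t| & f (q + t *: v) - f q = dF (q + s *: v) * t.
Proof.
move=> hf; pose F s := f (q + s *: v).
have hF s : is_derive s (1 : R) F (dF (q + s *: v)) by exact: is_derive1_line.
have cF a b : {within `[a, b], continuous F}.
  by apply: continuous_subspaceT => s; exact: der_continuous1.
have F0 : f q = F 0 by rewrite /F scale0r addr0.
have [t0|t0] := leP 0 t.
  have [s] := MVT_segment t0 (fun s _ => hF s) (cF _ _).
  rewrite in_itv/= => /andP[s0 st] E; exists s.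
    by rewrite !ger0_norm.
  by rewrite F0 [LHS]E subr0.
have [s] := MVT_segment (ltW t0) (fun s _ => hF s) (cF _ _).
rewrite in_itv/= => /andP[st s0] E; exists s.
  by rewrite !ler0_norm ?lerN2// ltW.
by rewrite F0 -opprB [F 0 - _]E sub0r mulrN opprK.
Qed.

End derivative_rules.

(** * Mollification *)

Section heine.
Context {R : realType} {n : nat}.
Implicit Types F : 'rV[R]_n -> R.

(** Heine's theorem on the ball of radius [b + 1]. Outside it, once [d <= 1], both points lie off
    the support. *)
Lemma Cc_unif F : Cc F -> forall e, 0 < e ->
  exists2 d, 0 < d & forall x y, `|x - y| <= d -> `|F x - F y| <= e.
Proof.
move=> hF e e0; have [cF _] := hF; have [b b0 hb] := Cc_bound hF.
have /compact_near_coveringP cB := @compact_ball_rV R n (b + 1).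
have /cB : forall x : 'rV[R]_n, `|x| <= b + 1 -> \forall x' \near x & d \near 0^'+,
    forall y, `|x' - y| <= d -> `|F x' - F y| <= e.
  move=> x _; have e2 : 0 < e / 2 by rewrite divr_gt0.
  have /cvgrPdist_le/(_ _ e2)/nbhs_ballP[r /= r0 hr] := cF x.
  have r2 : 0 < r / 2 by rewrite divr_gt0.
  exists (ball x (r / 2), [set d | d < r / 2]).
    by split => /=; [exact: nbhsx_ballx|exact: nbhs_right_lt].
  move=> [x' d] [/= xx' dr] y x'y.
  have h1 : `|F x - F x'| <= e / 2.
    by apply: hr; apply: le_ball xx'; rewrite ler_pdivrMr// mulr2n mulrDr mulr1 lerDl ltW.
  have h2 : `|F x - F y| <= e / 2.
    apply: hr; rewrite -ball_normE /= -(subrKA x') (le_lt_trans (ler_normD _ _))//.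
    by move: xx'; rewrite -ball_normE /= => xx'; lra.
  rewrite -(subrKA (F x)) (le_trans (ler_normD _ _))// distrC.
  by move: h1 h2; lra.
move=> h.
have : \forall d \near 0^'+, 0 < d /\ d <= 1 /\ forall x y : 'rV[R]_n,
    `|x| <= b + 1 -> `|x - y| <= d -> `|F x - F y| <= e.
  near=> d; split; first by near: d; exact: nbhs_right_gt.
  split; first by near: d; exact: nbhs_right_le.
  by move=> x y xb; move: x xb y; near: d.
move=> /filter_ex[d [d0 [d1 hd]]]; exists d => // x y xy.
have [xb|xb] := leP `|x| (b + 1); first exact: hd.
have hx : b < `|x| by move: xb; lra.
have hy : b < `|y|.
  have : `|x| <= `|y| + `|x - y| by rewrite addrC -[in leLHS](subrK y x) ler_normD.
  by move: xb xy d1; lra.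
by rewrite !hb// subrr normr0 ltW.
Unshelve. all: by end_near. Qed.

End heine.

Section smooth.
Context {R : realType}.

(** The family obtained from exp(-1/x) by differentiation: it is closed under derivatives when [p]
    varies, so smoothness is an induction. *)
Definition flat (p : {poly R}) (x : R) :=
  if 0 < x then p.[x^-1] * expR (- x^-1) else 0.

(** Induction on [p] for all rates at once: half of the exponential goes to the induction
    hypothesis, the other half absorbs the new factor [y]. *)
Lemma poly_expRN_bounded (p : {poly R}) (a : R) : 0 < a -> exists2 M, 0 <= M &
  forall y, 0 <= y -> `|p.[y]| * expR (- (a * y)) <= M.
Proof.
elim/poly_ind: p a => [|p c IH] a a0.
  by exists 0 => // y _; rewrite horner0 normr0 mul0r.
have a2 : 0 < a / 2 by rewrite divr_gt0.
have [M M0 hM] := IH _ a2.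
exists (M * (a / 2)^-1 + `|c|).
  by rewrite addr_ge0// mulr_ge0// invr_ge0 ltW.
move=> y y0; rewrite hornerMXaddC.
have ey : expR (- (a * y)) <= 1.
  by rewrite -expR0 ler_expR oppr_le0 mulr_ge0// ltW.
apply: (@le_trans _ _ ((`|p.[y] * y| + `|c|) * expR (- (a * y)))).
  by rewrite ler_wpM2r ?expR_ge0// ler_normD.
rewrite mulrDl lerD//; last by rewrite ler_piMr.
have -> : expR (- (a * y)) = expR (- (a / 2 * y)) * expR (- (a / 2 * y)).
  by rewrite -expRD; congr expR; field.
rewrite normrM mulrACA; apply: ler_pM.
- by rewrite mulr_ge0// expR_ge0.
- by rewrite mulr_ge0// expR_ge0.
- exact: hM.
rewrite ger0_norm// expRN ler_pdivrMr ?expR_gt0// ler_pdivlMl//.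
by rewrite (le_trans _ (expR_ge1Dx _))// lerDr.
Qed.

Lemma is_derive_flat p x :
  is_derive x (1 : R) (flat p) (flat ('X^2 * (p - p^`())) x).
Proof.
have [x0|x0|->] := ltgtP x 0.
- have -> : flat ('X^2 * (p - p^`())) x = 0 by rewrite /flat ltNge (ltW x0).
  apply: (@near_eq_der _ _ (fun=> 0)).
  apply: filterS (cvgr_lt x cvg_id _ x0) => y y0.
  by rewrite /flat ltNge (ltW y0).
- rewrite (_ : flat ('X^2 * (p - p^`())) x = ('X^2 * (p - p^`())).[x^-1] * expR (- x^-1)); last by rewrite /flat x0.
  have dV : is_derive x (1 : R) (fun y : R => y^-1) (- x ^- 2 * 1).
    by apply: (derV (f := id)); rewrite ?gt_eqF//.
  have dp : is_derive x^-1 (1 : R) (horner p) (p^`().[x^-1]).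
    by split; [exact: derivable_horner|rewrite -derive1E -derivE].
  have d1 := der_comp dV dp.
  have d2 := der_comp (derN dV) (is_derive_expR (- x^-1)).
  have := derM d1 d2.
  rewrite (_ : _ + _ = ('X^2 * (p - p^`())).[x^-1] * expR (- x^-1)); last first.
    by rewrite hornerM hornerXn hornerD hornerN exprVn; ring.
  apply: near_eq_der.
  by apply: filterS (cvgr_gt x cvg_id _ x0) => y y0; rewrite /flat y0.
- have -> : flat ('X^2 * (p - p^`())) 0 = 0 by rewrite /flat ltxx.
  (* At 0 the difference quotient of [flat p] is [h] times [flat ('X^2 * p) h], which is bounded. *)
  have [M M0 hM] := poly_expRN_bounded ('X^2 * p) ltr01.
  apply: is_derive_cvg; apply/cvgrPdist_le => e e0.
  near=> h; rewrite {2}/flat ltxx subr0 addr0 [h *: (1 : R)]mulr1 sub0r normrN.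
  rewrite /flat; case: ltP => h0; last by rewrite scaler0 normr0 ltW.
  have hn0 : h != 0 by rewrite gt_eqF.
  have -> : h^-1 *: (p.[h^-1] * expR (- h^-1)) =
      h * (('X^2 * p).[h^-1] * expR (- (1 * h^-1))).
    by rewrite [LHS]mulrA hornerM hornerXn mul1r; field.
  rewrite !normrM [`|expR _|]ger0_norm ?expR_ge0//.
  apply: (@le_trans _ _ (`|h| * M)).
    by rewrite ler_wpM2l// hM// invr_ge0 ltW.
  apply: (@le_trans _ _ (`|h| * (M + 1))).
    by rewrite ler_wpM2l// lerDl.
  rewrite -ler_pdivlMr ?ltr_wpDl//.
  by near: h; apply: (@dnbhs0_le _ R^o); rewrite divr_gt0// ltr_wpDl.
Unshelve. all: by end_near. Qed.

Lemma flat_ge0 x : 0 <= flat 1 x.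
Proof. by rewrite /flat; case: ltP => // _; rewrite hornerC mul1r expR_ge0. Qed.

Lemma flat_gt0 x : 0 < x -> 0 < flat 1 x.
Proof. by rewrite /flat => ->; rewrite hornerC mul1r expR_gt0. Qed.

Lemma flat_le0 p x : x <= 0 -> flat p x = 0.
Proof. by rewrite /flat ltNge => ->. Qed.

Lemma continuous_flat p : continuous (flat p).
Proof. by move=> x; exact: der_continuous1 (is_derive_flat p x). Qed.

End smooth.

Section Ck_closure.
Context {R : realType} {n : nat}.
Implicit Types u v : 'rV[R]_n -> R.
Notation e_ i := (delta_mx 0 i : 'rV[R]_n).

Lemma Ck_continuous k u : Ck k u -> continuous u.
Proof. by case: k => [|k] []. Qed.

Lemma Ck_step k u (du : 'I_n -> 'rV[R]_n -> R) : continuous u ->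
  (forall i q, is_derive q (e_ i) u (du i q)) -> (forall i, Ck k (du i)) ->
  Ck k.+1 u.
Proof.
move=> cu hu hdu; split=> // i; split=> [q|]; first by have [] := hu i q.
rewrite (_ : partial i u = du i)//; apply/funext => q.
by have [_ <-] := hu i q.
Qed.

Lemma Ck_der k u i q : Ck k.+1 u -> is_derive q (e_ i) u (partial i u q).
Proof. by move=> [_ /(_ i)[/(_ q) h _]]; exact: DeriveDef. Qed.

Lemma CkW k u : Ck k.+1 u -> Ck k u.
Proof.
elim: k u => [|k IH] u; first by move=> [].
by move=> [cu hu]; split=> // i; have [h1 h2] := hu i; split=> //; exact: IH.
Qed.

Lemma Ck_cst k (c : R) : Ck k (fun _ : 'rV[R]_n => c).
Proof.
elim: k c => [|k IH] c; first by split=> // q; exact: ctsC.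
refine (@Ck_step _ _ (fun _ _ => 0) _ _ _) => [q|i]; last exact: IH.
exact: ctsC.
Qed.

Lemma CkD k u v : Ck k u -> Ck k v -> Ck k (fun q => u q + v q).
Proof.
elim: k u v => [|k IH] u v hu hv.
  by split=> // q; apply: ctsD; [exact: (Ck_continuous hu)|exact: (Ck_continuous hv)].
refine (@Ck_step _ _ (fun i q => partial i u q + partial i v q) _ _ _) => [q|i q|i].
- by apply: ctsD; [exact: (Ck_continuous hu)|exact: (Ck_continuous hv)].
- exact: (derD (Ck_der i q hu) (Ck_der i q hv)).
- by apply: IH; [case: hu => _ /(_ i)[]|case: hv => _ /(_ i)[]].
Qed.

Lemma CkM k u v : Ck k u -> Ck k v -> Ck k (fun q => u q * v q).
Proof.
elim: k u v => [|k IH] u v hu hv.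
  by split=> // q; apply: ctsM; [exact: (Ck_continuous hu)|exact: (Ck_continuous hv)].
refine (@Ck_step _ _ (fun i q => u q * partial i v q + v q * partial i u q) _ _ _) => [q|i q|i].
- by apply: ctsM; [exact: (Ck_continuous hu)|exact: (Ck_continuous hv)].
- exact: (derM (Ck_der i q hu) (Ck_der i q hv)).
- apply: CkD; apply: IH.
  + exact: CkW.
  + by case: hv => _ /(_ i)[].
  + exact: CkW.
  + by case: hu => _ /(_ i)[].
Qed.

Lemma Ck_prod (I : Type) (r : seq I) (F : I -> 'rV[R]_n -> R) k :
  (forall i, Ck k (F i)) -> Ck k (fun q => \prod_(i <- r) F i q).
Proof.
move=> hF; elim: r => [|i r IH].
  by under eq_fun do rewrite big_nil; exact: Ck_cst.
by under eq_fun do rewrite big_cons; exact: CkM.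
Qed.

Lemma der_coord q (v : 'rV[R]_n) i : is_derive q v (fun y : 'rV[R]_n => y 0 i) (v 0 i).
Proof.
apply: is_derive_cvg; apply/cvgrPdist_le => e e0; near=> h.
have h0 : h != 0 by near: h; exact: nbhs_dnbhs_neq.
rewrite !mxE addrK [_ *: _]mulrA mulVf// mul1r subrr normr0 ltW//.
Unshelve. all: by end_near. Qed.

Lemma cts_coord q i : continuous_at q (fun y : 'rV[R]_n => y 0 i).
Proof. exact: coord_continuous. Qed.

Lemma Ck_flat k p (s c : R) i : Ck k (fun q : 'rV[R]_n => flat p (s * q 0 i + c)).
Proof.
have ca q : continuous_at q (fun q : 'rV[R]_n => s * q 0 i + c).
  by apply: ctsD; [apply: ctsM; [exact: ctsC|exact: cts_coord]|exact: ctsC].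
have cf p' q : continuous_at q (fun q : 'rV[R]_n => flat p' (s * q 0 i + c)).
  by apply: (cts_comp (ca q)); exact: continuous_flat.
elim: k p => [|k IH] p; first by split=> // q; exact: cf.
refine (@Ck_step _ _ (fun j q => s * (e_ j) 0 i *
    flat ('X^2 * (p - p^`())) (s * q 0 i + c)) _ _ _) => [q|j q|j]; first exact: cf.
  have := derD (derZ s (der_coord q (e_ j) i)) (derC c q (e_ j)).
  rewrite addr0 => h.
  by rewrite mulrC; exact: (der_comp h (is_derive_flat p _)).
by apply: CkM => //; exact: Ck_cst.
Qed.

End Ck_closure.

Lemma norm_delta1 (R : realType) n (i : 'I_n) : `|delta_mx 0 i : 'rV[R]_n| <= 1.
Proof.
apply: rV_norm_le => // j; rewrite mxE eqxx/=.
by case: (j == i); rewrite ?normr1 ?normr0.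
Qed.

Section cts_eps.
Context {R : realType} {V : normedModType R}.

Lemma cts_epsP (f : V -> R) q : continuous_at q f <->
  forall e, 0 < e -> exists2 d, 0 < d & forall y, `|q - y| <= d -> `|f q - f y| <= e.
Proof.
split=> [cf e e0|h].
  have /cvgrPdist_le/(_ _ e0)/nbhs_ballP[d /= d0 hd] := cf.
  exists (d / 2) => [|y qy]; first by rewrite divr_gt0.
  apply: hd; rewrite -ball_normE /= (le_lt_trans qy)//.
  by rewrite ltr_pdivrMr// mulr_natr mulr2n ltrDl.
apply/cvgrPdist_le => e e0; have [d d0 hd] := h e e0.
apply/nbhs_ballP; exists d => //= y.
by rewrite -ball_normE /= => /ltW; exact: hd.
Qed.

End cts_eps.

Lemma der_reflect (R : realType) (V : normedModType R) (F : V -> R) q y v d :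
  is_derive (q - y) v F d -> is_derive y v (fun y => F (q - y)) (- d).
Proof.
move=> hF; pose G t := F (q - y + t *: v).
have hG : is_derive (- 0 : R) (1 : R) G d.
  by apply: is_derive1_line; rewrite oppr0 scale0r addr0.
have := der_comp (derN (is_derive_id (0 : R) (1 : R))) hG.
rewrite mulrN mulr1 => H.
apply: (is_derive_reparam _ H) => h.
rewrite /G [h *: (1 : R)]mulr1 addr0 scaleNr; congr F.
by rewrite opprD addrCA addrC.
Qed.

Lemma scale_mul (R : realType) (a b : R) : a *: b = a * b.
Proof. by []. Qed.

Section mollifier.
Context {R : realType} {n : nat}.
Implicit Types (z F : 'rV[R]_n -> R) (q y : 'rV[R]_n).
Notation e_ i := (delta_mx 0 i : 'rV[R]_n).

(** A smooth kernel supported in the sup-norm ball of radius [e], not normalized. The coefficients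
    [1] and [-1] make both factors instances of [Ck_flat]. *)
Definition bump (e : R) q : R := \prod_i (flat 1 (1 * q 0 i + e) * flat 1 (-1 * q 0 i + e)).

Lemma bump_ge0 e q : 0 <= bump e q.
Proof. by apply: prodr_ge0 => i _; rewrite mulr_ge0// flat_ge0. Qed.

Lemma bump0 e : 0 < e -> 0 < bump e 0.
Proof.
move=> e0; apply: prodr_gt0 => i _.
by rewrite !mxE !mulr0 add0r mulr_gt0// flat_gt0.
Qed.

Lemma bump_supp e q : 0 <= e -> e < `|q| -> bump e q = 0.
Proof.
move=> e0 /(rV_norm_gt e0)[i]; rewrite real_lter_normr ?num_real// => /orP ei.
rewrite /bump (bigD1 i)//=; apply/eqP; rewrite mulf_eq0; apply/orP; left.
rewrite mulf_eq0; apply/orP; case: ei => ei; [right|left].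
  by rewrite flat_le0// mulN1r addrC subr_le0 ltW.
by rewrite flat_le0// mul1r -lerBrDr sub0r lerNr ltW.
Qed.

Lemma Cinfty_bump e : Cinfty (bump e).
Proof. by move=> k; apply: Ck_prod => i; apply: CkM; exact: Ck_flat. Qed.

Lemma partial_supp z b i : (forall q, b < `|q| -> z q = 0) ->
  forall q, b < `|q| -> partial i z q = 0.
Proof.
move=> hz q bq; rewrite /partial.
have : \forall y \near q, z y = (fun=> 0) y.
  by apply: filterS (cvgr_gt _ (@norm_continuous _ _ q) _ bq) => y; exact: hz.
by move=> h; rewrite (near_eq_derive _ h) derive_cst.
Qed.

Lemma Cc_shift F q : Cc F -> Cc (fun y => F (q - y)).
Proof.
move=> hF; have [cF _] := hF; have [b b0 hb] := Cc_bound hF; split.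
  move=> y; apply: (@continuous_comp _ _ _ (fun y => q - y) F); last exact: cF.
  exact: (continuousB (f := fun=> q) (g := id) (@cst_continuous _ _ q y) cvg_id).
exists (`|q| + b) => y yb; apply: hb.
have : `|y| <= `|q| + `|q - y|.
  by rewrite -[in leLHS](subKr q y) (le_trans (ler_normB _ _)).
by move: yb; lra.
Qed.

(** The point [q] enters through [F] only, so the regularity of the convolution is that of [F]. *)
Definition conv z F q := RI (fun y => z y * F (q - y)).

Lemma Cc_conv_integrand z F q : continuous z -> Cc F -> Cc (fun y => z y * F (q - y)).
Proof. by move=> cz hF; apply: CcMl => //; exact: Cc_shift. Qed.

Lemma conv_bound z b M F d : Cc z -> 0 <= b -> (forall y, b < `|y| -> z y = 0) ->
  (forall y, `|z y| <= M) -> Cc (fun y => z y * F y) ->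
  (forall y, `|F y| <= d) -> `|RI (fun y => z y * F y)| <= M * d * (2 * b) ^+ n.
Proof.
move=> hz b0 hb zM zF Fd.
have -> : (2 * b) ^+ n = \prod_(i < n) (2 * b) by rewrite prodr_const card_ord.
apply: RI_bound => // [q|q i bq].
  by rewrite normrM ler_pM.
by rewrite hb ?mul0r// (lt_le_trans bq)// rV_coord_le.
Qed.

Lemma continuous_conv z F : Cc z -> Cc F -> continuous (conv z F).
Proof.
move=> hz hF q; have [cz _] := hz.
have [b b0 hb] := Cc_bound hz; have [M M0 zM] := Cc_bounded hz.
apply/cts_epsP => e e0.
have C0 : 0 < M * (2 * b) ^+ n by rewrite mulr_gt0// exprn_gt0// mulr_gt0.
have [|d d0 hd] := Cc_unif hF (e := e / (M * (2 * b) ^+ n)); first by rewrite divr_gt0.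
exists d => // q' qq'; rewrite /conv -RIB; [|exact: Cc_conv_integrand|exact: Cc_conv_integrand].
under eq_fun do rewrite -mulrBr.
apply: (le_trans (conv_bound hz (ltW b0) hb zM (d := e / (M * (2 * b) ^+ n)) _ _)).
- by apply: CcMr => // y; apply: ctsB; apply: (Cc_shift _ hF).1.
- by move=> y; apply: hd; rewrite opprB addrA subrK.
- by rewrite mulrAC mulrC divfK// gt_eqF.
Qed.

(** By the mean value theorem the difference quotient of [F] is a value of [dF] at distance at most
    [|h|]; uniform continuity of [dF] then allows differentiation under the integral. *)
Lemma conv_der z F dF i q : Cc z -> Cc F -> Cc dF ->
  (forall y, is_derive y (e_ i) F (dF y)) ->
  is_derive q (e_ i) (conv z F) (conv z dF q).
Proof.
move=> hz hF hdF FdF; have [cz _] := hz.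
have [b b0 hb] := Cc_bound hz; have [M M0 zM] := Cc_bounded hz.
apply: is_derive_cvg; apply/cvgrPdist_le => e e0.
have C0 : 0 < M * (2 * b) ^+ n by rewrite mulr_gt0// exprn_gt0// mulr_gt0.
have [|d d0 hd] := Cc_unif hdF (e := e / (M * (2 * b) ^+ n)); first by rewrite divr_gt0.
near=> h.
have h0 : h != 0 by near: h; exact: nbhs_dnbhs_neq.
have hsd : `|h| <= d by near: h; exact: (@dnbhs0_le _ R^o).
have c1 := Cc_conv_integrand q cz hF.
have c2 := Cc_conv_integrand (h *: e_ i + q) cz hF.
have c3 := Cc_conv_integrand q cz hdF.
rewrite /conv -RIB// scale_mul -RIZ; last exact: CcB.
rewrite -RIB//; last by apply: CcZ; exact: CcB.
rewrite (_ : (fun _ => _) = (fun y => z y * (dF (q - y) -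
    h^-1 * (F (h *: e_ i + q - y) - F (q - y))))); last first.
  by apply/funext => y; ring.
apply: (le_trans (conv_bound hz (ltW b0) hb zM (d := e / (M * (2 * b) ^+ n)) _ _)).
- apply: CcMr => // y; apply: ctsB; first exact: (Cc_shift _ hdF).1.
  by apply: ctsM; [exact: ctsC|apply: ctsB; apply: (Cc_shift _ hF).1].
- move=> y.
  have [s sh] := MVT_line (q - y) h FdF.
  rewrite [h *: _ + q - y](_ : _ = q - y + h *: e_ i); last by rewrite -addrA addrC.
  move=> ->; rewrite mulrCA mulVf// mulr1; apply: hd.
  rewrite opprD addrA subrr sub0r normrN normrZ.
  by rewrite (le_trans _ hsd)// (le_trans _ sh)// ler_piMr// norm_delta1.
- by rewrite mulrAC mulrC divfK// gt_eqF.
Unshelve. all: by end_near. Qed.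

(** Integration by parts: up to sign, the difference of the integrands is the partial derivative in
    [y] of [z y * F (q - y)]. *)
Lemma conv_partial z dz F dF i q : Cc z -> Cc dz -> Cc F -> Cc dF ->
  (forall y, is_derive y (e_ i) z (dz y)) ->
  (forall y, is_derive y (e_ i) F (dF y)) ->
  conv z dF q = conv dz F q.
Proof.
move=> hz hdz hF hdF zdz FdF.
have [[cz _] [cdz _]] := (hz, hdz).
have c1 := Cc_conv_integrand q cz hdF.
have c2 := Cc_conv_integrand q cdz hF.
apply/eqP; rewrite -subr_eq0 /conv -RIB//; apply/eqP.
rewrite (_ : (fun _ => _) = (fun y => - (z y * (- dF (q - y)) + F (q - y) * dz y))).
  rewrite RIN; last first.
    apply: CcD; apply: CcMl => //; first exact/CcN/Cc_shift.
    exact: (Cc_shift q hF).1.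
  apply/eqP; rewrite oppr_eq0; apply/eqP.
  apply: (@RI_derive0 _ _ i (fun y => z y * F (q - y))).
  - exact: Cc_conv_integrand.
  - apply: CcD; apply: CcMl => //; first exact/CcN/Cc_shift.
    exact: (Cc_shift q hF).1.
  - move=> y; apply: derM => //.
    exact: der_reflect.
by apply/funext => y; ring.
Qed.

Lemma der0_cst (c : 'rV[R]_n -> R) :
  (forall i q, is_derive q (e_ i) c 0) -> forall q, c q = c 0.
Proof.
move=> hc q; rewrite [q in c q]row_sum_delta.
elim: (index_enum _) => [|i r IH]; first by rewrite big_nil.
rewrite big_cons addrC -IH; set p := \sum_(_ <- r) _.
have [s _] := MVT_line p (q 0 i) (hc i).
by rewrite mul0r => /eqP; rewrite subr_eq0 => /eqP.
Qed.

End mollifier.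

Section positivity.
Context {R : realType} {n : nat}.
Notation RT := (measurableTypeR R).

Lemma RI_ge0 (F : 'rV[R]_n -> R) : (forall q, 0 <= F q) -> 0 <= RI F.
Proof. by move=> F0; rewrite RIE; apply: Rintegral_ge0 => s _; exact: F0. Qed.

Lemma RI_gt0 (F : 'rV[R]_n -> R) q0 :
  Cc F -> (forall q, 0 <= F q) -> 0 < F q0 -> 0 < RI F.
Proof.
move=> hF F0 Fq0; have [cF _] := hF.
have F2 : 0 < F q0 / 2 by rewrite divr_gt0.
have /cts_epsP/(_ _ F2)[d d0 hd] := cF q0.
pose A (i : 'I_n) : set RT := `[q0 0 i - d, q0 0 i + d]%classic.
have mA i : measurable (A i) by exact: measurable_itv.
pose B := [set s : n.-tuple RT | forall i, A i (tnth s i)].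
have mB : measurable B by exact: measurable_tuple_box.
have muB : lebesgue_tuple B = ((2 * d) ^+ n)%:E.
  rewrite /B lebesgue_tuple_box//.
  rewrite (eq_bigr (fun=> (2 * d)%:E)) => [|i _].
    by rewrite prodEFin prodr_const card_ord.
  rewrite lebesgue_measure_itv/= lte_fin ltrD2l gtrN// -EFinD; congr _%:E; ring.
rewrite -lte_fin -(int_Rn_RI hF).
apply: (@lt_le_trans _ _ ((F q0 / 2)%:E * lebesgue_tuple B)%E).
  by rewrite muB -EFinM lte_fin mulr_gt0// exprn_gt0// mulr_gt0.
rewrite -(setIT B) -integral_indic// -ge0_integralZl//; last 2 first.
- by apply/measurable_EFinP; exact: measurable_indic.
- by rewrite lee_fin ltW.
apply: ge0_le_integral => //.
- by move=> s _; rewrite mule_ge0 ?lee_fin// ltW.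
- by apply: emeasurable_funM => //; apply/measurable_EFinP; exact: measurable_indic.
- by apply/measurable_EFinP; exact: measurable_Cc_t2r.
move=> s _; rewrite -EFinM lee_fin indicE.
have [sB|_] := boolP (s \in B); last by rewrite mulr0; exact: F0.
have /hd : `|q0 - t2r s| <= d.
  apply: rV_norm_le => [|i]; first exact: ltW.
  have := set_mem sB i; rewrite /A/= in_itv/= !mxE ler_distlC => /andP[h1 h2].
  by rewrite lerBlDr; apply/andP; split; move: h1 h2; lra.
by rewrite mulr1 ler_distlC => /andP[h _]; move: h; rewrite -/(t2r s); lra.
Qed.

End positivity.

Section density.
Context {R : realType} {n : nat}.
Implicit Types (z F : 'rV[R]_n -> R) (q y : 'rV[R]_n).
Notation e_ i := (delta_mx 0 i : 'rV[R]_n).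

Lemma Cc_bump e : 0 <= e -> Cc (@bump R n e).
Proof.
move=> e0; split; first exact: (Ck_continuous (Cinfty_bump e 0)).
by exists e => q; exact: bump_supp.
Qed.

Lemma Cc_partial_bump e i : 0 <= e -> Cc (partial i (@bump R n e)).
Proof.
move=> e0; split.
  by have [_ /(_ i)[_ [h _]]] := @Cinfty_bump R n e 1.
by exists e; apply: partial_supp => q; exact: bump_supp.
Qed.

(** Multiplication by a plateau turns a continuous function into a [Cc] one without changing it on a
    given ball. *)
Lemma Cc_plateau r : 0 <= r -> exists2 z : 'rV[R]_n -> R, Cc z &
  forall q, `|q| <= r -> z q = 1.
Proof.
move=> r0; exists (fun q => Num.min 1 (Num.max 0 (r + 1 - `|q|))).
  split.
    move=> q; apply: cts_min; first exact: ctsC.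
    apply: cts_max; first exact: ctsC.
    by apply: ctsB; [exact: ctsC|exact: norm_continuous].
  exists (r + 1) => q qr; rewrite (max_idPl _) ?min_r//.
  by rewrite subr_le0 ltW.
by move=> q qr; rewrite (max_idPr _) ?min_l//; move: qr; lra.
Qed.

(** Translation invariance for this one integrand, without a change of variables: the derivative in
    [q] of the mass is, up to sign, the integral of a partial derivative in [y], hence 0. *)
Lemma bump_mass e : 0 < e ->
  exists2 c, 0 < c & forall q, RI (fun y => bump e (q - y)) = c.
Proof.
move=> e0; have hb := Cc_bump (ltW e0).
exists (RI (fun y => bump e (0 - y))).
  apply: (@RI_gt0 _ _ _ 0); first exact: Cc_shift.
    by move=> y; exact: bump_ge0.
  by rewrite subr0 bump0.
apply: der0_cst => i q.
(* This radius makes the plateau equal to 1 on the support of every translate with center within 1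
   of [q], so the mass is a [conv] near [q]. *)
have [|z hz z1] := @Cc_plateau (`|q| + 1 + e).
  by rewrite !addr_ge0// ltW.
have z1' q' y : `|q'| <= `|q| + 1 -> e < `|q' - y| \/ z y = 1.
  move=> q'q; have [h|h] := ltP e `|q' - y|; [by left|right; apply: z1].
  rewrite -(subKr q' y) (le_trans (ler_normB _ _))//.
  exact: lerD.
have hdb := Cc_partial_bump i (ltW e0).
have dbump y : is_derive y (e_ i) (bump e) (partial i (bump e) y).
  exact: (Ck_der _ _ (Cinfty_bump e 1)).
have := conv_der q hz hb hdb dbump.
have -> : conv z (partial i (bump e)) q = 0.
  rewrite /conv (_ : (fun _ => _) = (fun y => - - partial i (bump e) (q - y))).
    rewrite RIN; last exact/CcN/Cc_shift.
    apply/eqP; rewrite oppr_eq0; apply/eqP.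
    apply: (@RI_derive0 _ _ i (fun y => bump e (q - y))).
    - exact: Cc_shift.
    - exact/CcN/Cc_shift.
    - by move=> y; exact: der_reflect.
  apply/funext => y; rewrite opprK.
  have [|h|->] := z1' q y; rewrite ?mul1r ?lerDl//.
  rewrite (@partial_supp _ _ _ e) ?mulr0// => y'; exact/bump_supp/ltW.
apply: near_eq_der; apply/nbhs_ballP; exists 1 => //= q'.
rewrite -ball_normE /= => qq'; rewrite /conv; congr RI; apply/funext => y.
have [|h|->] := z1' q' y; rewrite ?mul1r//.
  rewrite -(subKr q q') (le_trans (ler_normB _ _))// lerD2l ltW//.
by rewrite bump_supp ?mulr0// ltW.
Qed.

Lemma Ck_conv k b z F : Cc z -> Ck k F -> (forall q, b < `|q| -> F q = 0) ->
  Ck k (conv z F).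
Proof.
move=> hz; elim: k F => [|k IH] F hF hb.
  have cF : Cc F by split; [case: hF|exists b].
  by split; [exact: continuous_conv|].
have cF : Cc F by split; [exact: (Ck_continuous hF)|exists b].
refine (@Ck_step _ _ _ _ (fun i => conv z (partial i F)) _ _ _) => [|i q|i].
- exact: continuous_conv.
- apply: conv_der => //; last by move=> y; exact: (Ck_der i y hF).
  split; last by exists b; exact: partial_supp.
  by have [_ /(_ i)[_ h]] := hF; exact: (Ck_continuous h).
- apply: IH; last exact: partial_supp.
  by case: hF => _ /(_ i)[].
Qed.

Lemma conv_approx F e r c q : Cc F -> 0 < r -> 0 < c ->
  (forall q, RI (fun y => bump r (q - y)) = c) ->
  (forall x y, `|x - y| <= r -> `|F x - F y| <= e) ->
  `|c^-1 * conv F (bump r) q - F q| <= e.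
Proof.
move=> hF r0 c0 hc hr; have hb := Cc_bump (ltW r0); have [cF _] := hF.
have e0 : 0 <= e by have := hr 0 0; rewrite !subrr !normr0; apply; exact: ltW.
have h1 := Cc_conv_integrand q cF hb.
have h2 := CcZ (F q) (Cc_shift q hb).
have h3 := CcZ e (Cc_shift q hb).
have : `|conv F (bump r) q - F q * c| <= e * c.
  rewrite -(hc q) -!RIZ; [|exact: Cc_shift|exact: Cc_shift].
  rewrite ler_distl -RIB// -RID//; apply/andP; split; apply: RI_le => //.
  - exact: CcB.
  - move=> y; rewrite -mulrBl.
    have [h|h] := leP `|q - y| r; last by rewrite bump_supp ?mulr0// ltW.
    rewrite ler_wpM2r ?bump_ge0//.
    by have := hr _ _ h; rewrite ler_distl => /andP[]; lra.
  - exact: CcD.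
  - move=> y; rewrite -mulrDl.
    have [h|h] := leP `|q - y| r; last by rewrite bump_supp ?mulr0// ltW.
    rewrite ler_wpM2r ?bump_ge0//.
    by have := hr _ _ h; rewrite ler_distl => /andP[]; lra.
rewrite -ler_pdivrMr// -[X in _ / X](gtr0_norm c0) -normf_div mulrBl mulfK ?gt_eqF//.
by rewrite mulrC.
Qed.

(** The derivatives of the mollification are moved onto [z] by [conv_partial], so uniform continuity
    of the [dz i] gives uniform closeness. The last clause keeps the support where [u] stays away
    from 0. *)
Lemma smooth_approx z dz : Cc z -> (forall i, Cc (dz i)) ->
  (forall i q, is_derive q (e_ i) z (dz i q)) -> (forall q, 0 <= z q) ->
  forall e, 0 < e -> exists xi : 'rV[R]_n -> R,
  [/\ test_function xi, forall q, 0 <= xi q,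
      forall q, `|xi q - z q| <= e,
      forall i q, `|partial i xi q - dz i q| <= e &
      forall q, xi q != 0 -> exists2 y, `|q - y| <= e & z y != 0].
Proof.
move=> hz hdz zdz z0 e e0.
have [d d0 hd] := Cc_unif hz e0.
have /(@fin_all_exists2 _ _ _ _) [dd dd0 hdd] :
  forall i, exists2 d', 0 < d' & forall x y, `|x - y| <= d' -> `|dz i x - dz i y| <= e.
  by move=> i; exact: Cc_unif.
pose r := Num.min (Num.min e d) (\big[Num.min/1]_i dd i).
have r0 : 0 < r.
  rewrite !lt_min e0 d0/=; elim/big_ind: _ => // x y x0 y0.
  by rewrite lt_min x0.
have [re rd] : r <= e /\ r <= d by rewrite /r !ge_min !lexx/= orbT.
have rdd i : r <= dd i by rewrite /r ge_min; apply/orP; right; exact: bigmin_le.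
have [c c0 hc] := bump_mass r0.
have hb := Cc_bump (ltW r0).
have Cxi : Cinfty (fun q => c^-1 * conv z (bump r) q).
  move=> k; apply: CkM; first exact: Ck_cst.
  by apply: (@Ck_conv _ r) => //; [exact: Cinfty_bump|move=> q; exact/bump_supp/ltW].
have [b b0 hzb] := Cc_bound hz.
have supp q : c^-1 * conv z (bump r) q != 0 -> exists2 y, `|q - y| <= e & z y != 0.
  apply: contraPP => h; apply/negP; rewrite negbK /conv.
  rewrite (_ : (fun _ => _) = (fun=> 0)) ?RI0 ?mulr0//.
  apply/funext => y; have [qy|qy] := leP `|q - y| r; last first.
    by rewrite bump_supp ?mulr0// ltW.
  have [->|zy] := eqVneq (z y) 0; first by rewrite mul0r.
  by exfalso; apply: h; exists y => //; exact: le_trans re.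
exists (fun q => c^-1 * conv z (bump r) q); split => //.
- split=> //; apply: (subclosed_compact _ (@compact_ball_rV R n (b + e))).
    exact: closed_closure.
  have /closure_id -> : closed [set q : 'rV[R]_n | `|q| <= b + e].
    by apply: compact_closed; [exact: norm_hausdorff|exact: compact_ball_rV].
  apply: closureS => q /supp[y qy zy] /=.
  rewrite -(subrK y q) (le_trans (ler_normD _ _))// addrC lerD//.
  by rewrite leNgt; apply/negP => /hzb yb; move: zy; rewrite yb eqxx.
- move=> q; apply: mulr_ge0; first by rewrite invr_ge0 ltW.
  by apply: RI_ge0 => y; apply: mulr_ge0 => //; exact: bump_ge0.
- by move=> q; apply: conv_approx => // x y /le_trans/(_ rd); exact: hd.
- move=> i q; have hdb := Cc_partial_bump i (ltW r0).
  have dbump y : is_derive y (e_ i) (bump r) (partial i (bump r) y).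
    exact: (Ck_der _ _ (Cinfty_bump r 1)).
  rewrite [X in `|X - _|]/partial.
  have [_ ->] := derZ c^-1 (conv_der q hz hb hdb dbump).
  rewrite (conv_partial q hz (hdz i) hb hdb (zdz i) dbump).
  by apply: conv_approx => // x y /le_trans/(_ (rdd i)); exact: hdd.
Qed.

End density.

(** * The radial profile *)

Section one_dimensional.
Context {R : realType}.
Notation leb := (@lebesgue_measure R).
Implicit Types (F : R -> R).

(** Differentiability is asked inside only: most functions below are merely continuous at 0. *)
Lemma der_le F (dF : R -> R) a b : a <= b ->
  (forall x, a <= x <= b -> continuous_at x F) ->
  (forall x, a < x < b -> is_derive x (1 : R) F (dF x)) ->
  (forall x, a < x < b -> 0 <= dF x) -> F a <= F b.
Proof.
move=> ab cF hF dF0.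
have cab : {within `[a, b], continuous F}.
  by apply: continuous_in_subspaceT => x /set_mem; rewrite /= in_itv/=; exact: cF.
move: ab; rewrite le_eqVlt => /predU1P[->//|ab].
have hF' x : x \in `]a, b[%R -> is_derive x (1 : R) F (dF x).
  by rewrite in_itv/=; exact: hF.
have [c cab'] := MVT ab hF' cab.
rewrite -subr_ge0 => ->; rewrite mulr_ge0 ?subr_ge0 ?(ltW ab)//.
by apply: dF0; move: cab'; rewrite in_itv.
Qed.

Lemma der_lt F (dF : R -> R) a b : a < b ->
  (forall x, a <= x <= b -> continuous_at x F) ->
  (forall x, a < x < b -> is_derive x (1 : R) F (dF x)) ->
  (forall x, a < x < b -> 0 < dF x) -> F a < F b.
Proof.
move=> ab cF hF dF0.
have cab : {within `[a, b], continuous F}.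
  by apply: continuous_in_subspaceT => x /set_mem; rewrite /= in_itv/=; exact: cF.
have hF' x : x \in `]a, b[%R -> is_derive x (1 : R) F (dF x).
  by rewrite in_itv/=; exact: hF.
have [c cab'] := MVT ab hF' cab.
rewrite -subr_gt0 => ->; rewrite mulr_gt0 ?subr_gt0//.
by apply: dF0; move: cab'; rewrite in_itv.
Qed.

Lemma continuous_IVT F a b y : (forall x, continuous_at x F) -> a <= b ->
  F a <= y <= F b -> exists2 x, a <= x <= b & F x = y.
Proof.
move=> cF ab /andP[ay yb].
have [||x xab Fx] := @IVT R F a b y ab.
- exact: continuous_subspaceT.
- by rewrite ge_min ay le_max yb orbT.
by exists x => //; move: xab; rewrite in_itv.
Qed.

(** [F] need not be onto: outside its range [G] is an arbitrary choice, and every clause is stated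
    at a point of the range. *)
Lemma increasing_inverse F : (forall x, continuous_at x F) ->
  (forall x y, x < y -> F x < F y) ->
  exists G : R -> R, [/\ forall x, G (F x) = x, forall x, continuous_at (F x) G &
    forall x d, d != 0 -> is_derive x (1 : R) F d ->
      is_derive (F x) (1 : R) G d^-1].
Proof.
move=> cF iF.
have injF x y : F x = F y -> x = y.
  by have [/iF|/iF|//] := ltgtP x y; [move=> + e|move=> + e]; rewrite e ltxx.
pose G y := get [set x | F x = y].
have GF x : G (F x) = x.
  by apply: injF; rewrite /G; apply: (@getPex _ [set x' | F x' = F x]); exists x.
exists G; split => // [x|x d d0 hd].
  have : {near F x, continuous G}.
    by apply: near_can_continuous; near=> y => //; exact: cF.
  exact: nbhs_singleton.
by apply: is_derive_inverse => //; near=> y => //; exact: cF.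
Unshelve. all: by end_near. Qed.

(** Extension by a constant below 0 turns continuity within the half-line into continuity on the
    whole line. *)
Lemma within0y_continuous F : {within `[0, +oo[, continuous F} ->
  forall x : R, continuous_at x (fun y => F (Num.max y 0)).
Proof.
move=> cF x; apply/cts_epsP => e e0.
have m0 (y : R) : `[0, +oo[%classic (Num.max y 0).
  by rewrite /= in_itv/= andbT le_max lexx orbT.
have /cvgrPdist_le/(_ e e0) := (subspace_continuousP _ _).1 cF _ (m0 x).
rewrite near_withinE => /nbhs_ballP[d /= d0 hd].
exists (d / 2) => [|y xy]; first by rewrite divr_gt0.
apply: (hd _ _ (m0 y)) => /=.
have d2 : d / 2 < d by rewrite ltr_pdivrMr// mulr_natr mulr2n ltrDl.
apply: le_lt_trans d2; apply: le_trans xy.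
have [x0|x0] := leP x 0; have [y0|y0] := leP y 0.
- by rewrite subrr normr0.
- by rewrite sub0r normrN gtr0_norm// distrC ger0_norm; lra.
- by rewrite subr0 gtr0_norm// ger0_norm; lra.
- by [].
Qed.

(** * Primitives of functions singular at 0 *)

Section int0_facts.
Context (F : R -> R) (F_L1 : L1_0 F).
Context (F_cts : forall t : R, 0 < t -> continuous_at t F).

(** The interval is split into a neighbourhood of 0, where integrability is assumed, a compact part,
    where [F] is continuous, and the null set {0}, where its value is arbitrary. *)
Lemma int0_integrable b : leb.-integrable `[0, b] (EFin \o F).
Proof.
have [e e0 iF] := F_L1; pose e' := e / 2; have e'0 : 0 < e' by rewrite divr_gt0.
have e'e : e' <= e by rewrite ler_pdivrMr// mulr_natr mulr2n lerDl ltW.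
pose c := Num.max b e.
have ec : e' <= c by rewrite le_max e'e orbT.
apply: (@integrableS _ _ _ leb `[0, c]%classic).
- exact: measurable_itv.
- exact: measurable_itv.
- by apply: subset_itvl; rewrite bnd_simp le_max lexx.
have i1 : leb.-integrable setT ((EFin \o F) \_ `]0, e'[).
  rewrite -integrable_mkcond; last exact: measurable_itv.
  apply: integrableS iF; [exact: measurable_itv|exact: measurable_itv|].
  by apply: subset_itvl; rewrite bnd_simp.
have i2 : leb.-integrable setT ((EFin \o F) \_ `[e', c]).
  rewrite -integrable_mkcond; last exact: measurable_itv.
  apply: continuous_compact_integrable; first exact: segment_compact.
  apply: continuous_in_subspaceT => x /set_mem; rewrite /= in_itv/= => /andP[ex _].
  by apply: F_cts; exact: lt_le_trans ex.
have i3 : leb.-integrable setT ((EFin \o F) \_ [set 0]).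
  rewrite -integrable_mkcond; last exact: measurable_set1.
  apply: null_set_integrable; [exact: measurable_set1|exact: measurable_fun_set1|].
  exact: lebesgue_measure_set1.
rewrite integrable_mkcond; last exact: measurable_itv.
apply: (eq_integrable _ _ _ _ (integrableD measurableT (integrableD measurableT i1 i2) i3)) => //.
move=> x _ /=; rewrite !patchE !mem_setE /=.
rewrite !in_itv/= (_ : (x \in [set 0]) = (x == 0)); last first.
  by apply/idP/eqP => [/set_mem//|->]; exact/mem_set.
have [x0|x0|->] := ltgtP x 0.
- by rewrite (lt_geF (lt_trans x0 e'0))/= !adde0.
- have [xe|xe] := ltP x e'; rewrite /= !adde0 ?add0e//.
  by rewrite (ltW (lt_le_trans xe ec)).
- by rewrite (le_trans (ltW e'0) ec) lt_geF//= !add0e.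
Qed.

Lemma der_int0 (t : R) : 0 < t -> is_derive t (1 : R) (int0 F) (F t).
Proof.
move=> t0; have t1 : t < t + 1 by rewrite ltrDl.
have [h1 h2] := continuous_FTC1_closed t1 (int0_integrable _) t0 (F_cts t0).
by split => //; rewrite -derive1E.
Qed.

Lemma int0_le0 (t : R) : t <= 0 -> int0 F t = 0.
Proof.
rewrite /int0 le_eqVlt => /predU1P[->|t0]; first by rewrite set_itv1 Rintegral_set1.
by rewrite set_itv_ge ?Rintegral_set0// bnd_simp -ltNge.
Qed.

Lemma continuous_int0 (t : R) : continuous_at t (int0 F).
Proof.
have [t0|t0|->] := ltgtP t 0.
- rewrite /continuous_at int0_le0 ?ltW//; apply: cvg_near_cst.
  by apply: filterS (cvgr_lt t cvg_id _ t0) => s /ltW; exact: int0_le0.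
- exact: (der_continuous1 (der_int0 t0)).
- rewrite /continuous_at int0_le0//.
  exact: parameterized_integral_cvg_left ltr01 (int0_integrable 1).
Qed.

End int0_facts.

End one_dimensional.

Lemma L1_0_continuous (R : realType) (F G : R -> R) :
  (forall x, continuous_at x F) -> (forall t : R, 0 < t -> G t = F t) -> L1_0 G.
Proof.
move=> cF GF; exists 1 => //.
have : (@lebesgue_measure R).-integrable `[0, 1] (EFin \o F).
  apply: continuous_compact_integrable; first exact: segment_compact.
  exact: continuous_subspaceT.
move=> iF.
have : (@lebesgue_measure R).-integrable `]0, 1[ (EFin \o F).
  apply: integrableS iF; [exact: measurable_itv|exact: measurable_itv|].
  exact: subset_itv_oo_cc.
apply: eq_integrable => // x /set_mem; rewrite /= in_itv/= => /andP[x0 _].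
by rewrite GF.
Qed.

Lemma powR_le1 (R : realType) (x a : R) : 0 <= x -> x <= 1 -> 0 <= a -> x `^ a <= 1.
Proof.
move=> x0 x1 a0; have := @ge0_ler_powR R a a0 x 1; rewrite powR1 !nnegrE.
by apply.
Qed.

Lemma subr_le_bound (R : realType) (s1 s2 m r C : R) :
  0 <= s1 -> s1 - m <= s2 - r -> s2 <= C -> r - m <= C.
Proof. by lra. Qed.

(** * The functions phi and K, the energy and the profile *)

Section K_facts.
Context {R : realType} (phi : R -> R) (D tau B theta : R).
Context (phi_cont : {within `[0, +oo[, continuous phi})
  (phi_derivable : forall t : R, 0 < t -> derivable phi t 1)
  (phi'_cont : forall t : R, 0 < t -> {for t, continuous (derive1 phi)})
  (phi0 : phi 0 = 0)
  (phi'_gt0 : forall t : R, 0 < t -> 0 < derive1 phi t)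
  (phi'_L1 : L1_0 (fun t => t * derive1 phi t))
  (D_gt0 : 0 < D) (tau_ge0 : 0 <= tau)
  (phi'_upper : forall s t : R, 0 < s <= 1 -> 0 < t ->
    s * derive1 phi (s * t) <= D * s `^ tau * derive1 phi t)
  (B_gt0 : 0 < B) (theta_lt2 : theta < 2)
  (phi'_lower : forall t s : R, 0 < t -> 1 <= s ->
    B * derive1 phi t * s `^ (- theta) <= derive1 phi (t * s)).
Notation dphi := (derive1 phi).
Notation lam := (2 - theta).

Lemma der_phi (t : R) : 0 < t -> is_derive t (1 : R) phi (dphi t).
Proof. by move=> t0; split; [exact: phi_derivable|rewrite derive1E]. Qed.

(* Extended by the identity below 0, to be inverted on all of R. *)
Definition phie (x : R) := phi (Num.max x 0) + Num.min x 0.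

Lemma phie_ge0 (x : R) : 0 <= x -> phie x = phi x.
Proof. by move=> x0; rewrite /phie max_l// min_r// addr0. Qed.

Lemma phie_le0 (x : R) : x <= 0 -> phie x = x.
Proof. by move=> x0; rewrite /phie max_r// min_l// phi0 add0r. Qed.

Lemma continuous_phie (x : R) : continuous_at x phie.
Proof.
apply: ctsD; first exact: within0y_continuous.
by apply: cts_min; [exact: cvg_id|exact: ctsC].
Qed.

Lemma der_phie (t : R) : 0 < t -> is_derive t (1 : R) phie (dphi t).
Proof.
move=> t0; apply: near_eq_der (der_phi t0).
by apply: filterS (cvgr_gt t cvg_id _ t0) => y /ltW y0; rewrite phie_ge0.
Qed.

Lemma phi_lt (s t : R) : 0 <= s -> s < t -> phi s < phi t.
Proof.
move=> s0 st; rewrite -!phie_ge0 ?(le_trans s0 (ltW st))//.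
apply: (@der_lt _ _ dphi) => // x.
- by move=> _; exact: continuous_phie.
- by move=> /andP[sx _]; apply: der_phie; exact: le_lt_trans sx.
- by move=> /andP[sx _]; apply: phi'_gt0; exact: le_lt_trans sx.
Qed.

Lemma phi_le (s t : R) : 0 <= s -> s <= t -> phi s <= phi t.
Proof.
by move=> s0; rewrite le_eqVlt => /predU1P[->//|st]; exact/ltW/phi_lt.
Qed.

Lemma phi_ge0 (t : R) : 0 <= t -> 0 <= phi t.
Proof. by move=> t0; rewrite -phi0 phi_le. Qed.

Lemma phie_lt (x y : R) : x < y -> phie x < phie y.
Proof.
move=> xy; have [x0|x0] := leP 0 x.
  by rewrite !phie_ge0 ?(le_trans x0 (ltW xy))//; exact: phi_lt.
rewrite (phie_le0 (ltW x0)); have [y0|y0] := leP 0 y; last by rewrite phie_le0// ltW.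
by rewrite phie_ge0// (lt_le_trans x0)// phi_ge0.
Qed.

(** [phi'_upper] with [s = x^-1] gives phi'(x) >= phi'(1) / (D x) for x > 1, so [phi] grows at least
    logarithmically. *)
Lemma phi_unbounded (y : R) : exists2 x, 0 <= x & y <= phi x.
Proof.
pose k := dphi 1 / D.
have k0 : 0 < k by rewrite divr_gt0// phi'_gt0.
pose F x := phie x - k * ln x.
exists (expR (Num.max (y / k) 0)); first exact: expR_ge0.
set z := expR _; have z1 : 1 <= z by rewrite -expR0 ler_expR le_max lexx orbT.
have : F 1 <= F z.
  apply: (@der_le _ _ (fun x => dphi x - k * x^-1)) => // x.
  - move=> /andP[x1 _]; apply: ctsB; first exact: continuous_phie.
    apply: ctsM; first exact: ctsC.
    by apply: continuous_ln; exact: lt_le_trans x1.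
  - move=> /andP[x1 _]; have x0 : 0 < x by exact: lt_trans x1.
    by apply: derB; [exact: der_phie|apply: derZ; exact: is_derive1_ln].
  - move=> /andP[x1 _]; have x0 : 0 < x by exact: lt_trans x1.
    rewrite subr_ge0 /k mulrAC ler_pdivrMr//.
    have := @phi'_upper x^-1 x; rewrite invr_gt0 x0 invf_le1// (ltW x1) mulVf ?gt_eqF//.
    move=> /(_ isT isT) h; rewrite mulrC (le_trans h)//.
    rewrite [leRHS]mulrC mulrAC; apply: ler_piMr.
      by rewrite mulr_ge0// ltW// phi'_gt0.
    by rewrite powR_le1 ?invr_ge0 ?(ltW x0)// invf_le1// ltW.
rewrite /F ln1 mulr0 subr0 (phie_ge0 ler01) (phie_ge0 (le_trans ler01 z1)) /z expRK.
have h1 := phi_ge0 ler01.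
have : y <= k * Num.max (y / k) 0.
  by rewrite -ler_pdivrMl// mulrC le_max lexx.
by move: h1; lra.
Qed.

Lemma der_K (t : R) : 0 < t -> is_derive t (1 : R) (K phi) (t * dphi t).
Proof.
move=> t0; apply: der_int0 => // s s0.
by apply: ctsM; [exact: cvg_id|exact: phi'_cont].
Qed.

Lemma continuous_K (t : R) : continuous_at t (K phi).
Proof.
apply: continuous_int0 => // s s0.
by apply: ctsM; [exact: cvg_id|exact: phi'_cont].
Qed.

Lemma K_le0 (t : R) : t <= 0 -> K phi t = 0.
Proof. exact: int0_le0. Qed.

Lemma K_lt (s t : R) : 0 <= s -> s < t -> K phi s < K phi t.
Proof.
move=> s0 st; apply: (@der_lt _ _ (fun x => x * dphi x)) => // x.
- by move=> _; exact: continuous_K.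
- by move=> /andP[sx _]; apply: der_K; exact: le_lt_trans sx.
- move=> /andP[sx _]; have x0 := le_lt_trans s0 sx.
  by rewrite mulr_gt0// phi'_gt0.
Qed.

Lemma K_le (s t : R) : 0 <= s -> s <= t -> K phi s <= K phi t.
Proof.
by move=> s0; rewrite le_eqVlt => /predU1P[->//|st]; exact/ltW/K_lt.
Qed.

Lemma K_ge0 (t : R) : 0 <= K phi t.
Proof.
have [t0|t0] := leP t 0; first by rewrite K_le0.
by rewrite -(K_le0 (lexx 0)) K_le// ltW.
Qed.

(** Both sides vanish at [t = 0], and their derivatives in [t] are compared by [phi'_lower]; the
    chain rule supplies the factor s^2 in s^(2 - theta). *)
Lemma K_scale (t s : R) : 0 <= t -> 1 <= s -> B * s `^ lam * K phi t <= K phi (t * s).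
Proof.
move=> t0 s1; have s0 : 0 < s by exact: lt_le_trans s1.
pose F x := K phi (x * s) - B * s `^ lam * K phi x.
have : F 0 <= F t.
  apply: (@der_le _ _ (fun x => (x * s) * dphi (x * s) * s - B * s `^ lam * (x * dphi x))) => // x.
  - move=> _; apply: ctsB.
      apply: cts_comp; last exact: continuous_K.
      by apply: ctsM; [exact: cvg_id|exact: ctsC].
    by apply: ctsM; [exact: ctsC|exact: continuous_K].
  - move=> /andP[x0 _].
    have := derM (is_derive_id x (1 : R)) (derC s x (1 : R)).
    rewrite mulr0 add0r mulr1 => d1.
    exact: (derB (der_comp d1 (der_K (mulr_gt0 x0 s0))) (derZ _ (der_K x0))).
  - move=> /andP[x0 _]; rewrite subr_ge0.
    have -> : s `^ lam = s ^+ 2 * s `^ (- theta).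
      rewrite powRD; last by rewrite (gt_eqF s0) implybT.
      by rewrite -powR_mulrn ?(ltW s0).
    have -> : x * s * dphi (x * s) * s = s ^+ 2 * x * dphi (x * s) by ring.
    have -> : B * (s ^+ 2 * s `^ (- theta)) * (x * dphi x) =
      s ^+ 2 * x * (B * dphi x * s `^ (- theta)) by ring.
    by rewrite ler_pM2l ?mulr_gt0 ?exprn_gt0//; exact: phi'_lower.
by rewrite /F mul0r K_le0// mulr0 subrr subr_ge0.
Qed.

(** Half the argument leaves room for the mean value theorem: K(p) - K(p/2) = (p/2) x phi'(x) for
    some x in ]p/2, p[, and [phi'_upper] compares x phi'(x) with its value at p/2. The left side is
    the quantity that bounds [g]. *)
Lemma K_half (p : R) : 0 < p -> (p / 2) ^+ 2 * dphi (p / 2) <= D * K phi p.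
Proof.
move=> p0; have p2 : 0 < p / 2 by rewrite divr_gt0.
have p2p : p / 2 < p by rewrite ltr_pdivrMr// mulr_natr mulr2n ltrDl.
have hK x : x \in `]p / 2, p[%R -> is_derive x (1 : R) (K phi) (x * dphi x).
  by rewrite in_itv/= => /andP[px _]; apply: der_K; exact: lt_trans px.
have [|c] := MVT p2p hK.
  by apply: continuous_subspaceT => x; exact: continuous_K.
rewrite in_itv/= => /andP[pc cp] E.
have c0 : 0 < c by exact: lt_trans pc.
have := @phi'_upper (p / 2 / c) c; rewrite divr_gt0// ler_pdivrMr// mul1r (ltW pc).
move=> /(_ isT c0); rewrite divfK ?gt_eqF// => h.
have {h} h : p / 2 * dphi (p / 2) <= D * (c * dphi c).
  have h1 : (p / 2 / c) `^ tau <= 1.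
    by rewrite powR_le1 ?divr_ge0 ?(ltW p0) ?(ltW c0)// ler_pdivrMr// mul1r ltW.
  rewrite -(ler_pM2r (x := c^-1)) ?invr_gt0//.
  rewrite mulrAC; apply: (le_trans h).
  rewrite [leRHS](_ : _ = D * dphi c); last by field; rewrite gt_eqF.
  rewrite mulrAC ler_piMr// mulr_ge0// ?ltW// phi'_gt0//.
have : p / 2 * (p / 2 * dphi (p / 2)) <= p / 2 * (D * (c * dphi c)).
  by rewrite ler_pM2l.
have -> : p / 2 * (D * (c * dphi c)) = D * (K phi p - K phi (p / 2)).
  by rewrite E; field.
rewrite mulrA -expr2 => /le_trans; apply.
by rewrite ler_pM2l// gerBl K_ge0.
Qed.

Lemma K_surj (y : R) : 0 <= y -> exists2 x, 0 <= x & K phi x = y.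
Proof.
move=> y0; have K1 : 0 < K phi 1 by rewrite -(K_le0 (lexx 0)) K_lt.
have lam0 : 0 < lam by rewrite subr_gt0.
pose a := y / (B * K phi 1).
have a0 : 0 <= a by rewrite divr_ge0// mulr_ge0 ?ltW.
(* Chosen so that B s^lam K(1) >= y; the maximum with 1 makes [K_scale] applicable. *)
pose s := Num.max 1 (a `^ lam^-1).
have s1 : 1 <= s by rewrite le_max lexx.
have s0 : 0 <= s by exact: le_trans s1.
have [|x /andP[x0 _] <-] := @continuous_IVT _ (K phi) 0 s y continuous_K s0; last by exists x.
rewrite K_le0// y0/= -[s]mul1r (le_trans _ (K_scale ler01 s1))//.
rewrite mulrAC mulrC -ler_pdivrMr; last by rewrite mulr_gt0.
have -> : y / (B * K phi 1) = (a `^ lam^-1) `^ lam.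
  by rewrite -powRrM mulVf ?gt_eqF// powRr1.
by rewrite ge0_ler_powR ?nnegrE ?powR_ge0// ?le_max ?lexx ?orbT// ltW.
Qed.

Lemma KinvK (x : R) : 0 <= x -> Kinv phi (K phi x) = x.
Proof.
move=> x0; rewrite /Kinv pinvKV//; last by rewrite inE/= in_itv/= x0.
move=> a b; rewrite !inE/= !in_itv/= !andbT => a0 b0 ab.
have [h|h|//] := ltgtP a b.
- by have := K_lt a0 h; rewrite ab ltxx.
- by have := K_lt b0 h; rewrite ab ltxx.
Qed.

Context (f h : R -> R).
Context (f_cont : {within `[0, +oo[, continuous f})
  (f_incr : forall s t : R, 0 <= s -> s < t -> f s < f t)
  (f_gt0 : forall t : R, 0 < t -> 0 < f t)
  (h_cont : forall t : R, 0 < t -> {for t, continuous h})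
  (h_ge0 : forall t : R, 0 < t -> 0 <= h t)
  (h_noninc : forall s t : R, 0 < s -> s <= t -> h t <= h s)
  (h_L1 : L1_0 h).
Notation H := (int0 h).
Notation Fh := (Fhat theta f h).

Lemma f_le (s t : R) : 0 <= s -> s <= t -> f s <= f t.
Proof. by move=> s0; rewrite le_eqVlt => /predU1P[->//|st]; exact/ltW/f_incr. Qed.

Lemma f_ge0 (t : R) : 0 <= t -> 0 <= f t.
Proof.
rewrite le_eqVlt => /predU1P[<-|/f_gt0/ltW//].
have cf := @within0y_continuous _ _ f_cont 0.
rewrite leNgt; apply/negP => f0.
have : \forall y \near 0^'+, f (Num.max y 0) < 0.
  by apply: cvg_within; apply: (cvgr_lt _ cf); rewrite maxxx.
have : \forall y \near (0 : R)^'+, 0 < y by exact: nbhs_right_gt.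
move=> h1 h2; have [y [y0]] := filter_ex (filterI h1 h2).
by rewrite max_l ?ltW// ltNge ltW// f_gt0.
Qed.

Lemma continuous_f (t : R) : 0 < t -> continuous_at t f.
Proof.
move=> t0; have cf := @within0y_continuous _ _ f_cont t.
have e : f t = f (Num.max t 0) by rewrite max_l// ltW.
rewrite /continuous_at e; apply: cvg_trans cf; apply: near_eq_cvg.
by apply: filterS (cvgr_gt t cvg_id _ t0) => y y0; rewrite max_l// ltW.
Qed.

Lemma der_H (t : R) : 0 < t -> is_derive t (1 : R) H (h t).
Proof. exact: der_int0. Qed.

Lemma continuous_H (t : R) : continuous_at t H.
Proof. exact: continuous_int0. Qed.

Lemma H_ge0 (t : R) : 0 <= H t.
Proof.
have [t0|t0] := leP t 0; first by rewrite int0_le0.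
rewrite -(int0_le0 h (lexx 0)); apply: (@der_le _ _ h) => [|x _|x /andP[x0 _]|x /andP[x0 _]].
- exact: ltW.
- exact: continuous_H.
- exact: der_H.
- exact: h_ge0.
Qed.

Lemma continuous_expH (t : R) : continuous_at t (fun s => expR (lam * H s)).
Proof.
apply: cts_comp; last exact: continuous_expR.
by apply: ctsM; [exact: ctsC|exact: continuous_H].
Qed.

Lemma der_expH (t : R) : 0 < t ->
  is_derive t (1 : R) (fun s => expR (lam * H s)) (expR (lam * H t) * (lam * h t)).
Proof.
by move=> t0; exact: (der_comp (derZ lam (der_H t0)) (is_derive_expR _)).
Qed.

Lemma Fhat_L1 : L1_0 (fun s => f s * expR (lam * H s)).
Proof.
apply: (@L1_0_continuous _ (fun s => f (Num.max s 0) * expR (lam * H s))) => [t|t t0].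
  by apply: ctsM; [exact: within0y_continuous|exact: continuous_expH].
by rewrite max_l// ltW.
Qed.

Lemma continuous_Fhat_integrand (t : R) : 0 < t ->
  continuous_at t (fun s => f s * expR (lam * H s)).
Proof.
by move=> t0; apply: ctsM; [exact: continuous_f|exact: continuous_expH].
Qed.

Lemma der_Fhat (t : R) : 0 < t -> is_derive t (1 : R) Fh (f t * expR (lam * H t)).
Proof. by apply: der_int0; [exact: Fhat_L1|exact: continuous_Fhat_integrand]. Qed.

Lemma continuous_Fhat (t : R) : continuous_at t Fh.
Proof. by apply: continuous_int0; [exact: Fhat_L1|exact: continuous_Fhat_integrand]. Qed.

Lemma Fhat_gt0 (t : R) : 0 < t -> 0 < Fh t.
Proof.
move=> t0; rewrite -(int0_le0 (fun s => f s * expR (lam * H s)) (lexx 0)).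
apply: (@der_lt _ _ (fun s => f s * expR (lam * H s))) => [|x _|x /andP[x0 _]|x /andP[x0 _]] //.
- exact: continuous_Fhat.
- exact: der_Fhat.
- by rewrite mulr_gt0 ?expR_gt0// f_gt0.
Qed.

(* Replaces Fhat: 0 < En' <= f and lam * h * En <= f, so the gradient term is
   controlled by f along the profile. *)
Definition En (t : R) := expR (- (lam * H t)) * Fh t.
Definition dEn (t : R) := f t - lam * h t * En t.

Lemma continuous_En (t : R) : continuous_at t En.
Proof.
apply: ctsM; last exact: continuous_Fhat.
apply: cts_comp; last exact: continuous_expR.
by apply: ctsN; apply: ctsM; [exact: ctsC|exact: continuous_H].
Qed.

Lemma En_le0 (t : R) : t <= 0 -> En t = 0.
Proof. by move=> t0; rewrite /En [Fh t]int0_le0// mulr0. Qed.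

Lemma En_gt0 (t : R) : 0 < t -> 0 < En t.
Proof. by move=> t0; rewrite mulr_gt0 ?expR_gt0// Fhat_gt0. Qed.

Lemma En_ge0 (t : R) : 0 <= En t.
Proof. by have [/En_le0->//|/En_gt0/ltW] := leP t 0. Qed.

Lemma der_En (t : R) : 0 < t -> is_derive t (1 : R) En (dEn t).
Proof.
move=> t0.
have d1 := der_comp (derN (derZ lam (der_H t0))) (is_derive_expR (- (lam * H t))).
apply: is_derive_eq (derM d1 (der_Fhat t0)) _; rewrite /dEn /En.
have -> : expR (- (lam * H t)) * (f t * expR (lam * H t)) = f t.
  by rewrite mulrCA -expRD addNr expR0 mulr1.
by ring.
Qed.

Lemma continuous_dEn (t : R) : 0 < t -> continuous_at t dEn.
Proof.
move=> t0; apply: ctsB; first exact: continuous_f.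
apply: ctsM; last exact: continuous_En.
by apply: ctsM; [exact: ctsC|exact: h_cont].
Qed.

Lemma lam_gt0 : 0 < lam. Proof. by rewrite subr_gt0. Qed.

(* Comparing [h t <= h s] and [f s <= f t] for s <= t under the integral. *)
Lemma dEn_ge (t : R) : 0 < t -> f t * expR (- (lam * H t)) <= dEn t.
Proof.
move=> t0; pose G s := f t * expR (lam * H s) - lam * h t * Fh s.
have : G 0 <= G t.
  apply: (@der_le _ _ (fun s => f t * (expR (lam * H s) * (lam * h s)) -
    lam * h t * (f s * expR (lam * H s)))) => [|x _|x /andP[x0 _]|x /andP[x0 xt]].
  - exact: ltW.
  - apply: ctsB; apply: ctsM; [exact: ctsC|exact: continuous_expH|exact: ctsC|].
    exact: continuous_Fhat.
  - exact: (derB (derZ _ (der_expH x0)) (derZ _ (der_Fhat x0))).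
  - have -> : f t * (expR (lam * H x) * (lam * h x)) -
      lam * h t * (f x * expR (lam * H x)) =
      lam * expR (lam * H x) * (f t * h x - f x * h t) by ring.
    rewrite mulr_ge0// ?mulr_ge0 ?expR_ge0 ?(ltW lam_gt0)// subr_ge0.
    by apply: ler_pM; rewrite ?h_ge0 ?f_ge0 ?f_le ?h_noninc// ltW.
(* [H] and [Fhat] vanish at 0, so [G 0 = f t], while [expR (- (lam * H t)) * G t] is [dEn t]. *)
rewrite /G int0_le0// [Fh 0]int0_le0// !mulr0 expR0 mulr1 subr0 => h1.
have : expR (- (lam * H t)) * f t <=
    expR (- (lam * H t)) * (f t * expR (lam * H t) - lam * h t * Fh t).
  by rewrite ler_pM2l ?expR_gt0.
rewrite mulrC => /le_trans; apply; rewrite mulrBr /dEn /En.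
have -> : expR (- (lam * H t)) * (f t * expR (lam * H t)) = f t.
  by rewrite mulrCA -expRD addNr expR0 mulr1.
rewrite lerD2l lerN2 le_eqVlt; apply/orP; left; apply/eqP; ring.
Qed.

Lemma dEn_gt0 (t : R) : 0 < t -> 0 < dEn t.
Proof.
by move=> t0; apply: lt_le_trans (dEn_ge t0); rewrite mulr_gt0 ?expR_gt0// f_gt0.
Qed.

Lemma dEn_le (t : R) : 0 < t -> dEn t <= f t.
Proof.
move=> t0; rewrite /dEn gerBl mulr_ge0 ?En_ge0// mulr_ge0 ?h_ge0//.
exact/ltW/lam_gt0.
Qed.

Lemma h_En_le (t : R) : 0 < t -> h t * En t <= f t / lam.
Proof.
move=> t0; rewrite ler_pdivlMr ?lam_gt0// -subr_ge0.
have -> : h t * En t * lam = lam * h t * En t by ring.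
exact: ltW (dEn_gt0 t0).
Qed.

Lemma En_lt (s t : R) : 0 <= s -> s < t -> En s < En t.
Proof.
move=> s0 st; apply: (@der_lt _ _ dEn) => [//|x _|x /andP[sx _]|x /andP[sx _]].
- exact: continuous_En.
- by apply: der_En; exact: le_lt_trans sx.
- by apply: dEn_gt0; exact: le_lt_trans sx.
Qed.

Lemma En_le (s t : R) : 0 <= s -> s <= t -> En s <= En t.
Proof. by move=> s0; rewrite le_eqVlt => /predU1P[->//|st]; exact/ltW/En_lt. Qed.

Lemma Kinv_Fhat (t : R) : 0 < t ->
  0 < Kinv phi (Fh t) /\ K phi (Kinv phi (Fh t)) = Fh t.
Proof.
move=> t0; have F0 := Fhat_gt0 t0; have [x x0 xF] := K_surj (ltW F0).
rewrite -xF KinvK//; split => //; rewrite lt_neqAle x0 andbT; apply/eqP => x00.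
by move: F0; rewrite -xF -x00 K_le0// ltxx.
Qed.

(** This is [K_scale] with [s = expR (H t)]: the factor s^lam turns [Fhat] into [En]. *)
Lemma K_Kinv_le (t : R) : 0 < t ->
  K phi (Kinv phi (Fh t) / expR (H t)) <= En t / B.
Proof.
move=> t0; have [a0 aF] := Kinv_Fhat t0.
have e1 : 1 <= expR (H t) by rewrite -expR0 ler_expR H_ge0.
have := K_scale (divr_ge0 (ltW a0) (expR_ge0 (H t))) e1.
rewrite divfK ?gt_eqF ?expR_gt0// aF => h1.
rewrite ler_pdivlMr// /En mulrC expRN ler_pdivlMl ?expR_gt0//.
by move: h1; rewrite /powR gt_eqF ?expR_gt0// expRK mulrCA mulrA.
Qed.

(** The Keller-Osserman integrand. By [K_Kinv_le] it dominates the inverse of the number at which K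
    equals [En t / B]. *)
Definition chi (t : R) := expR (H t) / Kinv phi (Fh t).

Lemma continuous_chi (t : R) : 0 < t -> continuous_at t chi.
Proof.
move=> t0; have [a0 aF] := Kinv_Fhat t0.
pose Ke x := K phi x + Num.min x 0.
have Ke_ge0 x : 0 <= x -> Ke x = K phi x by move=> x0; rewrite /Ke min_r// addr0.
have Ke_le0 x : x <= 0 -> Ke x = x by move=> x0; rewrite /Ke K_le0// min_l// add0r.
have [||G [GK cG _]] := @increasing_inverse R Ke.
- move=> x; apply: ctsD; first exact: continuous_K.
  by apply: cts_min; [exact: cvg_id|exact: ctsC].
- move=> x y xy; have [x0|x0] := leP 0 x.
    by rewrite !Ke_ge0 ?(le_trans x0 (ltW xy))// K_lt.
  rewrite (Ke_le0 _ (ltW x0)); have [y0|y0] := leP y 0; first by rewrite Ke_le0.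
  by rewrite Ke_ge0 ?(ltW y0)// (lt_le_trans x0)// K_ge0.
have KG s : 0 < s -> Kinv phi (Fh s) = G (Fh s).
  by move=> s0; have [b0 bF] := Kinv_Fhat s0; rewrite -[in RHS]bF -Ke_ge0 ?GK ?ltW.
apply: ctsM.
  by apply: cts_comp; [exact: continuous_H|exact: continuous_expR].
apply: ctsV; first by rewrite gt_eqF.
have c1 : continuous_at t (fun s => G (Fh s)).
  apply: cts_comp; first exact: continuous_Fhat.
  by rewrite -aF -Ke_ge0 ?ltW//; exact: cG.
rewrite /continuous_at KG//; apply: cvg_trans c1; apply: near_eq_cvg.
by apply: filterS (cvgr_gt t cvg_id _ t0) => s s0; rewrite KG.
Qed.

Context (Keller_Osserman :
    L1_infty (fun t => expR (int0 h t) / Kinv phi (Fhat theta f h t))).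

Lemma KO_gt0 : exists2 a, 0 < a &
  (@lebesgue_measure R).-integrable `]a, +oo[ (EFin \o chi).
Proof.
have [a ia] := Keller_Osserman; exists (Num.max a 1); first by rewrite lt_max ltr01 orbT.
apply: integrableS ia; [exact: measurable_itv|exact: measurable_itv|].
by apply: subset_itvr; rewrite bnd_simp le_max lexx.
Qed.

(** If [En] stayed below [M], [chi] would stay above a positive constant and could not be integrable
    at infinity. *)
Lemma En_unbounded (M : R) : exists2 t, 0 < t & M < En t.
Proof.
apply: contrapT => hM.
have {hM} hM t : 0 < t -> En t <= M.
  by move=> t0; rewrite leNgt; apply/negP => Mt; apply: hM; exists t.
have M0 : 0 <= M by rewrite (le_trans (En_ge0 1))// hM.
have [X X0 KX] := K_surj (divr_ge0 M0 (ltW B_gt0)).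
have [a a0 ia] := KO_gt0.
have chiX t : 0 < t -> 0 < X /\ X^-1 <= chi t.
  move=> t0; have [b0 bF] := Kinv_Fhat t0.
  have bX : Kinv phi (Fh t) / expR (H t) <= X.
    rewrite leNgt; apply/negP => /(K_lt X0); rewrite KX ltNge => /negP; apply.
    by rewrite (le_trans (K_Kinv_le t0))// ler_pM2r ?invr_gt0// hM.
  have b1 : 0 < Kinv phi (Fh t) / expR (H t) by rewrite divr_gt0// expR_gt0.
  have X1 := lt_le_trans b1 bX; split => //.
  by rewrite /chi -[leRHS]invrK invfM invrK mulrC lef_pV2// posrE.
have [X1 _] := chiX _ a0.
have : (@lebesgue_measure R).-integrable `]a, +oo[ (EFin \o (fun=> X^-1)).
  apply: le_integrable ia; [exact: measurable_itv|exact: measurable_cst|].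
  move=> x /=; rewrite in_itv/= andbT => ax.
  have [_ xX] := chiX _ (lt_trans a0 ax).
  rewrite lee_fin ger0_norm ?invr_ge0// ger0_norm// (le_trans _ xX)// invr_ge0 ltW//.
move=> /integrableP[_].
under eq_integral do rewrite /= ger0_norm ?invr_ge0//.
rewrite integral_cst//= lebesgue_measure_itv/= ltry/=.
by rewrite gt0_muley ?lte_fin ?invr_gt0// ?ltxx.
Qed.

Lemma phi_inverse : exists P : R -> R, [/\ forall w, phie (P w) = w,
  forall x, P (phie x) = x, forall w, continuous_at w P &
  forall w : R, 0 < w -> 0 < P w /\ is_derive w (1 : R) P (dphi (P w))^-1].
Proof.
have [P [PK cP dP]] := increasing_inverse continuous_phie phie_lt.
have surj w : exists x, phie x = w.
  have [w0|w0] := leP w 0; first by exists w; rewrite phie_le0.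
  have [b b0 wb] := phi_unbounded w.
  have [|x _ <-] := continuous_IVT (y := w) continuous_phie b0; last by exists x.
  by rewrite phie_le0// (ltW w0) phie_ge0.
have KP w : phie (P w) = w by have [x <-] := surj w; rewrite PK.
exists P; split => // [w|w w0]; first by rewrite -{1}(KP w); exact: cP.
have Pw0 : 0 < P w.
  rewrite ltNge; apply/negP => Pw0; move: (w0).
  by rewrite -(KP w) phie_le0// ltNge Pw0.
split => //; rewrite -{1}(KP w); apply: dP; last exact: der_phie.
by rewrite gt_eqF// phi'_gt0.
Qed.

Lemma En_inverse : exists Ei : R -> R, [/\
  forall y, 0 <= y -> 0 <= Ei y /\ En (Ei y) = y,
  forall t, 0 <= t -> Ei (En t) = t,
  forall y : R, 0 <= y -> continuous_at y Ei &
  forall y : R, 0 < y -> is_derive y (1 : R) Ei (dEn (Ei y))^-1].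
Proof.
pose Ee x := En x + Num.min x 0.
have Ee_ge0 x : 0 <= x -> Ee x = En x by move=> x0; rewrite /Ee min_r// addr0.
have Ee_le0 x : x <= 0 -> Ee x = x by move=> x0; rewrite /Ee En_le0// min_l// add0r.
have cE x : continuous_at x Ee.
  apply: ctsD; first exact: continuous_En.
  by apply: cts_min; [exact: cvg_id|exact: ctsC].
have iE x y : x < y -> Ee x < Ee y.
  move=> xy; have [x0|x0] := leP 0 x.
    by rewrite !Ee_ge0 ?(le_trans x0 (ltW xy))// En_lt.
  rewrite (Ee_le0 _ (ltW x0)); have [y0|y0] := leP y 0; first by rewrite Ee_le0.
  by rewrite Ee_ge0 ?(ltW y0)// (lt_le_trans x0)// En_ge0.
have [Ei [EK cEi dEi]] := increasing_inverse cE iE.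
have surj y : 0 <= y -> 0 <= Ei y /\ En (Ei y) = y.
  move=> y0; have [b b0 /ltW yb] := En_unbounded y.
  have [|x /andP[x0 _] <-] := continuous_IVT (y := y) continuous_En (ltW b0).
    by rewrite En_le0// y0.
  by rewrite -(Ee_ge0 _ x0) EK Ee_ge0.
exists Ei; split => // [t t0|y y0|y y0].
- by rewrite -Ee_ge0.
- have [e0 eE] := surj y y0.
  by rewrite -{1}eE -(Ee_ge0 _ e0); exact: cEi.
- have [e0 eE] := surj y (ltW y0).
  have e1 : 0 < Ei y.
    rewrite lt_neqAle e0 andbT; apply/eqP => e00.
    by move: y0; rewrite -eE -e00 En_le0// ltxx.
  rewrite -{1}eE -(Ee_ge0 _ e0); apply: dEi; first by rewrite gt_eqF// dEn_gt0.
  apply: near_eq_der (der_En e1).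
  by apply: filterS (cvgr_gt _ cvg_id _ e1) => x /ltW x0; rewrite Ee_ge0.
Qed.

(* Along the level [t = l w] reached at speed [P w], the speed dominates a
   multiple of [chi t]^-1, so that the total travel time is finite. *)
Lemma speed_chi (t1 e : R) : 0 < e -> e < t1 -> exists2 k, 0 < k &
  forall t x, t1 <= t -> 0 < x -> K phi x = En t - En e -> k / x <= chi t.
Proof.
move=> e0 et1; have t10 := lt_trans e0 et1.
(* Beyond [t1] the subtraction of [En e] costs only a factor: En t - En e >= kap * En t. *)
pose kap := 1 - En e / En t1.
have kap0 : 0 < kap by rewrite subr_gt0 ltr_pdivrMr ?En_gt0// mul1r En_lt// ltW.
pose c := kap * B * B.
have c0 : 0 < c by rewrite !mulr_gt0.
(* Makes K(k y) <= kap * En t for [y] the inverse of [chi t]. One factor [B] in [c] comes from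
   [K_Kinv_le], the other from [K_scale], which is applied with ratio k^-1 and so needs k <= 1. *)
pose k := Num.min 1 (c `^ lam^-1).
have k0 : 0 < k by rewrite lt_min ltr01 powR_gt0.
exists k => // t x t1t x0 Kx; have t0 := lt_le_trans t10 t1t.
have [a0 aF] := Kinv_Fhat t0.
set y := Kinv phi (Fh t) / expR (H t).
have y0 : 0 < y by rewrite divr_gt0// expR_gt0.
have Ky : K phi y <= En t / B by exact: K_Kinv_le.
have kapE : kap * En t <= K phi x.
  rewrite Kx /kap mulrBl mul1r lerD2l lerN2 -mulrA ler_peMr ?En_ge0//.
  by rewrite ler_pdivlMl ?En_gt0// mulr1 En_le// ltW.
have kk : k `^ lam <= c.
  apply: (@le_trans _ _ ((c `^ lam^-1) `^ lam)).
    by rewrite ge0_ler_powR ?nnegrE ?powR_ge0 ?(ltW k0) ?(ltW lam_gt0)// ge_min lexx orbT.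
  by rewrite -powRrM mulVf ?gt_eqF ?lam_gt0// powRr1// ltW.
have kyx : k * y <= x.
  rewrite leNgt; apply/negP => /(K_lt (ltW x0)); apply/negP; rewrite -leNgt.
  apply: le_trans kapE.
  have k1 : 1 <= k^-1 by rewrite invf_ge1// ge_min lexx.
  have := K_scale (mulr_ge0 (ltW k0) (ltW y0)) k1.
  rewrite [k * y / k]mulrAC divff ?gt_eqF// mul1r => h1.
  have : B * (k^-1) `^ lam * K phi (k * y) <= En t / B by exact: le_trans h1 Ky.
  have -> : (k^-1) `^ lam = (k `^ lam)^-1.
    by rewrite /powR !gt_eqF ?invr_gt0// lnV ?posrE// mulrN expRN.
  rewrite ler_pdivlMr// mulrAC -mulrA mulrAC ler_pdivrMr ?powR_gt0// => h2.
  rewrite -(ler_pM2l (x := B * B)) ?mulr_gt0//.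
  apply: (@le_trans _ _ (En t * k `^ lam)).
    by apply: le_trans h2; rewrite le_eqVlt; apply/orP; left; apply/eqP; ring.
  apply: (@le_trans _ _ (En t * c)); first by rewrite ler_wpM2l ?En_ge0.
  by rewrite le_eqVlt; apply/orP; left; apply/eqP; rewrite /c; ring.
have -> : chi t = y^-1 by rewrite /chi /y invfM invrK mulrC.
by rewrite ler_pdivrMr// ler_pdivlMl// mulrC.
Qed.

(* The profile V' = p, K p = En V - En e on a bounded maximal interval [dom],
   parametrized by the flux phi (p r). *)
Lemma barrier_profile (e : R) : 0 < e ->
  exists (T : R) (dom : R -> Prop) (V p Y : R -> R),
  [/\ dom 0 /\ (exists2 r, 0 < r & dom r),
      (forall r : R, dom r -> 0 <= r <= T),
      (forall r s : R, dom s -> 0 <= r -> r <= s -> dom r),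
      (forall U : R, exists2 r, dom r & U < V r) &
  [/\ V 0 = e, p 0 = 0,
    (forall r : R, dom r -> [/\ continuous_at r V, continuous_at r p, e <= V r,
      0 <= p r & phi (p r) <= r * f (V r)]) &
    (forall r : R, dom r -> 0 < r -> 0 < p r /\
     [/\ is_derive r (1 : R) V (p r),
         is_derive r (1 : R) p (Y r / dphi (p r)),
         continuous_at r Y, 0 <= Y r <= f (V r) &
         h (V r) * ((p r / 2) ^+ 2 * dphi (p r / 2)) <= D * (f (V r) / lam)])]].
Proof.
move=> e0.
have [P [phieP Pphie cP dP]] := phi_inverse.
have [Ei [EiP EiK cEi dEi]] := En_inverse.
have P_le0 (w : R) : w <= 0 -> P w = w by move=> w0; rewrite -[w in P w](phie_le0 w0) Pphie.
have P_ge0 (w : R) : 0 <= w -> 0 <= P w.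
  rewrite le_eqVlt => /predU1P[<-|w0]; first by rewrite P_le0.
  by have [/ltW] := dP w w0.
pose q w := K phi (P w).
have cq (w : R) : continuous_at w q by apply: cts_comp; [exact: cP|exact: continuous_K].
have q_le0 (w : R) : w <= 0 -> q w = 0 by move=> w0; rewrite /q P_le0// K_le0.
have q_ge0 w : 0 <= q w by exact: K_ge0.
have dq (w : R) : 0 < w -> is_derive w (1 : R) q (P w).
  move=> w0; have [P0 dPw] := dP w w0.
  by apply: is_derive_eq (der_comp dPw (der_K P0)) _; rewrite mulfK// gt_eqF// phi'_gt0.
have Ee0 : 0 < En e by exact: En_gt0.
pose l w := Ei (En e + q w).
have Eq0 (w : R) : 0 < En e + q w by rewrite ltr_wpDr.
have El (w : R) : En (l w) = En e + q w by have [] := EiP _ (ltW (Eq0 w)).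
have le_l (w : R) : e <= l w.
  rewrite leNgt; apply/negP => lw.
  have [l0 _] := EiP _ (ltW (Eq0 w)).
  by have := En_lt l0 lw; rewrite El ltNge lerDl q_ge0.
have l_gt0 (w : R) : 0 < l w by exact: lt_le_trans (le_l w).
have cl (w : R) : continuous_at w l.
  by apply: cts_comp; [apply: ctsD; [exact: ctsC|exact: cq]|exact/cEi/ltW].
(* Differentiating K(p) = En V - En e along V' = p gives phi'(p) p' = En'(V): [Y] is the derivative
   of the flux in the radius. *)
pose Y w := dEn (l w).
have Y0 (w : R) : 0 < Y w by exact: dEn_gt0.
have cY (w : R) : continuous_at w Y by apply: cts_comp; [exact: cl|exact: continuous_dEn].
have Yf (w : R) : Y w <= f (l w) by exact: dEn_le.
have dl (w : R) : 0 < w -> is_derive w (1 : R) l (P w / Y w).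
  move=> w0; have := derD (derC (En e) w 1) (dq w w0); rewrite add0r => d1.
  by apply: is_derive_eq (der_comp d1 (dEi _ (Eq0 w))) _; rewrite mulrC.
have lmono (v w : R) : 0 <= v -> v <= w -> l v <= l w.
  move=> v0 vw; apply: (@der_le _ _ (fun w => P w / Y w)) => [//|x _|x /andP[vx _]|x /andP[vx _]].
  - exact: cl.
  - by apply: dl; exact: le_lt_trans vx.
  - by rewrite divr_ge0 ?(ltW (Y0 _))// P_ge0// (le_trans v0)// ltW.
(* The radius as a function of the flux. In terms of the level, dr = dV / p is singular at the
   start, where p = 0; here dr = dw / Y w has a continuous integrand. *)
pose rho w := int0 (fun x => (Y x)^-1) w + Num.min w 0.
have cYi (w : R) : continuous_at w (fun x => (Y x)^-1) by apply: ctsV; [rewrite gt_eqF|exact: cY].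
have L1Y : L1_0 (fun x => (Y x)^-1) by exact: (L1_0_continuous cYi).
have rho0 : rho 0 = 0 by rewrite /rho int0_le0// minxx addr0.
have rho_ge0 (w : R) : 0 <= w -> rho w = int0 (fun x => (Y x)^-1) w.
  by move=> w0; rewrite /rho min_r// addr0.
have crho (w : R) : continuous_at w rho.
  apply: ctsD; first by apply: continuous_int0.
  by apply: cts_min; [exact: cvg_id|exact: ctsC].
have drho (w : R) : 0 < w -> is_derive w (1 : R) rho (Y w)^-1.
  move=> w0; have := der_int0 L1Y (fun x _ => cYi x) w0.
  apply: near_eq_der; apply: filterS (cvgr_gt _ cvg_id _ w0) => x /ltW x0.
  by rewrite rho_ge0.
have rho_lt0 (v w : R) : 0 <= v -> v < w -> rho v < rho w.
  move=> v0 vw; apply: (@der_lt _ _ (fun w => (Y w)^-1)) => [//|x _|x /andP[vx _]|x _].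
  - exact: crho.
  - by apply: drho; exact: le_lt_trans vx.
  - by rewrite invr_gt0.
have rho_lt (v w : R) : v < w -> rho v < rho w.
  move=> vw; have [v0|v0] := leP 0 v; first exact: rho_lt0.
  have rho_le0 (x : R) : x <= 0 -> rho x = x.
    by move=> x0; rewrite /rho int0_le0// min_l// add0r.
  rewrite (rho_le0 _ (ltW v0)); have [w0|w0] := leP w 0; first by rewrite rho_le0.
  by rewrite (lt_trans v0)// -rho0 rho_lt0.
have [G [GK cG dG]] := increasing_inverse crho rho_lt.
have l_unb (U : R) : exists2 w, 0 < w & U < l w.
  pose t := Num.max (U + 1) (e + 1).
  have et : e < t by rewrite lt_max ltrDl ltr01 orbT.
  have tE : 0 <= En t - En e by rewrite subr_ge0 En_le// ltW.
  have [x x0 Kx] := K_surj tE.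
  have x1 : 0 < x.
    rewrite lt_neqAle x0 andbT; apply/eqP => x00.
    by have := En_lt (ltW e0) et; rewrite -subr_gt0 -Kx -x00 K_le0// ltxx.
  exists (phie x); first by rewrite -(phie_le0 (lexx 0)) phie_lt.
  rewrite /l /q Pphie Kx addrC subrK EiK; last by rewrite (le_trans _ (ltW et))// ltW.
  by rewrite /t lt_max ltrDl ltr01.
have [a a0 ia] := KO_gt0.
have [w1 w10 lw1] := l_unb (Num.max a e).
have [aw1 ew1] : a < l w1 /\ e < l w1 by move: lw1; rewrite gt_max => /andP.
have [k k0 hk] := speed_chi e0 ew1.
pose S (t : R) := \int[lebesgue_measure]_(s in `[(l w1), t]) chi s.
pose C := \int[lebesgue_measure]_(s in `]a, +oo[) chi s.
have ichi (u : R) : (@lebesgue_measure R).-integrable `[l w1, u] (EFin \o chi).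
  apply: integrableS ia; [exact: measurable_itv|exact: measurable_itv|].
  by apply: subset_itv; rewrite bnd_simp.
have chi_ge0 (t : R) : a < t -> 0 <= chi t.
  move=> at_; have [b0 _] := Kinv_Fhat (lt_trans a0 at_).
  by rewrite divr_ge0 ?expR_ge0 ?ltW.
have SC (u : R) : S u <= C.
  rewrite /S /C /Rintegral fine_le//; [exact: integrable_fin_num|exact: integrable_fin_num|].
  apply: ge0_subset_integral => //.
  - by move/integrableP: ia => [].
  - by move=> x /=; rewrite in_itv/= andbT lee_fin; exact: chi_ge0.
  - by apply: subset_itv; rewrite bnd_simp.
have dS (t : R) : l w1 < t -> is_derive t (1 : R) S (chi t).
  move=> t1; have t2 : t < t + 1 by rewrite ltrDl.
  have t0 := lt_trans (l_gt0 w1) t1.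
  have [h1 h2] := continuous_FTC1_closed t2 (ichi _) t1 (continuous_chi t0).
  by apply: DeriveDef; [exact: h1|rewrite -derive1E; exact: h2].
(* [S (l w) - k * rho w] is nondecreasing, since its derivative is (chi(l w) P w - k) / Y w and
   [speed_chi] bounds the numerator. The comparison starts at [w1 + 1] because [S] is differentiated
   only beyond [l w1]. *)
have rho_bd (w : R) : rho w <= rho (w1 + 1) + C / k.
  have C0 : 0 <= C.
    by apply: Rintegral_ge0 => x; rewrite /= in_itv/= andbT; exact: chi_ge0.
  have [ww|ww] := leP w (w1 + 1).
    rewrite (@le_trans _ _ (rho (w1 + 1)))//; last by rewrite lerDl divr_ge0// ltW.
    by move: ww; rewrite le_eqVlt => /predU1P[->//|/rho_lt/ltW].
  have lx (x : R) : w1 + 1 <= x -> l w1 < l x.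
    move=> wx; have w1x : w1 < x by rewrite (lt_le_trans _ wx)// ltrDl.
    apply: (@der_lt _ _ (fun w => P w / Y w)) => [//|y _|y /andP[vy _]|y /andP[vy _]].
    - exact: cl.
    - by apply: dl; exact: lt_trans vy.
    - by rewrite divr_gt0//; have [] := dP y (lt_trans w10 vy).
  have : S (l (w1 + 1)) - k * rho (w1 + 1) <= S (l w) - k * rho w.
    apply: (@der_le _ (fun w => S (l w) - k * rho w)
      (fun w => chi (l w) * (P w / Y w) - k * (Y w)^-1)) => [|x /andP[wx _]|x /andP[wx _]|x /andP[wx _]].
    - exact: ltW.
    - apply: ctsB; last by apply: ctsM; [exact: ctsC|exact: crho].
      apply: cts_comp; first exact: cl.
      exact: (der_continuous1 (dS _ (lx _ wx))).
    - have x0 : 0 < x by rewrite (lt_trans _ wx)// addr_gt0.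
      exact: (derB (der_comp (dl _ x0) (dS _ (lx _ (ltW wx)))) (derZ _ (drho _ x0))).
    - have x0 : 0 < x by rewrite (lt_trans _ wx)// addr_gt0.
      have [Px _] := dP x x0.
      rewrite mulrA -mulrBl mulr_ge0 ?invr_ge0 ?(ltW (Y0 _))// subr_ge0.
      rewrite -ler_pdivrMr//; apply: hk => //; first exact/ltW/lx/ltW.
      by rewrite El addrC addKr.
  have S0 : 0 <= S (l (w1 + 1)).
    apply: Rintegral_ge0 => x; rewrite /= in_itv/= => /andP[lx1 _].
    by apply: chi_ge0; exact: lt_le_trans lx1.
  move=> h1; have h2 := SC (l w); rewrite -lerBlDl ler_pdivlMr//.
  by rewrite mulrC mulrBr; exact: subr_le_bound S0 h1 h2.
pose dom (r : R) := exists2 w, 0 <= w & r = rho w.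
have dom_pos (w : R) : 0 <= w -> 0 < rho w -> 0 < w.
  by rewrite le_eqVlt => /predU1P[<-|//]; rewrite rho0 ltxx.
exists (rho (w1 + 1) + C / k), dom, (l \o G), (P \o G), (Y \o G).
split.
- split; first by exists 0.
  by exists (rho 1); [rewrite -rho0 rho_lt|exists 1].
- move=> _ [w w0 ->]; rewrite rho_bd andbT.
  by move: w0; rewrite le_eqVlt => /predU1P[<-|/rho_lt/ltW]; rewrite rho0.
- move=> r _ [w w0 ->] r0 rw.
  have [|x /andP[x0 _] <-] := continuous_IVT (y := r) crho w0; last by exists x.
  by rewrite rho0 r0.
- move=> U; have [w w0 Uw] := l_unb U.
  by exists (rho w); [exists w => //; exact: ltW|rewrite /= GK].
have G0 : G 0 = 0 by rewrite -rho0 GK.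
split.
- by rewrite /= G0 /l q_le0// addr0 EiK// ltW.
- by rewrite /= G0 P_le0.
- move=> _ [w w0 ->]; rewrite /= GK; split.
  + by apply: cts_comp; [exact: cG|rewrite GK; exact: cl].
  + by apply: cts_comp; [exact: cG|rewrite GK; exact: cP].
  + exact: le_l.
  + exact: P_ge0.
  + rewrite -phie_ge0 ?P_ge0// phieP.
    (* The flux at [rho w] is [w] itself, and w <= rho w * f(l w) because [Y] stays below [f (l w)]
       on [0, w]. *)
    have : f (l w) * rho 0 - 0 <= f (l w) * rho w - w.
      apply: (@der_le _ (fun x => f (l w) * rho x - x)
        (fun x => f (l w) * (Y x)^-1 - 1)) => [//|x _|x /andP[x0 _]|x /andP[x0 xw]].
      * by apply: ctsB; [apply: ctsM; [exact: ctsC|exact: crho]|exact: cvg_id].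
      * exact: (derB (derZ _ (drho _ x0)) (is_derive_id _ _)).
      * rewrite subr_ge0 ler_pdivlMr// mul1r (le_trans (Yf x))//.
        by apply: f_le; [exact: ltW|apply: lmono; exact: ltW].
    by rewrite rho0 mulr0 subrr subr_ge0 mulrC.
- move=> _ [w w0 ->] /(dom_pos _ w0) w1'; rewrite /= GK.
  have [Pw dPw] := dP w w1'.
  have dGw : is_derive (rho w) (1 : R) G (Y w).
    rewrite -[Y w]invrK; apply: dG; last exact: drho.
    by rewrite gt_eqF// invr_gt0.
  split; first exact: Pw.
  split.
  + have dlG : is_derive (G (rho w)) (1 : R) l (P w / Y w) by rewrite GK; exact: dl.
    by apply: is_derive_eq (der_comp dGw dlG) _; rewrite divfK// gt_eqF.
  + have dPG : is_derive (G (rho w)) (1 : R) P (dphi (P w))^-1 by rewrite GK.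
    by apply: is_derive_eq (der_comp dGw dPG) _; rewrite mulrC.
  + by apply: cts_comp; [exact: cG|rewrite GK; exact: cY].
  + by rewrite (ltW (Y0 w)) Yf.
  (* K(p) is at most [En] at the current level, so [h_En_le] absorbs the singular factor [h] into
     [f]. *)
  + apply: (@le_trans _ _ (h (l w) * (D * K phi (P w)))).
      by rewrite ler_wpM2l ?h_ge0// K_half.
    rewrite mulrCA ler_pM2l//; apply: le_trans (h_En_le (l_gt0 w)).
    by rewrite ler_wpM2l ?h_ge0// El /q lerDr ltW.
Qed.

End K_facts.

Lemma near_cst_continuous (R : realType) (T : topologicalType) (F : T -> R) q :
  (\forall y \near q, F y = F q) -> continuous_at q F.
Proof. exact: cvg_near_cst. Qed.

(** * The weak inequality for test functions of class C^1 *)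

Section zero_extension.
Context {R : realType} {n : nat}.
Implicit Types (F G z : 'rV[R]_n -> R) (q : 'rV[R]_n) (A : set 'rV[R]_n).
Notation e_ i := (delta_mx 0 i : 'rV[R]_n).

Lemma near_notin A q : closed A -> ~ A q -> \forall y \near q, ~ A y.
Proof. by move=> cA Aq; apply: (open_nbhs_nbhs (A := ~` A)); split => //; exact: closed_openC. Qed.

(** Near a point off the closed set [A] the function is identically 0, so regularity is checked on
    [A] only; this admits factors that are singular elsewhere. *)
Lemma Cc_ext A b F : closed A -> (forall q, A q -> `|q| <= b) ->
  (forall q, ~ A q -> F q = 0) -> (forall q, A q -> continuous_at q F) -> Cc F.
Proof.
move=> cA Ab F0 cF; split; last first.
  exists b => q bq; apply: F0 => /Ab; by rewrite leNgt bq.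
move=> q; have [Aq|Aq] := pselect (A q); first exact: cF.
apply: near_cst_continuous; have := near_notin cA Aq.
by apply: (@filterS _ (nbhs q) (nbhs_filter q)) => y Ay; rewrite !F0.
Qed.

Lemma der_ext A v F (dF : 'rV[R]_n -> R) : closed A ->
  (forall q, ~ A q -> F q = 0) -> (forall q, ~ A q -> dF q = 0) ->
  (forall q, A q -> is_derive q v F (dF q)) -> forall q, is_derive q v F (dF q).
Proof.
move=> cA F0 dF0 hF q; have [Aq|Aq] := pselect (A q); first exact: hF.
rewrite dF0//; apply: near_eq_der (derC 0 q v).
have := near_notin cA Aq.
by apply: (@filterS _ (nbhs q) (nbhs_filter q)) => y Ay; rewrite F0.
Qed.

(** [G] is regular on [A] only, but its products with [z] and [dz] extend by zero, and the
    divergence theorem is applied to the product. *)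
Lemma RI_by_parts A b i z dz G dG : closed A -> (forall q, A q -> `|q| <= b) ->
  (forall q, ~ A q -> z q = 0) -> (forall q, ~ A q -> dz q = 0) ->
  (forall q, A q -> [/\ continuous_at q z, continuous_at q dz,
     continuous_at q G & continuous_at q dG]) ->
  (forall q, A q -> is_derive q (e_ i) z (dz q) /\ is_derive q (e_ i) G (dG q)) ->
  [/\ Cc (fun q => G q * dz q), Cc (fun q => dG q * z q) &
      RI (fun q => G q * dz q) = - RI (fun q => dG q * z q)].
Proof.
move=> cA Ab z0 dz0 hc hd.
have c1 : Cc (fun q => G q * dz q).
  apply: (Cc_ext cA Ab) => [q /dz0 ->|q /hc[? ? ? ?]]; first by rewrite mulr0.
  exact: ctsM.
have c2 : Cc (fun q => dG q * z q).
  apply: (Cc_ext cA Ab) => [q /z0 ->|q /hc[? ? ? ?]]; first by rewrite mulr0.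
  exact: ctsM.
split=> //; apply/eqP; rewrite -subr_eq0 opprK -RID//; apply/eqP.
apply: (@RI_derive0 _ _ i (fun q => G q * z q)).
- apply: (Cc_ext cA Ab) => [q /z0 ->|q /hc[? ? ? ?]]; first by rewrite mulr0.
  exact: ctsM.
- exact: CcD.
- apply: (der_ext cA) => [q /z0 ->|q Aq|q /hd[h1 h2]].
  + by rewrite mulr0.
  + by rewrite z0// dz0// !mulr0 addr0.
  + by apply: is_derive_eq (derM h2 h1) _; rewrite [z q * _]mulrC.
Qed.

End zero_extension.

(** * Squared positive part and cutoff *)

Section sqpos.
Context {R : realType}.

(** The square makes the positive part C^1, the regularity that [weak_C1] asks of a test
    function. *)
Definition sqpos (x : R) := Num.max x 0 ^+ 2.
Definition dsqpos (x : R) := 2 * Num.max x 0.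

Lemma sqpos_ge0 x : 0 <= sqpos x. Proof. exact: sqr_ge0. Qed.
Lemma dsqpos_ge0 x : 0 <= dsqpos x.
Proof. by rewrite /dsqpos mulr_ge0// le_max lexx orbT. Qed.

Lemma sqpos_le0 x : x <= 0 -> sqpos x = 0.
Proof. by move=> x0; rewrite /sqpos max_r// expr0n. Qed.

Lemma dsqpos_le0 x : x <= 0 -> dsqpos x = 0.
Proof. by move=> x0; rewrite /dsqpos max_r// mulr0. Qed.

Lemma sqpos_gt0 x : 0 < x -> 0 < sqpos x.
Proof. by move=> x0; rewrite /sqpos max_l ?exprn_gt0// ltW. Qed.

Lemma sqpos_le x y : x <= y -> sqpos x <= sqpos y.
Proof.
move=> xy; have [x0|x0] := leP x 0; first by rewrite sqpos_le0// sqpos_ge0.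
have y0 := lt_le_trans x0 xy.
by rewrite /sqpos (max_l (ltW x0)) (max_l (ltW y0)) ler_pXn2r// nnegrE ltW.
Qed.

Lemma cts_pos (x : R) : continuous_at x (fun y => Num.max y 0).
Proof. by apply: cts_max; [exact: cvg_id|exact: ctsC]. Qed.

Lemma cts_sqpos x : continuous_at x sqpos.
Proof. by apply: ctsX; exact: cts_pos. Qed.

Lemma cts_dsqpos x : continuous_at x dsqpos.
Proof. by apply: ctsM; [exact: ctsC|exact: cts_pos]. Qed.

Lemma der_sqpos x : is_derive x (1 : R) sqpos (dsqpos x).
Proof.
have [x0|x0|->] := ltgtP x 0.
- rewrite dsqpos_le0 ?ltW//; apply: near_eq_der (derC 0 x (1 : R)).
  by apply: filterS (cvgr_lt x cvg_id _ x0) => y /ltW y0; rewrite sqpos_le0.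
- rewrite /dsqpos max_l ?ltW//.
  have := derX 1 (is_derive_id x (1 : R)); rewrite expr1 mulr1.
  apply: near_eq_der.
  by apply: filterS (cvgr_gt x cvg_id _ x0) => y /ltW y0; rewrite /sqpos max_l.
- rewrite dsqpos_le0//; apply: is_derive_cvg; apply/cvgrPdist_le => e e0; near=> h.
  rewrite sub0r normrN addr0 [h *: (1 : R)]mulr1 (sqpos_le0 (lexx 0)) subr0 scale_mul.
  have h0 : h != 0 by near: h; exact: nbhs_dnbhs_neq.
  have he : `|h| <= e by near: h; exact: (@dnbhs0_le _ R^o).
  rewrite /sqpos; have [hp|hp] := leP h 0; first by rewrite expr0n/= mulr0 normr0 ltW.
  by rewrite expr2 mulrA mulVf// mul1r.
Unshelve. all: by end_near. Qed.

(** An even C^1 cutoff, equal to 1 on [-1, 1] and to 0 for |x| >= 2, nonincreasing in |x|. *)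
Definition cutoff (x : R) := sqpos (1 - sqpos (x ^+ 2 - 1)).
Definition dcutoff (x : R) :=
  dsqpos (1 - sqpos (x ^+ 2 - 1)) * - (dsqpos (x ^+ 2 - 1) * (2 * x)).

Lemma cutoff_ge0 x : 0 <= cutoff x. Proof. exact: sqpos_ge0. Qed.

Lemma cutoff_le1 x : cutoff x <= 1.
Proof.
have -> : 1 = sqpos 1 :> R by rewrite /sqpos max_l// expr1n.
by apply: sqpos_le; rewrite gerBl sqpos_ge0.
Qed.

Lemma cutoff1 x : `|x| <= 1 -> cutoff x = 1 /\ dcutoff x = 0.
Proof.
move=> x1; have x2 : x ^+ 2 - 1 <= 0.
  by rewrite subr_le0 -real_normK ?num_real// expr_le1.
rewrite /cutoff /dcutoff (sqpos_le0 x2) (dsqpos_le0 x2) mul0r oppr0 mulr0 addr0.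
by rewrite /sqpos max_l// expr1n.
Qed.

Lemma cutoff0 x : 2 <= `|x| -> cutoff x = 0 /\ dcutoff x = 0.
Proof.
move=> x2; have h : 1 - sqpos (x ^+ 2 - 1) <= 0.
  rewrite subr_le0 [leLHS](_ : 1 = sqpos 1); last by rewrite /sqpos max_l// expr1n.
  apply: sqpos_le; rewrite lerBrDr -mulr2n.
  have : `|x| <= `|x| * `|x| by rewrite ler_peMr// (le_trans _ x2)// ler1n.
  by rewrite -normrM -expr2 [`|x ^+ 2|]ger0_norm ?sqr_ge0//; exact: le_trans.
by rewrite /cutoff /dcutoff (sqpos_le0 h) (dsqpos_le0 h) mul0r.
Qed.

Lemma cutoff_anti x y : `|x| <= `|y| -> cutoff y <= cutoff x.
Proof.
move=> xy; apply: sqpos_le; rewrite lerD2l lerN2; apply: sqpos_le.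
by rewrite lerD2r -(real_normK (num_real x)) -(real_normK (num_real y)) ler_pXn2r ?nnegrE.
Qed.

Lemma cts_cutoff x : continuous_at x cutoff.
Proof.
apply: cts_comp; last exact: cts_sqpos.
apply: ctsB; first exact: ctsC.
apply: cts_comp; last exact: cts_sqpos.
by apply: ctsB; [apply: ctsX; exact: cvg_id|exact: ctsC].
Qed.

Lemma cts_dcutoff x : continuous_at x dcutoff.
Proof.
have c1 : continuous_at x (fun x => x ^+ 2 - 1).
  by apply: ctsB; [apply: ctsX; exact: cvg_id|exact: ctsC].
apply: ctsM.
  apply: cts_comp; last exact: cts_dsqpos.
  by apply: ctsB; [exact: ctsC|apply: cts_comp => //; exact: cts_sqpos].
apply: ctsN; apply: ctsM; first by apply: cts_comp => //; exact: cts_dsqpos.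
by apply: ctsM; [exact: ctsC|exact: cvg_id].
Qed.

Lemma der_cutoff x : is_derive x (1 : R) cutoff (dcutoff x).
Proof.
have := derB (derX 1 (is_derive_id x (1 : R))) (derC 1 x (1 : R)).
rewrite expr1 subr0 mulr1 => d1.
have := derB (derC 1 x (1 : R)) (der_comp d1 (der_sqpos _)).
rewrite sub0r => d2.
exact: (der_comp d2 (der_sqpos _)).
Qed.

Lemma dcutoff_bounded : exists2 C, 0 < C & forall x, `|dcutoff x| <= C.
Proof.
have le22 : (-2 : R) <= 2 by rewrite ltW// gtrN.
have c : {within `[-2, 2], continuous (fun x : R => `|dcutoff x|)}.
  by apply: continuous_subspaceT => x; apply: cts_norm; exact: cts_dcutoff.
have [x0 _ hx0] := EVT_max le22 c.
exists (`|dcutoff x0| + 1) => [|x]; first by rewrite ltr_wpDl.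
have [x2|x2] := leP 2 `|x|.
  by have [_ ->] := cutoff0 x2; rewrite normr0 addr_ge0.
by rewrite ler_wpDr// hx0// in_itv/= -ler_norml ltW.
Qed.

End sqpos.

(** * Horizontal gradient and monotonicity of the flux *)

Section horizontal.
Context {R : realType} {m : nat}.
Notation n := (m + m + 1)%N.
Implicit Types (u v z : 'rV[R]_n -> R) (q : 'rV[R]_n) (dz : 'I_n -> 'rV[R]_n -> R).

(* XH and YH on a function given together with its partial derivatives. *)
Definition Xd (j : 'I_m) dz q := dz (ix j) q + 2 * q 0 (iy j) * dz it q.
Definition Yd (j : 'I_m) dz q := dz (iy j) q - 2 * q 0 (ix j) * dz it q.

Lemma XHE j u q : XH j u q = Xd j (fun i => partial i u) q. Proof. by []. Qed.
Lemma YHE j u q : YH j u q = Yd j (fun i => partial i u) q. Proof. by []. Qed.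

Definition pair_dot (a b a' b' : 'I_m -> R) := \sum_(j < m) (a j * a' j + b j * b' j).

Lemma pair_dot_ge0 a b : 0 <= pair_dot a b a b.
Proof. by apply: sumr_ge0 => j _; rewrite addr_ge0// -expr2 sqr_ge0. Qed.

Lemma pair_dotC a b a' b' : pair_dot a b a' b' = pair_dot a' b' a b.
Proof. by apply: eq_bigr => j _; ring. Qed.

Lemma pair_dot_coord a b j :
  `|a j| <= Num.sqrt (pair_dot a b a b) /\ `|b j| <= Num.sqrt (pair_dot a b a b).
Proof.
have h : a j ^+ 2 + b j ^+ 2 <= pair_dot a b a b.
  rewrite /pair_dot (bigD1 j)//= -!expr2 lerDl; apply: sumr_ge0 => i _.
  by rewrite addr_ge0// -expr2 sqr_ge0.
rewrite -!sqrtr_sqr !ler_wsqrtr//; apply: le_trans h.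
  by rewrite lerDr sqr_ge0.
by rewrite lerDl sqr_ge0.
Qed.

Lemma pair_dot_CS a b a' b' :
  pair_dot a b a' b' <= Num.sqrt (pair_dot a b a b) * Num.sqrt (pair_dot a' b' a' b').
Proof.
set s := Num.sqrt (pair_dot a b a b); set t := Num.sqrt _.
have s0 : 0 <= s by exact: sqrtr_ge0.
have t0 : 0 <= t by exact: sqrtr_ge0.
have ss : pair_dot a b a b = s ^+ 2 by rewrite sqr_sqrtr// pair_dot_ge0.
have tt : pair_dot a' b' a' b' = t ^+ 2 by rewrite sqr_sqrtr// pair_dot_ge0.
have zero c d c' d' : Num.sqrt (pair_dot c d c d) = 0 -> pair_dot c d c' d' = 0.
  move=> cd0; apply: big1 => j _.
  have [] := pair_dot_coord c d j; rewrite cd0 !normr_le0 => /eqP -> /eqP ->.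
  by rewrite !mul0r addr0.
move: s0; rewrite le_eqVlt => /predU1P[s0|s0]; first by rewrite zero -?s0// mul0r.
move: t0; rewrite le_eqVlt => /predU1P[t0|t0].
  by rewrite pair_dotC zero -?t0// mulr0.
(* The nonnegative square of t a - s a', with s and t the two norms; the cases of a zero norm are
   settled above. *)
have := pair_dot_ge0 (fun j => t * a j - s * a' j) (fun j => t * b j - s * b' j).
have -> : pair_dot (fun j => t * a j - s * a' j) (fun j => t * b j - s * b' j)
    (fun j => t * a j - s * a' j) (fun j => t * b j - s * b' j) =
    t ^+ 2 * pair_dot a b a b - 2 * t * s * pair_dot a b a' b' +
    s ^+ 2 * pair_dot a' b' a' b'.
  rewrite /pair_dot !mulr_sumr -sumrB -big_split/=.
  by apply: eq_bigr => j _; ring.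
rewrite ss tt => h; have st : 0 < 2 * (s * t) by rewrite !mulr_gt0.
rewrite -(ler_pM2l st) -subr_ge0; apply: le_trans h _.
by rewrite le_eqVlt; apply/orP; left; apply/eqP; ring.
Qed.

Lemma hdotE u v q : hdot u v q =
  pair_dot (fun j => XH j u q) (fun j => YH j u q) (fun j => XH j v q) (fun j => YH j v q).
Proof. by []. Qed.

Lemma XH_le_hnorm u q j : `|XH j u q| <= hnorm u q /\ `|YH j u q| <= hnorm u q.
Proof. exact: (pair_dot_coord (fun j => XH j u q) (fun j => YH j u q)). Qed.

Lemma cts_Xd dz q j : (forall i, continuous_at q (dz i)) -> continuous_at q (Xd j dz).
Proof.
move=> h; apply: ctsD; first exact: h.
by apply: ctsM; [apply: ctsM; [exact: ctsC|exact: cts_coord]|exact: h].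
Qed.

Lemma cts_Yd dz q j : (forall i, continuous_at q (dz i)) -> continuous_at q (Yd j dz).
Proof.
move=> h; apply: ctsB; first exact: h.
by apply: ctsM; [apply: ctsM; [exact: ctsC|exact: cts_coord]|exact: h].
Qed.

Lemma Ck1_partial_continuous u i : Ck 1 u -> continuous (partial i u).
Proof. by move=> [_ /(_ i)[_ []]]. Qed.

Lemma cts_hnorm u q : Ck 1 u -> continuous_at q (hnorm u).
Proof.
move=> hu; apply: cts_sqrt; apply: cts_sum => j.
have hp i : continuous_at q (partial i u) by exact: Ck1_partial_continuous.
have cX : continuous_at q (XH j u) by exact: (@cts_Xd (fun i => partial i u)).
have cY : continuous_at q (YH j u) by exact: (@cts_Yd (fun i => partial i u)).
by apply: ctsD; exact: ctsM.
Qed.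

End horizontal.

Section flux.
Context {R : realType} {m : nat} (phi : R -> R).
Notation n := (m + m + 1)%N.
Context (phi_cont : {within `[0, +oo[, continuous phi}) (phi0 : phi 0 = 0)
  (phi_ge0 : forall t : R, 0 <= t -> 0 <= phi t).
Implicit Types (u : 'rV[R]_n -> R) (q : 'rV[R]_n).

Definition fluxc u q := (hnorm u q)^-1 * phi (hnorm u q).

(** At a critical point of [u] the coefficient is singular, but the flux component is at most
    phi(|grad u|) in absolute value, which tends to phi(0) = 0. *)
Lemma cts_flux u (w : 'rV[R]_n -> R) q : Ck 1 u -> continuous_at q w ->
  (forall q, `|w q| <= hnorm u q) -> continuous_at q (fun q => fluxc u q * w q).
Proof.
move=> hu cw wu.
have cp : continuous_at q (fun q => phi (Num.max (hnorm u q) 0)).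
  apply: (cts_comp (h := fun y => phi (Num.max y 0))); first exact: cts_hnorm.
  exact: within0y_continuous.
have hmax q' : Num.max (hnorm u q') 0 = hnorm u q' by rewrite max_l// sqrtr_ge0.
have cp' : continuous_at q (fun q => phi (hnorm u q)).
  by move: cp; under eq_fun do rewrite hmax.
have [hq|hq] := eqVneq (hnorm u q) 0; last first.
  apply: ctsM => //; apply: ctsM => //.
  by apply: ctsV => //; exact: cts_hnorm.
apply/cts_epsP => e e0; move/cts_epsP : cp' => /(_ e e0)[d d0 hd].
exists d => // q' qq'; rewrite {1}/fluxc hq invr0 !mul0r sub0r normrN.
have := hd q' qq'; rewrite hq phi0 sub0r normrN; apply: le_trans.
rewrite /fluxc; have [->|h] := eqVneq (hnorm u q') 0.
  by rewrite invr0 !mul0r normr0 normr_ge0.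
have h0 : 0 < hnorm u q' by rewrite lt_neqAle eq_sym h sqrtr_ge0.
rewrite !normrM gtr0_norm ?invr_gt0// mulrAC mulrC ler_piMr//.
by rewrite ler_pdivrMl// mulr1.
Qed.

(** Cauchy-Schwarz on the mixed product reduces the claim to (phi s - phi t)(s - t) >= 0. Stated for
    families of components, since the second gradient is the explicit one of the barrier. *)
Lemma flux_monotone (phi_le : forall s t : R, 0 <= s -> s <= t -> phi s <= phi t)
    (a b a' b' : 'I_m -> R) (s t : R) :
  s = Num.sqrt (pair_dot a b a b) -> t = Num.sqrt (pair_dot a' b' a' b') ->
  0 <= pair_dot (fun j => s^-1 * phi s * a j - t^-1 * phi t * a' j)
    (fun j => s^-1 * phi s * b j - t^-1 * phi t * b' j)
    (fun j => a j - a' j) (fun j => b j - b' j).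
Proof.
move=> sE tE.
have s0 : 0 <= s by rewrite sE sqrtr_ge0.
have t0 : 0 <= t by rewrite tE sqrtr_ge0.
have ss : pair_dot a b a b = s ^+ 2 by rewrite sE sqr_sqrtr// pair_dot_ge0.
have tt : pair_dot a' b' a' b' = t ^+ 2 by rewrite tE sqr_sqrtr// pair_dot_ge0.
have E : pair_dot (fun j => s^-1 * phi s * a j - t^-1 * phi t * a' j)
    (fun j => s^-1 * phi s * b j - t^-1 * phi t * b' j)
    (fun j => a j - a' j) (fun j => b j - b' j) =
    s^-1 * phi s * pair_dot a b a b + t^-1 * phi t * pair_dot a' b' a' b' -
    (s^-1 * phi s + t^-1 * phi t) * pair_dot a b a' b'.
  rewrite /pair_dot !mulr_sumr -big_split/= -sumrB.
  by apply: eq_bigr => j _; ring.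
have k0 (r : R) : 0 <= r -> 0 <= r^-1 * phi r.
  by move=> r0; rewrite mulr_ge0 ?invr_ge0// phi_ge0.
have kr (r : R) : r^-1 * phi r * r = phi r.
  have [->|r0] := eqVneq r 0; first by rewrite mulr0 phi0.
  by rewrite mulrAC mulVf// mul1r.
have := pair_dot_CS a b a' b'; rewrite -sE -tE => CS.
rewrite E ss tt !expr2 !mulrA !kr.
apply: (@le_trans _ _ (phi s * s + phi t * t - (s^-1 * phi s + t^-1 * phi t) * (s * t))).
  have -> : (s^-1 * phi s + t^-1 * phi t) * (s * t) =
     (s^-1 * phi s * s) * t + (t^-1 * phi t * t) * s by ring.
  rewrite !kr.
  have -> : phi s * s + phi t * t - (phi s * t + phi t * s) =
     (phi s - phi t) * (s - t) by ring.
  have [st|ts] := leP s t.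
    by rewrite mulr_le0// subr_le0// phi_le.
  by rewrite mulr_ge0// subr_ge0 ?phi_le// ltW.
by rewrite lerD2l lerN2 ler_wpM2l// addr_ge0// k0.
Qed.

End flux.

Lemma weak_C1_arith (R : realType) (a b F G d1 d2 e : R) :
  a - d1 <= b -> G - d2 <= F -> b <= - F -> d1 + d2 <= e -> a <= - G + e.
Proof. by lra. Qed.

Section weak_form.
Context {R : realType} {m : nat} (phi f h g : R -> R).
Notation n := (m + m + 1)%N.
Context (phi_cont : {within `[0, +oo[, continuous phi}) (phi0 : phi 0 = 0)
  (phi_ge0 : forall t : R, 0 <= t -> 0 <= phi t)
  (f_cont : {within `[0, +oo[, continuous f})
  (g_cont : {within `[0, +oo[, continuous g})
  (h_cont : forall t : R, 0 < t -> {for t, continuous h}).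
Context (u : 'rV[R]_n -> R) (u_ge0 : forall q, 0 <= u q)
  (u_sol : weak_solution phi f h g u).
Implicit Types (q : 'rV[R]_n) (z : 'rV[R]_n -> R) (dz : 'I_n -> 'rV[R]_n -> R).
Notation e_ i := (delta_mx 0 i : 'rV[R]_n).

Let hu : Ck 1 u. Proof. by case: u_sol. Qed.
Let cu : continuous u. Proof. exact: Ck_continuous hu. Qed.

(* The threshold c avoids the singularity of h at 0. *)
Definition source (c : R) q :=
  f (Num.max (u q) 0) - h (Num.max (u q) c) * g (Num.max (hnorm u q) 0).

Definition flux_dot dz q := \sum_(j < m)
  (fluxc phi u q * XH j u q * Xd j dz q + fluxc phi u q * YH j u q * Yd j dz q).

Lemma cts_source c q : 0 < c -> continuous_at q (source c).
Proof.
move=> c0; apply: ctsB.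
  apply: (cts_comp (h := fun y => f (Num.max y 0))); first exact: cu.
  exact: within0y_continuous.
apply: ctsM.
  apply: (cts_comp (h := h)); first by apply: cts_max; [exact: cu|exact: ctsC].
  by apply: h_cont; rewrite lt_max c0 orbT.
apply: (cts_comp (h := fun y => g (Num.max y 0))); first exact: cts_hnorm.
exact: within0y_continuous.
Qed.

Lemma sourceE c q : c <= u q -> source c q = f (u q) - h (u q) * g (hnorm u q).
Proof. by move=> cu'; rewrite /source !max_l// sqrtr_ge0. Qed.

Lemma cts_fluxX j q : continuous_at q (fun q => fluxc phi u q * XH j u q).
Proof.
apply: cts_flux => // [|q']; last by have [] := XH_le_hnorm u q' j.
by apply: (@cts_Xd _ _ (fun i => partial i u)) => i; exact: Ck1_partial_continuous.
Qed.

Lemma cts_fluxY j q : continuous_at q (fun q => fluxc phi u q * YH j u q).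
Proof.
apply: cts_flux => // [|q']; last by have [] := XH_le_hnorm u q' j.
by apply: (@cts_Yd _ _ (fun i => partial i u)) => i; exact: Ck1_partial_continuous.
Qed.

Lemma Cc_flux_dot dz : (forall i, Cc (dz i)) -> Cc (flux_dot dz).
Proof.
move=> hdz; apply: Cc_sum => j.
have cc (i : 'I_n) : continuous (fun q : 'rV[R]_n => 2 * q 0 i).
  by move=> q; apply: ctsM; [exact: ctsC|exact: cts_coord].
apply: CcD; apply: CcMl.
- by move=> q; exact: cts_fluxX.
- by apply: CcD => //; exact: CcMl.
- by move=> q; exact: cts_fluxY.
- by apply: CcB => //; exact: CcMl.
Qed.

Lemma Cc_of_Ck1 xi b : Ck 1 xi -> (forall q, b < `|q| -> xi q = 0) ->
  Cc xi /\ forall i, Cc (partial i xi).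
Proof.
move=> hxi hb; split=> [|i]; first by split; [exact: (Ck_continuous hxi)|exists b].
split; first exact: Ck1_partial_continuous.
by exists b; exact: partial_supp.
Qed.

Lemma weak_smooth c xi b : 0 < c -> test_function xi -> (forall q, 0 <= xi q) ->
  (forall q, b < `|q| -> xi q = 0) -> (forall q, xi q != 0 -> c <= u q) ->
  RI (fun q => source c q * xi q) <= - RI (flux_dot (fun i => partial i xi)).
Proof.
move=> c0 hxi xi0 xib xiu.
have [cxi cdxi] := Cc_of_Ck1 (hxi.1 1%N) xib.
have [_ /(_ xi hxi xi0)] := u_sol.
have -> : (fun q => ((hnorm u q)^-1 * phi (hnorm u q) * hdot u xi q)%R) =
    flux_dot (fun i => partial i xi).
  apply/funext => q; rewrite /flux_dot /hdot mulr_sumr; apply: eq_bigr => j _.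
  by rewrite /fluxc !XHE !YHE; ring.
have -> : (fun q => ((f (u q) - h (u q) * g (hnorm u q)) * xi q)%R) =
    (fun q => source c q * xi q).
  apply/funext => q; have [->|/xiu cuq] := eqVneq (xi q) 0; first by rewrite !mulr0.
  by rewrite sourceE.
rewrite !int_Rn_RI ?lee_fin//; first exact: Cc_flux_dot.
by apply: CcMl => // q; exact: cts_source.
Qed.

(** Mollification of [z] with uniform control of the derivatives and of the support. The bound u >=
    2 c on the support of [z] leaves, by uniform continuity, u >= c on that of the mollified
    function, where [source c] is the true right-hand side. *)
Lemma weak_C1 z dz c : 0 < c -> Cc z -> (forall i, Cc (dz i)) ->
  (forall i q, is_derive q (e_ i) z (dz i q)) -> (forall q, 0 <= z q) ->
  (forall q, z q != 0 -> 2 * c <= u q) ->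
  RI (fun q => source c q * z q) <= - RI (flux_dot dz).
Proof.
move=> c0 hz hdz zdz z0 zu.
have [b b0 zb] := Cc_bound hz.
have [pl hpl pl1] : exists2 pl : 'rV[R]_n -> R, Cc pl & forall q, `|q| <= b + 2 -> pl q = 1.
  by apply: Cc_plateau; rewrite addr_ge0// ltW.
(* Bounds the flux term per unit size of the partial derivatives of the test function. *)
pose cf q := \sum_(j < m) (`|fluxc phi u q * XH j u q| * (1 + 2 * `|q 0 (iy j)|) +
   `|fluxc phi u q * YH j u q| * (1 + 2 * `|q 0 (ix j)|)).
have ccf : continuous cf.
  move=> q; apply: cts_sum => j; apply: ctsD; apply: ctsM.
  - by apply: cts_norm; exact: cts_fluxX.
  - apply: ctsD; first exact: ctsC.
    by apply: ctsM; [exact: ctsC|apply: cts_norm; exact: cts_coord].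
  - by apply: cts_norm; exact: cts_fluxY.
  - apply: ctsD; first exact: ctsC.
    by apply: ctsM; [exact: ctsC|apply: cts_norm; exact: cts_coord].
have csrc : continuous (source c) by move=> q; exact: cts_source.
have [M1 M10 hM1] := Cc_bounded (CcMl csrc hpl).
have [M2 M20 hM2] := Cc_bounded (CcMl ccf hpl).
have hM1' q : `|q| <= b + 2 -> `|source c q| <= M1.
  by move=> qb; have := hM1 q; rewrite pl1// mulr1.
have hM2' q : `|q| <= b + 2 -> cf q <= M2.
  by move=> qb; have := hM2 q; rewrite pl1// mulr1; apply: le_trans; exact: ler_norm.
have [d d0 hd] := Cc_unif (CcMl cu hpl) c0.
pose vol := \prod_(i < n) (2 * (b + 1)).
have vol0 : 0 < vol by apply: prodr_gt0 => i _; rewrite mulr_gt0// addr_gt0.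
apply/ler_addgt0Pr => e e0.
(* Below 1, the support stays within radius [b + 1]; below [d], [u] stays above [c]; the last bound
   brings the two errors together below [e]. *)
pose e1 := Num.min (Num.min 1 d) (e / ((M1 + M2) * vol)).
have MV : 0 < (M1 + M2) * vol by rewrite mulr_gt0// addr_gt0.
have e10 : 0 < e1 by rewrite !lt_min ltr01 d0 divr_gt0.
have [e1_1 e1d e1e] : [/\ e1 <= 1, e1 <= d & e1 <= e / ((M1 + M2) * vol)].
  by rewrite /e1 !ge_min !lexx !orbT.
have [xi [txi xi0 xiz dxiz xisupp]] := smooth_approx hz hdz zdz z0 e10.
have xib q : b + 1 < `|q| -> xi q = 0.
  move=> qb; apply/eqP/negPn/negP => /xisupp[y qy].
  rewrite zb ?eqxx//.
  have : `|q| <= `|y| + `|q - y| by rewrite addrC -[in leLHS](subrK y q) ler_normD.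
  by move: (le_trans qy e1_1) qb; lra.
have xiu q : xi q != 0 -> c <= u q.
  move=> xq; have [y qy zy] := xisupp q xq.
  have qb : `|q| <= b + 1 by rewrite leNgt; apply/negP => /xib xq0; rewrite xq0 eqxx in xq.
  have yb : `|y| <= b by rewrite leNgt; apply/negP => /zb zy0; rewrite zy0 eqxx in zy.
  have := hd q y (le_trans qy e1d).
  rewrite !pl1 ?mulr1; [|by move: yb; lra|by move: qb; lra].
  have := zu y zy; rewrite ler_distl => h1 /andP[h2 _].
  by move: h1 h2; lra.
have := weak_smooth c0 txi xi0 xib xiu.
have [cxi cdxi] := Cc_of_Ck1 (txi.1 1%N) xib.
have zb' q : b + 1 < `|q| -> z q = 0 by move=> qb; rewrite zb//; move: qb; lra.
have dzb' i q : b + 1 < `|q| -> dz i q = 0.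
  move=> qb; have [_ <-] := zdz i q.
  by rewrite -/(partial i z q) (partial_supp (b := b))//; move: qb; lra.
have bd1 : `|RI (fun q => source c q * xi q) - RI (fun q => source c q * z q)| <= M1 * e1 * vol.
  rewrite -RIB; [|exact: CcMl|exact: CcMl].
  apply: (@RI_bound _ _ _ (fun=> b + 1)) => [i|||q i bq].
  - by rewrite addr_ge0// ltW.
  - by apply: CcB; exact: CcMl.
  - move=> q; have [qb|qb] := leP `|q| (b + 1); last first.
      by rewrite xib// zb'// !mulr0 subrr normr0 mulr_ge0// ltW.
    by rewrite -mulrBr normrM ler_pM// hM1'//; move: qb; lra.
  - have qb : b + 1 < `|q| by apply: lt_le_trans bq _; exact: rV_coord_le.
    by rewrite xib// zb'// !mulr0 subrr.
have bd2 : `|RI (flux_dot (fun i => partial i xi)) - RI (flux_dot dz)| <= M2 * e1 * vol.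
  have [cd1 cd2] := (Cc_flux_dot cdxi, Cc_flux_dot hdz).
  rewrite -RIB//; apply: (@RI_bound _ _ _ (fun=> b + 1)) => [i|||q i bq].
  - by rewrite addr_ge0// ltW.
  - exact: CcB.
  - move=> q; have [qb|qb] := leP `|q| (b + 1); last first.
      rewrite (_ : _ - _ = 0) ?normr0 ?mulr_ge0 ?ltW//.
      rewrite /flux_dot -sumrB; apply: big1 => j _.
      by rewrite /Xd /Yd !dzb'// !(partial_supp _ xib)// !mulr0 !subr0 !mulr0 !addr0 subrr.
    apply: (@le_trans _ _ (cf q * e1)); last first.
      by rewrite ler_wpM2r ?(ltW e10)// hM2'//; move: qb; lra.
    rewrite /flux_dot -sumrB (le_trans (ler_norm_sum _ _ _))// /cf mulr_suml.
    apply: ler_sum => j _.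
    set A := fluxc phi u q * XH j u q; set A' := fluxc phi u q * YH j u q.
    have -> : A * Xd j (fun i => partial i xi) q + A' * Yd j (fun i => partial i xi) q -
      (A * Xd j dz q + A' * Yd j dz q) =
      A * ((partial (ix j) xi q - dz (ix j) q) + 2 * q 0 (iy j) * (partial it xi q - dz it q)) +
      A' * ((partial (iy j) xi q - dz (iy j) q) - 2 * q 0 (ix j) * (partial it xi q - dz it q)).
      by rewrite /Xd /Yd; ring.
    have step (a k x y : R) : `|x| <= e1 -> `|y| <= e1 ->
        `|a * (x + 2 * k * y)| <= `|a| * (1 + 2 * `|k|) * e1.
      move=> xe ye; rewrite normrM -[leRHS]mulrA; apply: ler_wpM2l => //.
      apply: (le_trans (ler_normD _ _)).
      have -> : (1 + 2 * `|k|) * e1 = e1 + 2 * `|k| * e1 by ring.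
      apply: lerD => //; rewrite !normrM (ger0_norm (x := 2))//.
      by apply: ler_wpM2l => //; exact: mulr_ge0.
    rewrite [leRHS]mulrDl; apply: (le_trans (ler_normD _ _)).
    apply: lerD; first exact: step.
    have -> : (partial (iy j) xi q - dz (iy j) q) - 2 * q 0 (ix j) * (partial it xi q - dz it q) =
      (partial (iy j) xi q - dz (iy j) q) + 2 * (- q 0 (ix j)) * (partial it xi q - dz it q) by ring.
    by rewrite -[`|q 0 (ix j)|]normrN step.
  - have qb : b + 1 < `|q| by apply: lt_le_trans bq _; exact: rV_coord_le.
    rewrite /flux_dot -sumrB; apply: big1 => j _.
    by rewrite /Xd /Yd !dzb'// !(partial_supp _ xib)// !mulr0 !subr0 !mulr0 !addr0 subrr.
have e1e' : e1 * ((M1 + M2) * vol) <= e by rewrite -ler_pdivlMr.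
move=> wk; move: bd1 bd2; rewrite !ler_distl => /andP[b1 _] /andP[b2 _].
apply: weak_C1_arith b1 b2 wk _; apply: le_trans e1e'.
by rewrite le_eqVlt; apply/orP; left; apply/eqP; ring.
Qed.

End weak_form.

(** * The barrier *)

Section koranyi.
Context {R : realType} {m : nat}.
Notation n := (m + m + 1)%N.
Implicit Types (q v : 'rV[R]_n) (i : 'I_n) (j : 'I_m).
Notation e_ i := (delta_mx 0 i : 'rV[R]_n).

Lemma ixE j k : (ix j == ix k) = (j == k).
Proof. by rewrite (inj_eq (@lshift_inj _ _)) (inj_eq (@lshift_inj _ _)). Qed.
Lemma iyE j k : (iy j == iy k) = (j == k).
Proof. by rewrite (inj_eq (@lshift_inj _ _)) (inj_eq (@rshift_inj _ _)). Qed.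
Lemma ix_iy j k : (ix j == iy k) = false.
Proof. by rewrite (inj_eq (@lshift_inj _ _)) eq_lrshift. Qed.
Lemma iy_ix j k : (iy j == ix k) = false.
Proof. by rewrite eq_sym ix_iy. Qed.
Lemma ix_it j : (ix j == it :> 'I_n) = false. Proof. exact: eq_lrshift. Qed.
Lemma iy_it j : (iy j == it :> 'I_n) = false. Proof. exact: eq_lrshift. Qed.
Lemma it_ix j : (it == ix j :> 'I_n) = false. Proof. by rewrite eq_sym ix_it. Qed.
Lemma it_iy j : (it == iy j :> 'I_n) = false. Proof. by rewrite eq_sym iy_it. Qed.

Lemma e_E i k : (e_ i) 0 k = (k == i)%:R.
Proof. by rewrite mxE eqxx. Qed.

(* [nr] is the Koranyi gauge, (ZX, ZY) the horizontal gradient of nr^4 / 4. *)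
Definition rho q := \sum_(j < m) (q 0 (ix j) ^+ 2 + q 0 (iy j) ^+ 2).
Definition N4 q := rho q ^+ 2 + q 0 it ^+ 2.
Definition nr q := Num.sqrt (Num.sqrt (N4 q)).
Definition ra q := Num.sqrt (rho q).
Definition ZX j q := rho q * q 0 (ix j) + q 0 it * q 0 (iy j).
Definition ZY j q := rho q * q 0 (iy j) - q 0 it * q 0 (ix j).

Definition drho i q := \sum_(j < m)
  (2 * q 0 (ix j) * (ix j == i)%:R + 2 * q 0 (iy j) * (iy j == i)%:R).
Definition dN4 i q := 2 * rho q * drho i q + 2 * q 0 it * (it == i)%:R.

Lemma rho_ge0 q : 0 <= rho q.
Proof. by apply: sumr_ge0 => j _; rewrite addr_ge0 ?sqr_ge0. Qed.

Lemma N4_ge0 q : 0 <= N4 q. Proof. by rewrite addr_ge0 ?sqr_ge0. Qed.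
Lemma nr_ge0 q : 0 <= nr q. Proof. exact: sqrtr_ge0. Qed.
Lemma ra_ge0 q : 0 <= ra q. Proof. exact: sqrtr_ge0. Qed.

Lemma raE q : ra q ^+ 2 = rho q. Proof. by rewrite sqr_sqrtr ?rho_ge0. Qed.
Lemma nrE2 q : nr q ^+ 2 = Num.sqrt (N4 q). Proof. by rewrite sqr_sqrtr ?sqrtr_ge0. Qed.
Lemma nrE q : nr q ^+ 4 = N4 q.
Proof. by rewrite (exprM _ 2 2) nrE2 sqr_sqrtr ?N4_ge0. Qed.

Lemma ra_le_nr q : ra q <= nr q.
Proof.
apply: ler_wsqrtr; rewrite -[leLHS](ger0_norm (rho_ge0 q)) -sqrtr_sqr.
by apply: ler_wsqrtr; rewrite lerDl sqr_ge0.
Qed.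

Lemma cts_rho q : continuous_at q rho.
Proof. by apply: cts_sum => j; apply: ctsD; apply: ctsX; exact: cts_coord. Qed.

Lemma cts_ra q : continuous_at q ra.
Proof. by apply: cts_sqrt; exact: cts_rho. Qed.

Lemma cts_nr q : continuous_at q nr.
Proof.
apply: cts_sqrt; apply: cts_sqrt; apply: ctsD; apply: ctsX; first exact: cts_rho.
exact: cts_coord.
Qed.

Lemma cts_ZX j q : continuous_at q (ZX j).
Proof.
by apply: ctsD; apply: ctsM; first [exact: cts_rho|exact: cts_coord].
Qed.

Lemma cts_ZY j q : continuous_at q (ZY j).
Proof.
by apply: ctsB; apply: ctsM; first [exact: cts_rho|exact: cts_coord].
Qed.

Lemma cts_drho i q : continuous_at q (drho i).
Proof.
apply: cts_sum => j; apply: ctsD; apply: ctsM; try exact: ctsC;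
  by apply: ctsM; [exact: ctsC|exact: cts_coord].
Qed.

Lemma cts_dN4 i q : continuous_at q (dN4 i).
Proof.
apply: ctsD; apply: ctsM.
- by apply: ctsM; [exact: ctsC|exact: cts_rho].
- exact: cts_drho.
- by apply: ctsM; [exact: ctsC|exact: cts_coord].
- exact: ctsC.
Qed.

Lemma der_coord_e i k q : is_derive q (e_ i) (fun y : 'rV[R]_n => y 0 k) (k == i)%:R.
Proof. by rewrite -e_E; exact: der_coord. Qed.

Lemma der_rho i q : is_derive q (e_ i) rho (drho i q).
Proof.
apply: der_sum => j; apply: derD; rewrite -[2 * _]/(2%:R * _) -{1}[q 0 _]expr1;
exact: (derX 1 (der_coord_e _ _ _)).
Qed.

Lemma der_N4 i q : is_derive q (e_ i) N4 (dN4 i q).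
Proof.
apply: derD.
  by have := derX 1 (der_rho i q); rewrite expr1.
by have := derX 1 (der_coord_e i it q); rewrite expr1.
Qed.

Lemma der_ra i q : 0 < rho q -> is_derive q (e_ i) ra ((2 * ra q)^-1 * drho i q).
Proof. by move=> r0; exact: (der_sqrt r0 (der_rho i q)). Qed.

Lemma der_nr i q : 0 < N4 q -> is_derive q (e_ i) nr (dN4 i q / (4 * nr q ^+ 3)).
Proof.
move=> N0; have s0 : 0 < Num.sqrt (N4 q) by rewrite sqrtr_gt0.
apply: is_derive_eq (der_sqrt (f := fun y => Num.sqrt (N4 y)) s0 (der_sqrt N0 (der_N4 i q))) _.
rewrite -nrE2; have b0 : nr q != 0 by rewrite gt_eqF// sqrtr_gt0.
rewrite -[Num.sqrt (nr q ^+ 2)]/(_) sqrtr_sqr ger0_norm ?nr_ge0//.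
by field.
Qed.

Lemma drho_ix j q : drho (ix j) q = 2 * q 0 (ix j).
Proof.
rewrite /drho (bigD1 j)//= eqxx iy_ix mulr1 mulr0 addr0 big1 ?addr0// => k kj.
by rewrite ixE (negbTE kj) iy_ix !mulr0 addr0.
Qed.

Lemma drho_iy j q : drho (iy j) q = 2 * q 0 (iy j).
Proof.
rewrite /drho (bigD1 j)//= eqxx ix_iy mulr1 mulr0 add0r big1 ?addr0// => k kj.
by rewrite iyE (negbTE kj) ix_iy !mulr0 addr0.
Qed.

Lemma drho_it q : drho it q = 0.
Proof. by apply: big1 => k _; rewrite ix_it iy_it !mulr0 addr0. Qed.

Lemma Xd_drho j q : Xd j drho q = 2 * q 0 (ix j).
Proof. by rewrite /Xd drho_ix drho_it mulr0 addr0. Qed.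
Lemma Yd_drho j q : Yd j drho q = 2 * q 0 (iy j).
Proof. by rewrite /Yd drho_iy drho_it mulr0 subr0. Qed.
Lemma Xd_dN4 j q : Xd j dN4 q = 4 * ZX j q.
Proof. by rewrite /Xd /dN4 drho_ix drho_it it_ix eqxx /= mulr0n mulr1n /ZX; ring. Qed.
Lemma Yd_dN4 j q : Yd j dN4 q = 4 * ZY j q.
Proof. by rewrite /Yd /dN4 drho_iy drho_it it_iy eqxx /= mulr0n mulr1n /ZY; ring. Qed.

Lemma sum_Z_rho q :
  \sum_(j < m) (ZX j q * q 0 (ix j) + ZY j q * q 0 (iy j)) = rho q ^+ 2.
Proof.
rewrite expr2 [in X in _ * X]/rho mulr_sumr; apply: eq_bigr => j _.
by rewrite /ZX /ZY; ring.
Qed.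

(** Equivalent off the origin to |grad nr| = ra / nr: the horizontal gradient of the gauge
    degenerates on the center. *)
Lemma sum_ZZ q : pair_dot (ZX^~ q) (ZY^~ q) (ZX^~ q) (ZY^~ q) = rho q * N4 q.
Proof.
have -> : rho q * N4 q = (rho q ^+ 2 + q 0 it ^+ 2) * rho q by rewrite mulrC.
rewrite [in X in _ * X]/rho mulr_sumr; apply: eq_bigr => j _.
by rewrite /ZX /ZY; ring.
Qed.

Definition dZX j i q := rho q * (ix j == i)%:R + q 0 (ix j) * drho i q +
  (q 0 it * (iy j == i)%:R + q 0 (iy j) * (it == i)%:R).
Definition dZY j i q := rho q * (iy j == i)%:R + q 0 (iy j) * drho i q -
  (q 0 it * (ix j == i)%:R + q 0 (ix j) * (it == i)%:R).

Lemma der_ZX j i q : is_derive q (e_ i) (ZX j) (dZX j i q).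
Proof.
exact: (derD (derM (der_rho i q) (der_coord_e i (ix j) q))
  (derM (der_coord_e i it q) (der_coord_e i (iy j) q))).
Qed.

Lemma der_ZY j i q : is_derive q (e_ i) (ZY j) (dZY j i q).
Proof.
exact: (derB (derM (der_rho i q) (der_coord_e i (iy j) q))
  (derM (der_coord_e i it q) (der_coord_e i (ix j) q))).
Qed.

Lemma cts_dZX j i q : continuous_at q (dZX j i).
Proof.
apply: ctsD; apply: ctsD; apply: ctsM;
  first [exact: ctsC|exact: cts_coord|exact: cts_rho|exact: cts_drho].
Qed.

Lemma cts_dZY j i q : continuous_at q (dZY j i).
Proof.
apply: ctsB; apply: ctsD; apply: ctsM;
  first [exact: ctsC|exact: cts_coord|exact: cts_rho|exact: cts_drho].
Qed.

(** The sub-Laplacian of nr^4, divided by 4; the constant is the homogeneous dimension 2m + 2 plus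
    2. *)
Lemma div_Z q :
  \sum_(j < m) (Xd j (dZX j) q + Yd j (dZY j) q) = (2 * m%:R + 4) * rho q.
Proof.
have -> : (2 * m%:R + 4) * rho q = \sum_(j < m) 2 * rho q + 4 * rho q.
  by rewrite -mulr_suml sumr_const card_ord -[2 *+ m]mulr_natr; ring.
rewrite [4 * rho q]mulr_sumr -big_split/=; apply: eq_bigr => j _.
rewrite /Xd /Yd /dZX /dZY drho_ix drho_iy drho_it.
by rewrite !eqxx ix_iy iy_ix ix_it iy_it it_ix it_iy /= !mulr0n !mulr1n; ring.
Qed.

End koranyi.

Section barrier.
Context {R : realType} {m : nat} (phi V p Q : R -> R) (c : R).
Notation n := (m + m + 1)%N.
Notation dphi := (derive1 phi).
Implicit Types (q : 'rV[R]_n) (i : 'I_n) (j : 'I_m).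
Notation e_ i := (delta_mx 0 i : 'rV[R]_n).

(* For the barrier v q = V (c * nr q): [bs] is |grad v|, [dbv i] a partial
   derivative, (WX, WY) = Om Z = bs^-1 phi(bs) grad v the flux and [divW] its
   divergence; Om = phi(bs) / (ra nr^2) has partials cA drho + cB dN4. *)
Definition bs q := c * p (c * nr q) * ra q / nr q.
Definition dbv i q := p (c * nr q) * (c * (dN4 i q / (4 * nr q ^+ 3))).
Definition Om q := phi (bs q) / (ra q * nr q ^+ 2).
Definition cA q := dphi (bs q) * c * p (c * nr q) / (2 * ra q * nr q) / (ra q * nr q ^+ 2) -
  phi (bs q) / (2 * ra q ^+ 3 * nr q ^+ 2).
Definition cB q :=
  dphi (bs q) * (c ^+ 2 * Q (c * nr q) * ra q / nr q - c * p (c * nr q) * ra q / nr q ^+ 2)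
    / (4 * nr q ^+ 3) / (ra q * nr q ^+ 2) - phi (bs q) / (2 * ra q * nr q ^+ 6).
Definition dOm i q := cA q * drho i q + cB q * dN4 i q.
Definition WX j q := Om q * ZX j q.
Definition WY j q := Om q * ZY j q.
Definition dWX j i q := Om q * dZX j i q + ZX j q * dOm i q.
Definition dWY j i q := Om q * dZY j i q + ZY j q * dOm i q.
Definition divW q := \sum_(j < m) (Xd j (dWX j) q + Yd j (dWY j) q).

Section off_origin.
Context (q : 'rV[R]_n) (N0 : 0 < N4 q).

Lemma nr_gt0 : 0 < nr q.
Proof. by rewrite !sqrtr_gt0. Qed.

Let b0 : nr q != 0. Proof. by rewrite gt_eqF// nr_gt0. Qed.

Lemma der_bv i : is_derive (c * nr q) (1 : R) V (p (c * nr q)) ->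
  is_derive q (e_ i) (fun q => V (c * nr q)) (dbv i q).
Proof. by move=> hV; exact: (der_comp (derZ c (der_nr i N0)) hV). Qed.

Lemma XV_E j : Xd j dbv q = c * p (c * nr q) / nr q ^+ 3 * ZX j q.
Proof.
have -> : Xd j dbv q = p (c * nr q) * c / (4 * nr q ^+ 3) * Xd j dN4 q.
  by rewrite /Xd /dbv; ring.
by rewrite Xd_dN4; field.
Qed.
Lemma YV_E j : Yd j dbv q = c * p (c * nr q) / nr q ^+ 3 * ZY j q.
Proof.
have -> : Yd j dbv q = p (c * nr q) * c / (4 * nr q ^+ 3) * Yd j dN4 q.
  by rewrite /Yd /dbv; ring.
by rewrite Yd_dN4; field.
Qed.

End off_origin.

Section at_point.
Context (q : 'rV[R]_n) (q0 : 0 < rho q).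

Lemma N4_gt0 : 0 < N4 q.
Proof. by rewrite ltr_wpDr ?sqr_ge0// exprn_gt0. Qed.
Lemma ra_gt0 : 0 < ra q. Proof. by rewrite sqrtr_gt0. Qed.

Let a0 : ra q != 0. Proof. by rewrite gt_eqF// ra_gt0. Qed.
Let N0 := N4_gt0.
Let b0 : nr q != 0. Proof. by rewrite gt_eqF// nr_gt0. Qed.

Lemma der_Om i : is_derive (c * nr q) (1 : R) p (Q (c * nr q)) ->
  is_derive (bs q) (1 : R) phi (dphi (bs q)) ->
  is_derive q (e_ i) Om (dOm i q).
Proof.
move=> hp hphi.
have dn := der_nr i N0; have dr := der_ra i q0.
have dP := der_comp (f := fun y => c * nr y) (derZ c dn) hp.
have dbs := derM (f := fun y => c * p (c * nr y) * ra y) (derM (derZ c dP) dr)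
  (derV (f := nr) b0 dn).
have dden := derM (f := ra) (g := fun y => nr y ^+ 2) dr (derX 1 dn).
have den0 : ra q * nr q ^+ 2 != 0 by rewrite mulf_neq0// expf_neq0.
have dF := der_comp (f := bs) dbs hphi.
have dV := derV (f := fun y => ra y * nr y ^+ 2) den0 dden.
apply: is_derive_eq (derM dF dV) _.
rewrite /dOm /cA /cB /bs expr1.
move: (dphi _) (phi _) => F' F.
by field; rewrite a0 b0.
Qed.

Lemma cts_bs : continuous_at (c * nr q) p -> continuous_at q bs.
Proof.
move=> cp; apply: ctsM; last by apply: ctsV => //; exact: cts_nr.
apply: ctsM; last exact: cts_ra.
apply: ctsM; first exact: ctsC.
apply: cts_comp => //.
by apply: ctsM; [exact: ctsC|exact: cts_nr].
Qed.

Context (cp : continuous_at (c * nr q) p) (cQ : continuous_at (c * nr q) Q)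
  (cphi : continuous_at (bs q) phi) (cdphi : continuous_at (bs q) dphi).

Let cP : continuous_at q (fun q => p (c * nr q)).
Proof. by apply: cts_comp => //; apply: ctsM; [exact: ctsC|exact: cts_nr]. Qed.
Let cQ' : continuous_at q (fun q => Q (c * nr q)).
Proof. by apply: cts_comp => //; apply: ctsM; [exact: ctsC|exact: cts_nr]. Qed.
Let cF : continuous_at q (fun q => phi (bs q)).
Proof. by apply: cts_comp => //; exact: cts_bs. Qed.
Let cF' : continuous_at q (fun q => dphi (bs q)).
Proof. by apply: cts_comp => //; exact: cts_bs. Qed.
Let ca := @cts_ra R m q.
Let cb := @cts_nr R m q.

Lemma cts_dbv i : continuous_at q (dbv i).
Proof.
apply: ctsM => //; apply: ctsM; first exact: ctsC.
apply: ctsM; first exact: cts_dN4.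
apply: ctsV; first by rewrite mulf_neq0// expf_neq0.
by apply: ctsM; [exact: ctsC|exact: ctsX].
Qed.

Lemma cts_Om : continuous_at q Om.
Proof.
apply: ctsM => //; apply: ctsV; first by rewrite mulf_neq0// expf_neq0.
by apply: ctsM => //; exact: ctsX.
Qed.

Lemma cts_cA : continuous_at q cA.
Proof.
have c2 : continuous_at q (fun q => (ra q * nr q ^+ 2)^-1).
  apply: ctsV; first by rewrite mulf_neq0// expf_neq0.
  by apply: ctsM => //; exact: ctsX.
apply: ctsB; apply: ctsM => //.
  apply: ctsM; first by apply: ctsM => //; apply: ctsM => //; exact: ctsC.
  apply: ctsV; first by rewrite !mulf_neq0.
  by apply: ctsM => //; apply: ctsM => //; exact: ctsC.
apply: ctsV; first by rewrite !mulf_neq0// expf_neq0.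
by apply: ctsM; [apply: ctsM; [exact: ctsC|exact: ctsX]|exact: ctsX].
Qed.

Lemma cts_cB : continuous_at q cB.
Proof.
have c2 : continuous_at q (fun q => (ra q * nr q ^+ 2)^-1).
  apply: ctsV; first by rewrite mulf_neq0// expf_neq0.
  by apply: ctsM => //; exact: ctsX.
have c3 : continuous_at q (fun q => (4 * nr q ^+ 3)^-1).
  apply: ctsV; first by rewrite mulf_neq0// expf_neq0.
  by apply: ctsM; [exact: ctsC|exact: ctsX].
apply: ctsB; apply: ctsM => //.
  apply: ctsM => //; apply: ctsM => //; apply: ctsB.
    apply: ctsM; last exact: ctsV.
    by apply: ctsM => //; apply: ctsM => //; exact: ctsC.
  apply: ctsM; last by apply: ctsV; [exact: expf_neq0|exact: ctsX].
  by apply: ctsM => //; apply: ctsM => //; exact: ctsC.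
apply: ctsV; first by rewrite !mulf_neq0// expf_neq0.
by apply: ctsM; [apply: ctsM => //; exact: ctsC|exact: ctsX].
Qed.

Lemma cts_dOm i : continuous_at q (dOm i).
Proof.
apply: ctsD; apply: ctsM; first [exact: cts_cA|exact: cts_cB|exact: cts_drho|exact: cts_dN4].
Qed.

Lemma cts_WX j : continuous_at q (WX j).
Proof. by apply: ctsM; [exact: cts_Om|exact: cts_ZX]. Qed.
Lemma cts_WY j : continuous_at q (WY j).
Proof. by apply: ctsM; [exact: cts_Om|exact: cts_ZY]. Qed.
Lemma cts_dWX j i : continuous_at q (dWX j i).
Proof.
apply: ctsD; apply: ctsM; first [exact: cts_Om|exact: cts_dZX|exact: cts_ZX|exact: cts_dOm].
Qed.
Lemma cts_dWY j i : continuous_at q (dWY j i).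
Proof.
apply: ctsD; apply: ctsM; first [exact: cts_Om|exact: cts_dZY|exact: cts_ZY|exact: cts_dOm].
Qed.

Lemma der_WX j i : is_derive q (e_ i) Om (dOm i q) ->
  is_derive q (e_ i) (WX j) (dWX j i q).
Proof. by move=> h; exact: (derM h (der_ZX j i q)). Qed.
Lemma der_WY j i : is_derive q (e_ i) Om (dOm i q) ->
  is_derive q (e_ i) (WY j) (dWY j i q).
Proof. by move=> h; exact: (derM h (der_ZY j i q)). Qed.

(** The radial form of the operator: [ra / nr] is the length of the gradient of the gauge, and 2m +
    1 is the homogeneous dimension minus 1. *)
Lemma divWE : divW q = dphi (bs q) * c ^+ 2 * Q (c * nr q) * (ra q / nr q) ^+ 2 +
  (2 * m%:R + 1) * phi (bs q) * ra q / nr q ^+ 2.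
Proof.
have -> : divW q = Om q * \sum_(j < m) (Xd j (dZX j) q + Yd j (dZY j) q) +
  cA q * 2 * \sum_(j < m) (ZX j q * q 0 (ix j) + ZY j q * q 0 (iy j)) +
  cB q * 4 * pair_dot (ZX^~ q) (ZY^~ q) (ZX^~ q) (ZY^~ q).
  rewrite /divW /pair_dot !mulr_sumr -!big_split/=; apply: eq_bigr => j _.
  have -> : Xd j (dWX j) q = Om q * Xd j (dZX j) q +
      ZX j q * (cA q * Xd j drho q + cB q * Xd j dN4 q).
    by rewrite /Xd /dWX /dOm; ring.
  have -> : Yd j (dWY j) q = Om q * Yd j (dZY j) q +
      ZY j q * (cA q * Yd j drho q + cB q * Yd j dN4 q).
    by rewrite /Yd /dWY /dOm; ring.
  by rewrite Xd_drho Yd_drho Xd_dN4 Yd_dN4; ring.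
rewrite div_Z sum_Z_rho sum_ZZ -raE -nrE /Om /cA /cB.
move: (dphi _) (phi _) (p _) (Q _) => F' F P Q'.
by field; rewrite a0 b0.
Qed.

Context (c0 : 0 < c) (p0 : 0 < p (c * nr q)).

Lemma bs_gt0 : 0 < bs q.
Proof. by rewrite divr_gt0 ?(nr_gt0 N0)// !mulr_gt0// ra_gt0. Qed.

Lemma norm_dbv : Num.sqrt (pair_dot (fun j => Xd j dbv q) (fun j => Yd j dbv q)
  (fun j => Xd j dbv q) (fun j => Yd j dbv q)) = bs q.
Proof.
have -> : pair_dot (fun j => Xd j dbv q) (fun j => Yd j dbv q)
  (fun j => Xd j dbv q) (fun j => Yd j dbv q) = bs q ^+ 2.
  have -> : pair_dot (fun j => Xd j dbv q) (fun j => Yd j dbv q)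
    (fun j => Xd j dbv q) (fun j => Yd j dbv q) =
    (c * p (c * nr q) / nr q ^+ 3) ^+ 2 * pair_dot (ZX^~ q) (ZY^~ q) (ZX^~ q) (ZY^~ q).
    by rewrite /pair_dot mulr_sumr; apply: eq_bigr => j _; rewrite !(XV_E N0) !(YV_E N0); ring.
  by rewrite sum_ZZ -raE -nrE /bs; field.
by rewrite sqrtr_sqr ger0_norm// ltW// bs_gt0.
Qed.

Lemma WX_E j : WX j q = (bs q)^-1 * phi (bs q) * Xd j dbv q.
Proof.
rewrite /WX /Om (XV_E N0); have /gt_eqF/negbT := p0.
move: (phi _) => F; rewrite /bs; move: (p _) => P P0.
by field; rewrite a0 b0 P0 gt_eqF.
Qed.

Lemma WY_E j : WY j q = (bs q)^-1 * phi (bs q) * Yd j dbv q.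
Proof.
rewrite /WY /Om (YV_E N0); have /gt_eqF/negbT := p0.
move: (phi _) => F; rewrite /bs; move: (p _) => P P0.
by field; rewrite a0 b0 P0 gt_eqF.
Qed.

End at_point.

(** The horizontal fields are divergence free: the coefficient 2 y_j or -2 x_j of the central
    derivative does not depend on [t], so it passes through the integration by parts. *)
Lemma weak_divW (A : set 'rV[R]_n) b z dz : closed A ->
  (forall q, A q -> `|q| <= b) ->
  (forall q, ~ A q -> z q = 0) -> (forall i q, ~ A q -> dz i q = 0) ->
  (forall q, A q -> continuous_at q z /\ forall i, continuous_at q (dz i)) ->
  (forall q, A q -> forall i, is_derive q (e_ i) z (dz i q)) ->
  (forall q, A q -> [/\ 0 < rho q, continuous_at (c * nr q) p, continuous_at (c * nr q) Q,
     continuous_at (bs q) phi & continuous_at (bs q) dphi]) ->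
  (forall q, A q -> is_derive (c * nr q) (1 : R) p (Q (c * nr q)) /\
     is_derive (bs q) (1 : R) phi (dphi (bs q))) ->
  [/\ Cc (fun q => \sum_(j < m) (WX j q * Xd j dz q + WY j q * Yd j dz q)),
     Cc (fun q => divW q * z q) &
   RI (fun q => \sum_(j < m) (WX j q * Xd j dz q + WY j q * Yd j dz q)) =
   - RI (fun q => divW q * z q)].
Proof.
move=> cA Ab z0 dz0 cz hz hc hd.
have ibp i (G dG : 'rV[R]_n -> R) :
    (forall q, A q -> continuous_at q G /\ continuous_at q dG) ->
    (forall q, A q -> is_derive q (e_ i) G (dG q)) ->
    [/\ Cc (fun q => G q * dz i q), Cc (fun q => dG q * z q) &
      RI (fun q => G q * dz i q) = - RI (fun q => dG q * z q)].
  move=> h1 h2; apply: (RI_by_parts cA Ab z0 (dz0 i)) => q Aq.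
    by have [? ?] := h1 q Aq; have [? ?] := cz q Aq; split.
  by split; [exact: hz|exact: h2].
have c2 i q : continuous_at q (fun q : 'rV[R]_n => 2 * q 0 i).
  by apply: ctsM; [exact: ctsC|exact: cts_coord].
have dOmq q i : A q -> is_derive q (e_ i) Om (dOm i q).
  by move=> Aq; have [? ? ? ? ?] := hc q Aq; have [? ?] := hd q Aq; exact: der_Om.
have hX j : [/\ Cc (fun q => WX j q * Xd j dz q), Cc (fun q => Xd j (dWX j) q * z q) &
    RI (fun q => WX j q * Xd j dz q) = - RI (fun q => Xd j (dWX j) q * z q)].
  have [|q Aq|e1 e2 e3] := ibp (ix j) (WX j) (dWX j (ix j)).
  - by move=> q Aq; have [? ? ? ? ?] := hc q Aq; split; [exact: cts_WX|exact: cts_dWX].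
  - by apply: der_WX; exact: dOmq.
  have [|q Aq|f1 f2 f3] := ibp it (fun q => 2 * q 0 (iy j) * WX j q)
      (fun q => 2 * q 0 (iy j) * dWX j it q).
  - move=> q Aq; have [? ? ? ? ?] := hc q Aq.
    by split; apply: ctsM => //; [exact: cts_WX|exact: cts_dWX].
  - have h1 := derZ 2 (der_coord_e it (iy j) q).
    apply: is_derive_eq (derM h1 (der_WX j (dOmq q it Aq))) _.
    by rewrite iy_it mulr0n !mulr0 addr0.
  have E1 : (fun q => WX j q * Xd j dz q) =
      (fun q => WX j q * dz (ix j) q + 2 * q 0 (iy j) * WX j q * dz it q).
    by apply/funext => q; rewrite /Xd; ring.
  have E2 : (fun q => Xd j (dWX j) q * z q) =
      (fun q => dWX j (ix j) q * z q + 2 * q 0 (iy j) * dWX j it q * z q).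
    by apply/funext => q; rewrite /Xd; ring.
  rewrite E1 E2; split; [exact: CcD|exact: CcD|].
  by rewrite !RID// e3 f3 opprD.
have hY j : [/\ Cc (fun q => WY j q * Yd j dz q), Cc (fun q => Yd j (dWY j) q * z q) &
    RI (fun q => WY j q * Yd j dz q) = - RI (fun q => Yd j (dWY j) q * z q)].
  have [|q Aq|e1 e2 e3] := ibp (iy j) (WY j) (dWY j (iy j)).
  - by move=> q Aq; have [? ? ? ? ?] := hc q Aq; split; [exact: cts_WY|exact: cts_dWY].
  - by apply: der_WY; exact: dOmq.
  have [|q Aq|f1 f2 f3] := ibp it (fun q => 2 * q 0 (ix j) * WY j q)
      (fun q => 2 * q 0 (ix j) * dWY j it q).
  - move=> q Aq; have [? ? ? ? ?] := hc q Aq.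
    by split; apply: ctsM => //; [exact: cts_WY|exact: cts_dWY].
  - have h1 := derZ 2 (der_coord_e it (ix j) q).
    apply: is_derive_eq (derM h1 (der_WY j (dOmq q it Aq))) _.
    by rewrite ix_it mulr0n !mulr0 addr0.
  have E1 : (fun q => WY j q * Yd j dz q) =
      (fun q => WY j q * dz (iy j) q - 2 * q 0 (ix j) * WY j q * dz it q).
    by apply/funext => q; rewrite /Yd; ring.
  have E2 : (fun q => Yd j (dWY j) q * z q) =
      (fun q => dWY j (iy j) q * z q - 2 * q 0 (ix j) * dWY j it q * z q).
    by apply/funext => q; rewrite /Yd; ring.
  rewrite E1 E2; split; [exact: CcB|exact: CcB|].
  by rewrite !RIB// e3 f3 opprB opprK addrC.
have ED : (fun q => divW q * z q) =
    (fun q => \sum_(j < m) (Xd j (dWX j) q * z q + Yd j (dWY j) q * z q)).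
  by apply/funext => q; rewrite /divW mulr_suml; apply: eq_bigr => j _; rewrite mulrDl.
have cc1 j : Cc (fun q => WX j q * Xd j dz q + WY j q * Yd j dz q).
  by have [h1 _ _] := hX j; have [h2 _ _] := hY j; exact: CcD.
have cc2 j : Cc (fun q => Xd j (dWX j) q * z q + Yd j (dWY j) q * z q).
  by have [_ h1 _] := hX j; have [_ h2 _] := hY j; exact: CcD.
rewrite ED; split; [exact: Cc_sum|exact: Cc_sum|].
rewrite !RI_sum// -sumrN; apply: eq_bigr => j _.
have [? ? h1] := hX j; have [? ? h2] := hY j.
by rewrite !RID// h1 h2 opprD.
Qed.

End barrier.

(** * Comparison *)

Lemma near_eq_cts (R : realType) (T : topologicalType) (F G : T -> R) q :
  (\forall y \near q, F y = G y) -> continuous_at q F -> continuous_at q G.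
Proof.
move=> FG cF; rewrite /continuous_at -(nbhs_singleton FG).
by apply: cvg_trans cF; exact: near_eq_cvg.
Qed.

(** Continuity on [A] suffices because a limit of points of [A] is again in [A]; the barrier is
    controlled on a ball only. *)
Lemma closedI_le (R : realType) (T : topologicalType) (A : set T) (F : T -> R) b :
  closed A -> (forall q, A q -> continuous_at q F) ->
  closed (A `&` [set q | F q <= b]).
Proof.
move=> cA cF q Aq.
have Aq' : A q by apply: cA; move=> B /Aq[y [[Ay _] By]]; exists y.
split=> //=; rewrite leNgt; apply/negP => bF.
have [y [[_ /= Fy] By]] := Aq _ (cvgr_gt _ (cF q Aq') _ bF).
by move: By => /=; rewrite ltNge Fy.
Qed.

Lemma derivative_at_max1 (R : realType) (G : R -> R) d :
  is_derive (0 : R) (1 : R) G d -> (\forall t \near (0 : R), G t <= G 0) -> d <= 0.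
Proof.
move=> [hd hE] hG.
have hc : h^-1 *: (G (h *: 1 + 0) - G 0) @[h --> (0 : R)^'] --> d.
  by rewrite -hE; exact: hd.
have hr : h @[h --> (0 : R)^'+] --> (0 : R) by apply: cvg_at_right_filter; exact: cvg_id.
apply: (cvgr_to_le (cvg_dnbhs_at_right hc)); near=> h.
have h0 : 0 < h by near: h; exact: nbhs_right_gt.
rewrite addr0 [h *: (1 : R)]mulr1 scale_mul pmulr_rle0 ?invr_gt0// subr_le0.
by near: h; exact: (hr _ hG).
Unshelve. all: by end_near. Qed.

Lemma derivative_at_max (R : realType) (V : normedModType R) (F : V -> R) q v d :
  is_derive q v F d -> (\forall y \near q, F y <= F q) -> d = 0.
Proof.
move=> hF hq; pose G t := F (q + t *: v).
have G0 : G 0 = F q by rewrite /G scale0r addr0.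
have hG : is_derive (0 : R) 1 G d by apply: is_derive1_line; rewrite scale0r addr0.
have nG : \forall t \near (0 : R), G t <= G 0.
  have hv : q + t *: v @[t --> (0 : R)] --> q.
    rewrite -[X in _ --> X](_ : q + 0 *: v = q); last by rewrite scale0r addr0.
    have h1 : t *: v @[t --> (0 : R)] --> 0 *: v by apply: cvgZr_tmp; exact: cvg_id.
    exact: (cvgD (cvg_cst q) h1).
  by rewrite G0; exact: (hv _ hq).
apply/eqP; rewrite eq_le (derivative_at_max1 hG nG) -oppr_le0.
have hN : is_derive (0 : R) 1 (fun t => G (- t)) (- d).
  have hG' : is_derive (- 0 : R) 1 G d by rewrite oppr0.
  have := der_comp (derN (is_derive_id (0 : R) (1 : R))) hG'.
  by rewrite mulrN mulr1.
apply: (derivative_at_max1 hN); rewrite oppr0.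
have hv : - t @[t --> (0 : R)] --> (0 : R).
  by rewrite -[X in _ --> X]oppr0; apply: cvgN; exact: cvg_id.
exact: (hv _ nG).
Qed.

Section koranyi_norm.
Context {R : realType} {m : nat}.
Notation n := (m + m + 1)%N.
Implicit Types (q : 'rV[R]_n).

(** Makes gauge balls bounded. The central coordinate is at most nr^2, the others at most nr <= 1 +
    nr^2. *)
Lemma norm_le_nr q : `|q| <= 1 + nr q ^+ 2.
Proof.
have b0 := nr_ge0 q; have le1 (a b : R) : 0 <= b -> a ^+ 2 <= b ^+ 2 -> `|a| <= b.
  move=> hb ab; rewrite -(ger0_norm hb) -(ler_pXn2r (n := 2))// ?nnegrE//.
  by rewrite !real_normK ?num_real.
have lx j a : a = q 0 (ix j) \/ a = q 0 (iy j) -> `|a| <= 1 + nr q ^+ 2.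
  move=> ha; have /le1 : a ^+ 2 <= nr q ^+ 2.
    apply: (@le_trans _ _ (rho q)).
      rewrite /rho (bigD1 j)//= -[leLHS]addr0 lerD//.
        by case: ha => ->; rewrite ?lerDl ?lerDr sqr_ge0.
      by apply: sumr_ge0 => k _; rewrite addr_ge0 ?sqr_ge0.
    by rewrite -raE ler_pXn2r ?nnegrE ?ra_ge0// ra_le_nr.
  by move=> /(_ b0) h; nra.
apply: rV_norm_le => [|i]; first by rewrite addr_ge0// sqr_ge0.
have [k ->|k ->] := split_ordP i; last first.
  rewrite (ord1 k) -/it -/(@it m); apply: (@le_trans _ _ (nr q ^+ 2)); last by rewrite lerDr.
  apply: le1; first exact: sqr_ge0.
  by rewrite -exprM nrE lerDr sqr_ge0.
have [j ->|j ->] := split_ordP k; apply: (lx j); [by left|by right].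
Qed.

End koranyi_norm.

Section origin.
Context {R : realType} {m : nat}.
Notation n := (m + m + 1)%N.
Implicit Types (q : 'rV[R]_n) (j : 'I_m).
Notation e_ i := (delta_mx 0 i : 'rV[R]_n).

Lemma rho0_coord q j : rho q = 0 -> q 0 (ix j) = 0 /\ q 0 (iy j) = 0.
Proof.
move=> /psumr_eq0P H; have := H (fun k _ => addr_ge0 (sqr_ge0 _) (sqr_ge0 _)) j isT.
by move=> /eqP; rewrite paddr_eq0 ?sqr_ge0// !sqrf_eq0 => /andP[/eqP -> /eqP ->].
Qed.

Lemma N40_eq0 q : N4 q = 0 -> q = 0.
Proof.
move=> /eqP; rewrite paddr_eq0 ?sqr_ge0// !sqrf_eq0 => /andP[/eqP r0 /eqP t0].
apply/rowP => i; rewrite mxE; have [k ->|k ->] := split_ordP i; last first.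
  by rewrite (ord1 k).
by have [j ->|j ->] := split_ordP k; have [] := rho0_coord j r0.
Qed.

Lemma nr0 : nr (0 : 'rV[R]_n) = 0.
Proof.
rewrite /nr /N4 /rho big1 => [|j _]; last by rewrite !mxE expr0n addr0.
by rewrite mxE !expr0n addr0 !sqrtr0.
Qed.

Lemma nr_delta (t : R) j : nr (t *: e_ (ix j)) = `|t| /\ nr (t *: e_ (iy j)) = `|t|.
Proof.
have E q : rho q = t ^+ 2 -> q 0 it = 0 -> nr q = `|t|.
  move=> r0 t0; rewrite /nr /N4 r0 t0 expr0n addr0.
  by rewrite sqrtr_sqr ger0_norm ?sqr_ge0// sqrtr_sqr.
have k0 i k : (t *: e_ i) 0 k = t * (k == i)%:R by rewrite mxE e_E.
split; apply: E; rewrite ?k0 ?it_ix ?it_iy ?mulr0// /rho (bigD1 j)//= !k0.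
- rewrite ixE eqxx iy_ix mulr1 mulr0 expr0n addr0 big1 ?addr0// => k kj.
  by rewrite !k0 ixE (negbTE kj) iy_ix !mulr0 expr0n addr0.
- rewrite iyE eqxx ix_iy mulr1 mulr0 expr0n add0r big1 ?addr0// => k kj.
  by rewrite !k0 iyE (negbTE kj) ix_iy !mulr0 expr0n addr0.
Qed.

(* The slope of the profile vanishes at 0, so the barrier is horizontally
   differentiable at the origin, where the homogeneous norm is not. *)
Lemma der_bv_origin (V p : R -> R) (c r1 : R) j : 0 < c -> 0 < r1 -> p 0 = 0 ->
  continuous_at (0 : R) p -> (forall r, 0 <= r <= r1 -> continuous_at r V) ->
  (forall r, 0 < r <= r1 -> is_derive r (1 : R) V (p r)) ->
  is_derive (0 : 'rV[R]_n) (e_ (ix j)) (fun q => V (c * nr q)) 0 /\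
  is_derive (0 : 'rV[R]_n) (e_ (iy j)) (fun q => V (c * nr q)) 0.
Proof.
move=> c0 r10 p0 cp cV dV.
have main i : (forall t : R, nr (t *: e_ i) = `|t|) ->
    is_derive (0 : 'rV[R]_n) (e_ i) (fun q => V (c * nr q)) 0.
  move=> hi; apply: is_derive_cvg; apply/cvgrPdist_le => eps eps0.
  move/cts_epsP : cp => /(_ (eps / c) (divr_gt0 eps0 c0))[d d0 hd].
  have b0 : 0 < Num.min d r1 / c by rewrite divr_gt0// lt_min d0.
  near=> t; rewrite sub0r normrN addr0 hi nr0 mulr0 scale_mul.
  have t0 : t != 0 by near: t; exact: nbhs_dnbhs_neq.
  have : `|t| <= Num.min d r1 / c by near: t; exact: (@dnbhs0_le _ R^o).
  rewrite ler_pdivlMr// le_min mulrC => /andP[td tr].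
  have ct0 : 0 < c * `|t| by rewrite mulr_gt0// normr_gt0.
  have h1 (x : R) : x \in `]0, c * `|t|[%R -> is_derive x (1 : R) V (p x).
    by rewrite in_itv/= => /andP[s0 st]; apply: dV; rewrite s0 (le_trans (ltW st)).
  have h2 : {within `[0, c * `|t|], continuous V}.
    apply: continuous_in_subspaceT => x /set_mem/=; rewrite in_itv/= => /andP[s0 st].
    by apply: cV; rewrite s0 (le_trans st).
  have [s hs ->] := MVT ct0 h1 h2.
  move: hs; rewrite in_itv/= subr0 => /andP[s0 st].
  rewrite !normrM normfV normr_id (gtr0_norm c0) mulrCA [_^-1 * _]mulrCA mulVf ?normr_eq0// mulr1.
  rewrite -ler_pdivlMr//; have := hd s; rewrite p0 !sub0r !normrN; apply.
  by rewrite gtr0_norm// (le_trans (ltW st)).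
split; apply: main => t; by have [] := nr_delta t j.
Unshelve. all: by end_near. Qed.

End origin.

Section axis_cutoff.
Context {R : realType} {m : nat} (j0 : 'I_m).
Notation n := (m + m + 1)%N.
Implicit Types (q : 'rV[R]_n) (i : 'I_n) (j : 'I_m) (d : R).
Notation e_ i := (delta_mx 0 i : 'rV[R]_n).

(* Vanishes near the center [x = y = 0], where the barrier is not smooth. *)
Definition axcut d q :=
  1 - cutoff (d^-1 * q 0 (ix j0)) * cutoff (d^-1 * q 0 (iy j0)).
Definition daxcut d i q :=
  - (cutoff (d^-1 * q 0 (ix j0)) * (dcutoff (d^-1 * q 0 (iy j0)) * (d^-1 * (iy j0 == i)%:R)) +
     cutoff (d^-1 * q 0 (iy j0)) * (dcutoff (d^-1 * q 0 (ix j0)) * (d^-1 * (ix j0 == i)%:R))).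

Lemma der_axcut d i q : is_derive q (e_ i) (axcut d) (daxcut d i q).
Proof.
have h k := der_comp (derZ d^-1 (der_coord_e i k q)) (der_cutoff (d^-1 * q 0 k)).
have := derB (derC 1 q (e_ i)) (derM (h (ix j0)) (h (iy j0))).
by rewrite sub0r.
Qed.

Let cd d k q : continuous_at q (fun q : 'rV[R]_n => d^-1 * q 0 k).
Proof. by apply: ctsM; [exact: ctsC|exact: cts_coord]. Qed.
Let cc d k q : continuous_at q (fun q : 'rV[R]_n => cutoff (d^-1 * q 0 k)).
Proof. by apply: cts_comp; [exact: cd|exact: cts_cutoff]. Qed.
Let cdc d k q : continuous_at q (fun q : 'rV[R]_n => dcutoff (d^-1 * q 0 k)).
Proof. by apply: cts_comp; [exact: cd|exact: cts_dcutoff]. Qed.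

Lemma cts_axcut d q : continuous_at q (axcut d).
Proof. by apply: ctsB; [exact: ctsC|apply: ctsM; exact: cc]. Qed.

Lemma cts_daxcut d i q : continuous_at q (daxcut d i).
Proof.
apply: ctsN; apply: ctsD; apply: ctsM; try exact: cc;
  by apply: ctsM; [exact: cdc|exact: ctsC].
Qed.

Lemma axcut_ge0 d q : 0 <= axcut d q.
Proof. by rewrite subr_ge0 mulr_ile1 ?cutoff_ge0 ?cutoff_le1. Qed.

(** Monotonicity lets the tested integral keep a fixed positive lower bound while [d] tends to 0. *)
Lemma axcut_anti d d' q : 0 < d -> d <= d' -> axcut d' q <= axcut d q.
Proof.
move=> d0 dd; have d0' := lt_le_trans d0 dd.
have le k : cutoff (d^-1 * q 0 k) <= cutoff (d'^-1 * q 0 k).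
  apply: cutoff_anti; rewrite !normrM !normfV (gtr0_norm d0) (gtr0_norm d0').
  by apply: ler_wpM2r; [exact: normr_ge0|rewrite lef_pV2 ?posrE].
by rewrite lerD2l lerN2 ler_pM ?cutoff_ge0.
Qed.

Let dle d k q (a : R) : 0 < d -> (`|d^-1 * q 0 k| <= a) = (`|q 0 k| <= a * d).
Proof. by move=> d0; rewrite normrM normfV (gtr0_norm d0) ler_pdivrMl// [d * a]mulrC. Qed.

Let dge d k q (a : R) : 0 < d -> (a <= `|d^-1 * q 0 k|) = (a * d <= `|q 0 k|).
Proof. by move=> d0; rewrite normrM normfV (gtr0_norm d0) ler_pdivlMl// [d * a]mulrC. Qed.

Lemma axcut0 d q : 0 < d -> `|q 0 (ix j0)| <= d -> `|q 0 (iy j0)| <= d ->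
  axcut d q = 0 /\ forall i, daxcut d i q = 0.
Proof.
move=> d0 hx hy; rewrite /axcut /daxcut.
have [|-> ->] := @cutoff1 R (d^-1 * q 0 (ix j0)); first by rewrite dle// mul1r.
have [|-> ->] := @cutoff1 R (d^-1 * q 0 (iy j0)); first by rewrite dle// mul1r.
by split=> [|i]; rewrite ?mulr1 ?subrr// !mul0r !mulr0 addr0 oppr0.
Qed.

Lemma axcut1 d q : 0 < d -> 2 * d <= `|q 0 (ix j0)| -> axcut d q = 1.
Proof.
move=> d0 hx; rewrite /axcut.
have [|-> _] := @cutoff0 R (d^-1 * q 0 (ix j0)); first by rewrite dge.
by rewrite mul0r subr0.
Qed.

Lemma daxcut_supp d q i : 0 < d ->
  2 * d < `|q 0 (ix j0)| \/ 2 * d < `|q 0 (iy j0)| -> daxcut d i q = 0.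
Proof.
move=> d0 [] hq; rewrite /daxcut.
  have [|-> ->] := @cutoff0 R (d^-1 * q 0 (ix j0)); first by rewrite dge// ltW.
  by rewrite !mul0r mulr0 addr0 oppr0.
have [|-> ->] := @cutoff0 R (d^-1 * q 0 (iy j0)); first by rewrite dge// ltW.
by rewrite !mul0r mulr0 addr0 oppr0.
Qed.

(** Hence the horizontal derivatives of the cutoff are its plain partial derivatives. *)
Lemma daxcut_it d q : daxcut d it q = 0.
Proof. by rewrite /daxcut ix_it iy_it !mulr0 addr0 oppr0. Qed.

Lemma daxcut_bound C d q i : 0 < d -> (forall x : R, `|dcutoff x| <= C) ->
  `|daxcut d i q| <= 2 * C / d.
Proof.
move=> d0 hC; have C0 : 0 <= C := le_trans (normr_ge0 _) (hC 0).
have step (x y : R) (b : bool) :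
    `|cutoff x * (dcutoff y * (d^-1 * b%:R))| <= C / d.
  rewrite normrM ger0_norm ?cutoff_ge0// -[leRHS]mul1r.
  apply: ler_pM; rewrite ?cutoff_ge0 ?cutoff_le1// normrM; apply: ler_pM => //.
  have d1 : 0 <= d^-1 by rewrite invr_ge0 ltW.
  by rewrite ger0_norm ?mulr_ge0// ler_piMr// lern1 leq_b1.
rewrite normrN; have -> : 2 * C / d = C / d + C / d by ring.
by apply: (le_trans (ler_normD _ _)); apply: lerD; exact: step.
Qed.

End axis_cutoff.

Section comparison.
Context {R : realType} {m : nat} (phi f h g V p Q : R -> R) (c r1 e : R).
Notation n := (m + m + 1)%N.
Notation dphi := (derive1 phi).
Implicit Types (q : 'rV[R]_n) (i : 'I_n) (j : 'I_m).
Notation e_ i := (delta_mx 0 i : 'rV[R]_n).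
Context (phi_cont : {within `[0, +oo[, continuous phi})
  (phi_derivable : forall t : R, 0 < t -> derivable phi t 1)
  (phi'_cont : forall t : R, 0 < t -> {for t, continuous (derive1 phi)})
  (phi0 : phi 0 = 0)
  (phi_ge0 : forall t : R, 0 <= t -> 0 <= phi t)
  (phi_le : forall s t : R, 0 <= s -> s <= t -> phi s <= phi t)
  (f_cont : {within `[0, +oo[, continuous f})
  (f_incr : forall s t : R, 0 <= s -> s < t -> f s < f t)
  (f_gt0 : forall t : R, 0 < t -> 0 < f t)
  (h_cont : forall t : R, 0 < t -> {for t, continuous h})
  (h_noninc : forall s t : R, 0 < s -> s <= t -> h t <= h s)
  (g_cont : {within `[0, +oo[, continuous g})
  (g_ge0 : forall t : R, 0 <= t -> 0 <= g t) (g0 : g 0 = 0)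
  (u : 'rV[R]_n -> R) (u_ge0 : forall q, 0 <= u q)
  (u_sol : weak_solution phi f h g u).
Context (c_gt0 : 0 < c) (r1_gt0 : 0 < r1) (e_gt0 : 0 < e) (p0 : p 0 = 0)
  (V_cont : forall r : R, 0 <= r <= r1 -> [/\ continuous_at r V, continuous_at r p & e <= V r])
  (V_der : forall r : R, 0 < r <= r1 -> [/\ 0 < p r, is_derive r (1 : R) V (p r),
     is_derive r (1 : R) p (Q r) & continuous_at r Q])
  (divW_le : forall q, 0 < rho q -> c * nr q <= r1 ->
     divW phi p Q c q <= f (V (c * nr q)) / 2)
  (hg_le : forall q, 0 < rho q -> c * nr q <= r1 ->
     h (V (c * nr q)) * g (bs p c q) <= f (V (c * nr q)) / 4)
  (u_lt : forall q, c * nr q = r1 -> u q < V r1).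

Let hu : Ck 1 u. Proof. by case: u_sol. Qed.
Let cu : continuous u. Proof. exact: Ck_continuous hu. Qed.
Let du i q : is_derive q (e_ i) u (partial i u q). Proof. exact: Ck_der hu. Qed.

Definition cmp_ball : set 'rV[R]_n := [set q | c * nr q <= r1].
Definition gap q := u q - V (c * nr q).
(** Bounds from below the difference of the two right-hand sides, as the barrier satisfies Delta^phi
    v <= f(v) / 2. The threshold [e / 2] lies below [u] wherever [u] exceeds the barrier, which is
    at least [e]. *)
Definition excess q := source f h g u (e / 2) q - f (Num.max (V (c * nr q)) 0) / 2.

Let B := cmp_ball.

Let cnr_cts q : continuous_at q (fun q => c * nr q).
Proof. by apply: ctsM; [exact: ctsC|exact: cts_nr]. Qed.

Let cnr_ge0 q : 0 <= c * nr q. Proof. by rewrite mulr_ge0 ?nr_ge0// ltW. Qed.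

Let B_in q : B q -> 0 <= c * nr q <= r1.
Proof. by move=> Bq; rewrite cnr_ge0. Qed.

Lemma closed_cmp_ball : closed B.
Proof.
have -> : B = setT `&` [set q | c * nr q <= r1] by rewrite setTI.
by apply: closedI_le => [|q _]; [exact: closedT|exact: cnr_cts].
Qed.

Lemma cmp_ball_bound q : B q -> `|q| <= 1 + (r1 / c) ^+ 2.
Proof.
move=> Bq; apply: (le_trans (norm_le_nr q)); rewrite lerD2l.
have : nr q <= r1 / c by rewrite ler_pdivlMr// mulrC.
by move=> h1; apply: lerXn2r; rewrite ?nnegrE ?nr_ge0// divr_ge0// ltW.
Qed.

Lemma compact_cmp A : closed A -> A `<=` B -> compact A.
Proof.
move=> cA AB; apply: subclosed_compact cA (@compact_ball_rV _ _ (1 + (r1 / c) ^+ 2)) _.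
by move=> q /AB; exact: cmp_ball_bound.
Qed.

Lemma max_on (F : 'rV[R]_n -> R) A : closed A -> A `<=` B ->
  (forall q, A q -> continuous_at q F) -> A !=set0 ->
  exists2 q, A q & forall y, A y -> F y <= F q.
Proof.
move=> cA AB cF A0.
have [|q /set_mem Aq hq] := EVT_max_rV A0 (compact_cmp cA AB) (f := F).
  by apply: continuous_in_subspaceT => q /set_mem; exact: cF.
by exists q => // y Ay; apply: hq; exact/mem_set.
Qed.

Let cV q : B q -> continuous_at q (fun q => V (c * nr q)).
Proof. by move=> /B_in/V_cont[h1 _ _]; apply: cts_comp => //; exact: cnr_cts. Qed.

Lemma cts_gap q : B q -> continuous_at q gap.
Proof. by move=> /cV; apply: ctsB; exact: cu. Qed.

Lemma cts_excess q : B q -> continuous_at q excess.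
Proof.
move=> Bq; apply: ctsB.
  by apply: (cts_source f_cont g_cont h_cont u_sol); rewrite divr_gt0.
apply: ctsM; last exact: ctsC.
apply: (cts_comp (h := fun y => f (Num.max y 0))); first exact: cV.
exact: within0y_continuous.
Qed.

Lemma gap_interior q : B q -> 0 < gap q -> c * nr q < r1.
Proof.
move=> Bq gq; rewrite lt_neqAle [_ <= _]Bq andbT; apply/eqP => E.
by move: gq; rewrite /gap E subr_gt0 ltNge (ltW (u_lt E)).
Qed.

Lemma near_cmp_ball q : c * nr q < r1 -> \forall y \near q, B y.
Proof.
move=> qr; have : \forall y \near q, c * nr y < r1 by exact: (cvgr_lt _ (@cnr_cts q) _ qr).
by apply: (@filterS _ (nbhs q) (nbhs_filter q)) => y /ltW.
Qed.

Lemma excess_arith (fu fv a b : R) : 0 < fv -> fv < fu -> a <= b -> b <= fv / 4 ->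
  0 < fu - a - fv / 2.
Proof. by lra. Qed.

(** At an interior maximum of the gap the gradients agree, so [g] is evaluated at the slope of the
    barrier, and h(u) <= h(v) since u > v. What remains exceeds f(v) (1 - 1/4 - 1/2). *)
Lemma excess_gt0 q : B q -> (forall y, B y -> gap y <= gap q) -> 0 < gap q ->
  0 < excess q.
Proof.
move=> Bq hmax gq; have qr := gap_interior Bq gq.
have nmax : \forall y \near q, gap y <= gap q.
  by have := near_cmp_ball qr; apply: (@filterS _ (nbhs q) (nbhs_filter q)) => y; exact: hmax.
have [_ _ eV] := V_cont (B_in Bq).
have V0 := lt_le_trans e_gt0 eV.
have Vu : V (c * nr q) < u q by move: gq; rewrite subr_gt0.
suff hgn : h (V (c * nr q)) * g (hnorm u q) <= f (V (c * nr q)) / 4.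
  rewrite /excess (sourceE _ _ _ u_ge0); last first.
    by apply: (le_trans _ (le_trans eV (ltW Vu))); rewrite ler_pdivrMr// ler_peMr ?ler1n// ltW.
  rewrite max_l ?ltW//; apply: excess_arith hgn; first exact: f_gt0.
    by apply: f_incr; rewrite ?ltW.
  by apply: ler_wpM2r; [apply: g_ge0; exact: sqrtr_ge0|apply: h_noninc; rewrite ?ltW].
have part i d : is_derive q (e_ i) (fun q => V (c * nr q)) d -> partial i u q = d.
  move=> hd; apply/eqP; rewrite -subr_eq0; apply/eqP.
  exact: (derivative_at_max (derB (du i q) hd) nmax).
have [rq|rq] := ltP 0 (rho q).
  have N0 := N4_gt0 rq.
  have r0 : 0 < c * nr q <= r1 by rewrite mulr_gt0 ?nr_gt0.
  have [pq dV _ _] := V_der r0.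
  have -> : hnorm u q = bs p c q; last exact: hg_le.
  rewrite /hnorm hdotE -(norm_dbv rq c_gt0 pq).
  have -> : (fun j => XH j u q) = (fun j => Xd j (dbv p c) q).
    by apply/funext => j; rewrite XHE /Xd !(part _ _ (der_bv N0 _ dV)).
  have -> // : (fun j => YH j u q) = (fun j => Yd j (dbv p c) q).
  by apply/funext => j; rewrite YHE /Yd !(part _ _ (der_bv N0 _ dV)).
(* On the center the barrier has zero horizontal gradient: off the origin because [ZX] and [ZY]
   vanish, at the origin because the profile starts with zero slope. The gradient term then contains
   g(0) = 0. *)
have rho0 : rho q = 0 by apply/eqP; rewrite eq_le rq rho_ge0.
have XY0 j : XH j u q = 0 /\ YH j u q = 0.
  have [x0 y0] := rho0_coord j rho0.
  have [N0|N0] := ltP 0 (N4 q).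
    have r0 : 0 < c * nr q <= r1 by rewrite mulr_gt0 ?nr_gt0.
    have [pq dV _ _] := V_der r0.
    have -> : XH j u q = Xd j (dbv p c) q by rewrite XHE /Xd !(part _ _ (der_bv N0 _ dV)).
    have -> : YH j u q = Yd j (dbv p c) q by rewrite YHE /Yd !(part _ _ (der_bv N0 _ dV)).
    by rewrite XV_E// YV_E// /ZX /ZY x0 y0 !mulr0 addr0 subr0 mulr0.
  have q0 : q = 0 by apply: N40_eq0; apply/eqP; rewrite eq_le N0 N4_ge0.
  have h0r : 0 <= (0 : R) <= r1 by rewrite lexx ltW.
  have [_ cp _] := V_cont h0r.
  have [||dx dy] := der_bv_origin j c_gt0 r1_gt0 p0 cp (V := V).
  - by move=> r /V_cont[].
  - by move=> r /V_der[].
  rewrite XHE YHE /Xd /Yd x0 y0 !mulr0 !mul0r addr0 subr0.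
  by split; apply: part; rewrite q0.
have -> : hnorm u q = 0.
  rewrite /hnorm hdotE /pair_dot big1 ?sqrtr0// => j _.
  by have [-> ->] := XY0 j; rewrite !mulr0 addr0.
by rewrite g0 mulr0 divr_ge0// ltW// f_gt0.
Qed.

(* Near its maximum the gap keeps a definite distance from the set where
   [excess] fails to be positive. *)
Lemma level_exists (q0 : 'rV[R]_n) : B q0 -> 0 < gap q0 ->
  exists (q1 : 'rV[R]_n) (l : R), [/\ B q1, 0 < l, l < gap q1 &
    forall q, B q -> l <= gap q -> 0 < excess q].
Proof.
move=> Bq0 gq0.
have [q1 Bq1 hq1] : exists2 q, B q & forall y, B y -> gap y <= gap q.
  apply: max_on; [exact: closed_cmp_ball|by []|exact: cts_gap|by exists q0].
have g1 : 0 < gap q1 := lt_le_trans gq0 (hq1 _ Bq0).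
pose Z := B `&` [set q | excess q <= 0].
have cZ : closed Z by apply: closedI_le; [exact: closed_cmp_ball|exact: cts_excess].
have half0 : 0 < gap q1 / 2 by rewrite divr_gt0.
have half1 : gap q1 / 2 < gap q1 by rewrite gtr_pMr// invf_lt1// ltr1n.
have [Z0|Z0] := pselect (Z !=set0); last first.
  exists q1, (gap q1 / 2); split=> // q Bq _.
  by rewrite ltNge; apply/negP => Eq; apply: Z0; exists q.
have [q2 [Bq2 Eq2] hq2] : exists2 q, Z q & forall y, Z y -> gap y <= gap q.
  by apply: max_on => // [q [] //|q [Bq _]]; exact: cts_gap.
have g21 : gap q2 < gap q1.
  rewrite ltNge; apply/negP => g12.
  have : 0 < excess q2.
    apply: excess_gt0 => // [y By|]; first exact: le_trans (hq1 _ By) g12.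
    exact: lt_le_trans g1 g12.
  by rewrite ltNge [_ <= _]Eq2.
(* The midpoint clears the bad set [Z], where the gap is at most [gap q2]; half of [gap q1] keeps
   the level positive, as [gap q2] may be negative. *)
exists q1, (Num.max (gap q1 / 2) ((gap q1 + gap q2) / 2)); split=> //.
- by rewrite lt_max half0.
- by rewrite gt_max half1/=; move: g21; lra.
- move=> q Bq; rewrite ge_max => /andP[_ lq].
  rewrite ltNge; apply/negP => Eq; have := hq2 q (conj Bq Eq).
  by move: lq g21; lra.
Qed.

Lemma bounded_on (F : 'rV[R]_n -> R) : (forall q, B q -> continuous_at q F) ->
  exists2 M, 0 <= M & forall q, B q -> `|F q| <= M.
Proof.
move=> cF; have B0 : B !=set0.
  by exists 0; rewrite /B /cmp_ball /= nr0 mulr0 ltW.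
have cF' q : B q -> continuous_at q (fun q => `|F q|) by move=> Bq; apply: cts_norm; exact: cF.
have [q _ hq] := max_on closed_cmp_ball (@subset_refl _ B) cF' B0.
by exists `|F q|.
Qed.

Section test.
Context (j0 : 'I_m) (l : R) (l0 : 0 < l).
Hypothesis excess_pos : forall q, B q -> l <= gap q -> 0 < excess q.
Implicit Types (d : R).

(** Set to 0 beyond the ball, where nothing is known of the profile. Its positive values inside stay
    off the boundary sphere. *)
Definition test d q :=
  if c * nr q <= r1 then sqpos (gap q - l) * axcut j0 d q else 0.
Definition dtest d i q := if c * nr q <= r1 then
  sqpos (gap q - l) * daxcut j0 d i q +
  axcut j0 d q * (dsqpos (gap q - l) * (partial i u q - dbv p c i q)) else 0.

(** The conditions gap >= l and max(|x_j0|, |y_j0|) >= d, negated to fit [closedI_le]. *)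
Definition test_supp d : set 'rV[R]_n := (B `&` [set q | - gap q <= - l]) `&`
  [set q | - Num.max `|q 0 (ix j0)| `|q 0 (iy j0)| <= - d].

Lemma closed_test_supp d : closed (test_supp d).
Proof.
apply: closedI_le => [|q _].
  by apply: closedI_le => [|q Bq]; [exact: closed_cmp_ball|apply: ctsN; exact: cts_gap].
by apply: ctsN; apply: cts_max; apply: cts_norm; exact: cts_coord.
Qed.

(** A positive gap excludes the boundary sphere by [u_lt], and the distance [d] excludes the center;
    around each point of this set the barrier is regular. *)
Lemma test_suppP d q : 0 < d -> test_supp d q ->
  [/\ B q, l <= gap q, 0 < rho q, 0 < c * nr q <= r1 & c * nr q < r1].
Proof.
move=> d0 [[Bq /=]]; rewrite !lerN2 => lq dq.
have qr : c * nr q < r1 by apply: gap_interior => //; exact: lt_le_trans lq.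
have rq : 0 < rho q.
  rewrite lt_neqAle rho_ge0 andbT eq_sym; apply/eqP => /(rho0_coord j0)[x0 y0].
  by move: dq; rewrite x0 y0 normr0 maxxx leNgt d0.
by split=> //; rewrite mulr_gt0 ?(nr_gt0 (N4_gt0 rq)).
Qed.

Lemma test_off d q : 0 < d -> ~ test_supp d q ->
  [/\ test d q = 0, forall i, dtest d i q = 0 &
    B q -> sqpos (gap q - l) = 0 \/ forall i, daxcut j0 d i q = 0].
Proof.
move=> d0 nq; have [lq|lq] := leP l (gap q); last first.
  have gl : gap q - l <= 0 by rewrite subr_le0 ltW.
  rewrite /test /dtest sqpos_le0// dsqpos_le0// mul0r; split=> [|i|_]; last by left.
  - by case: ifP.
  - by case: ifP => // _; rewrite !mul0r mulr0 addr0.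
have cut0 : B q -> axcut j0 d q = 0 /\ forall i, daxcut j0 d i q = 0.
  move=> Bq; have small : Num.max `|q 0 (ix j0)| `|q 0 (iy j0)| <= d.
    rewrite leNgt; apply/negP => dq; apply: nq; split; last by rewrite /= lerN2 ltW.
    by split=> //=; rewrite lerN2.
  by move: small; rewrite ge_max => /andP[]; exact: axcut0.
rewrite /test /dtest; split=> [|i|Bq]; last by right; have [] := cut0 Bq.
  by case: ifP => // /cut0[-> _]; rewrite mulr0.
by case: ifP => // /cut0[-> ->]; rewrite mulr0 mul0r addr0.
Qed.

Lemma test_ge0 d q : 0 <= test d q.
Proof. by rewrite /test; case: ifP => // _; rewrite mulr_ge0 ?sqpos_ge0 ?axcut_ge0. Qed.

Lemma near_ball_eq d (F G : 'rV[R]_n -> R) q : c * nr q < r1 ->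
  \forall y \near q, F y = (if c * nr y <= r1 then F y else G y).
Proof.
move=> qr; have := near_cmp_ball qr.
by apply: (@filterS _ (nbhs q) (nbhs_filter q)) => y ->.
Qed.

Let cts_dbv' d q i : 0 < d -> test_supp d q -> continuous_at q (dbv p c i).
Proof.
move=> d0 /(test_suppP d0)[Bq _ rq r0 _]; apply: cts_dbv => //.
by have [] := V_cont (B_in Bq).
Qed.

Let cts_sq q : B q -> continuous_at q (fun q => sqpos (gap q - l)).
Proof.
move=> Bq; apply: cts_comp; last exact: cts_sqpos.
by apply: ctsB; [exact: cts_gap|exact: ctsC].
Qed.

Lemma cts_test d q : 0 < d -> test_supp d q -> continuous_at q (test d).
Proof.
move=> d0 /(test_suppP d0)[Bq _ _ _ qr].
apply: near_eq_cts (near_ball_eq d _ (fun=> 0) qr) _.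
by apply: ctsM; [exact: cts_sq|exact: cts_axcut].
Qed.

Lemma cts_dtest d q i : 0 < d -> test_supp d q -> continuous_at q (dtest d i).
Proof.
move=> d0 qs; have [Bq _ _ _ qr] := test_suppP d0 qs.
apply: near_eq_cts (near_ball_eq d _ (fun=> 0) qr) _.
apply: ctsD; apply: ctsM; [exact: cts_sq|exact: cts_daxcut|exact: cts_axcut|].
apply: ctsM.
  apply: cts_comp; last exact: cts_dsqpos.
  by apply: ctsB; [exact: cts_gap|exact: ctsC].
by apply: ctsB; [exact: Ck1_partial_continuous|exact: cts_dbv' qs].
Qed.

Lemma der_test d q i : 0 < d -> test_supp d q -> is_derive q (e_ i) (test d) (dtest d i q).
Proof.
move=> d0 qs; have [Bq _ rq r0 qr] := test_suppP d0 qs.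
apply: near_eq_der (near_ball_eq d _ (fun=> 0) qr) _.
have [_ dV _ _] := V_der r0.
have dg := derB (derB (du i q) (der_bv (N4_gt0 rq) i dV)) (derC l q (e_ i)).
apply: is_derive_eq (derM (der_comp (f := fun y => gap y - l) dg (der_sqpos _)) (der_axcut j0 d i q)) _.
by rewrite /dtest Bq subr0.
Qed.

Let der_test_all d i q : 0 < d -> is_derive q (e_ i) (test d) (dtest d i q).
Proof.
move=> d0; apply: (der_ext (@closed_test_supp d)) => {}q.
- by move=> /(test_off d0)[].
- by move=> /(test_off d0)[].
- exact: der_test.
Qed.

Let supp_bound d q : 0 < d -> test_supp d q -> `|q| <= 1 + (r1 / c) ^+ 2.
Proof. by move=> d0 /(test_suppP d0)[Bq _ _ _ _]; exact: cmp_ball_bound. Qed.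

Let Cc_supp d F : 0 < d -> (forall q, ~ test_supp d q -> F q = 0) ->
  (forall q, test_supp d q -> continuous_at q F) -> Cc F.
Proof. by move=> d0; apply: (Cc_ext (@closed_test_supp d)) => q; exact: supp_bound. Qed.

Lemma Cc_test d : 0 < d -> Cc (test d).
Proof.
move=> d0; apply: (Cc_supp d0) => q; first by move=> /(test_off d0)[].
exact: cts_test.
Qed.

Lemma Cc_dtest d i : 0 < d -> Cc (dtest d i).
Proof.
move=> d0; apply: (Cc_supp d0) => q; first by move=> /(test_off d0)[].
exact: cts_dtest.
Qed.

Lemma Cc_excess_test d : 0 < d -> Cc (fun q => excess q * test d q).
Proof.
move=> d0; apply: (Cc_supp d0) => q.
  by move=> /(test_off d0)[-> _ _]; rewrite mulr0.
move=> qs; have [Bq _ _ _ _] := test_suppP d0 qs.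
by apply: ctsM; [exact: cts_excess|exact: cts_test].
Qed.

Let FX j q := fluxc phi u q * XH j u q.
Let FY j q := fluxc phi u q * YH j u q.

(** The part of the flux difference paired with the gradient of the cutoff; the other part has a
    sign by [flux_monotone]. *)
Definition cut_err d q := if c * nr q <= r1 then
  sqpos (gap q - l) * \sum_(j < m)
    ((FX j q - WX phi p c j q) * Xd j (daxcut j0 d) q +
     (FY j q - WY phi p c j q) * Yd j (daxcut j0 d) q) else 0.

Lemma cut_err_off d q : 0 < d -> ~ test_supp d q -> cut_err d q = 0.
Proof.
move=> d0 nq; rewrite /cut_err; case: ifP => // Bq.
have [_ _ /(_ Bq)[->|dk0]] := test_off d0 nq; first by rewrite mul0r.
rewrite big1 ?mulr0// => j _.
by rewrite /Xd /Yd !dk0 !mulr0 addr0 subr0 !mulr0 addr0.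
Qed.

Let bs_pos q : B q -> 0 < rho q -> 0 < c * nr q <= r1 -> 0 < bs p c q.
Proof. by move=> Bq rq /V_der[pq _ _ _]; exact: bs_gt0. Qed.

Let phi_cts (t : R) : 0 < t -> continuous_at t phi.
Proof.
move=> t0; apply: differentiable_continuous; apply/derivable1_diffP; exact: phi_derivable.
Qed.

Let phi_der (t : R) : 0 < t -> is_derive t (1 : R) phi (dphi t).
Proof. by move=> t0; split; [exact: phi_derivable|rewrite derive1E]. Qed.

Let cts_W q j : B q -> 0 < rho q -> 0 < c * nr q <= r1 ->
  continuous_at q (WX phi p c j) /\ continuous_at q (WY phi p c j).
Proof.
move=> Bq rq r0; have [_ cp _] := V_cont (B_in Bq).
have cf := phi_cts (bs_pos Bq rq r0).
by split; [exact: cts_WX|exact: cts_WY].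
Qed.

Lemma Cc_cut_err d : 0 < d -> Cc (cut_err d).
Proof.
move=> d0; apply: (Cc_supp d0) => q; first exact: cut_err_off.
move=> qs; have [Bq _ rq r0 qr] := test_suppP d0 qs.
apply: near_eq_cts (near_ball_eq d _ (fun=> 0) qr) _.
apply: ctsM; first exact: cts_sq.
apply: cts_sum => j; have [cX cY] := cts_W j Bq rq r0.
apply: ctsD; apply: ctsM.
- by apply: ctsB => //; exact: (cts_fluxX phi_cont phi0 u_sol).
- by apply: cts_Xd => i; exact: cts_daxcut.
- by apply: ctsB => //; exact: (cts_fluxY phi_cont phi0 u_sol).
- by apply: cts_Yd => i; exact: cts_daxcut.
Qed.

(** The weak inequality for [u] minus the divergence identity for the barrier, both tested with
    [test d]. *)
Lemma test_inequality d : 0 < d ->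
  RI (fun q => excess q * test d q) <= - RI (cut_err d).
Proof.
move=> d0.
have e20 : 0 < e / 2 by rewrite divr_gt0.
have ct := Cc_test d0; have cdt i := Cc_dtest i d0.
have cs : Cc (fun q => source f h g u (e / 2) q * test d q).
  by apply: CcMl => // q; exact: (cts_source f_cont g_cont h_cont u_sol).
have cf := Cc_flux_dot phi_cont phi0 u_sol cdt.
have wC : RI (fun q => source f h g u (e / 2) q * test d q) <= - RI (flux_dot phi u (dtest d)).
  apply: (weak_C1 phi_cont phi0 f_cont g_cont h_cont u_ge0 u_sol) => //.
  - by move=> i q; exact: der_test_all.
  - exact: test_ge0.
  - move=> q; have [qs|/(test_off d0)[-> _ _]] := pselect (test_supp d q); last by rewrite eqxx.
    have [Bq lq _ _ _] := test_suppP d0 qs; have [_ _ eV] := V_cont (B_in Bq).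
    by move=> _; move: lq eV l0; rewrite /gap; lra.
have h1 q : test_supp d q -> `|q| <= 1 + (r1 / c) ^+ 2 by exact: supp_bound.
have h2 q : ~ test_supp d q -> test d q = 0 by move=> /(test_off d0)[].
have h3 i q : ~ test_supp d q -> dtest d i q = 0 by move=> /(test_off d0)[].
have h4 q : test_supp d q -> continuous_at q (test d) /\ forall i, continuous_at q (dtest d i).
  by move=> qs; split; [exact: cts_test|move=> i; exact: cts_dtest].
have h5 q : test_supp d q -> forall i, is_derive q (e_ i) (test d) (dtest d i q).
  by move=> qs i; exact: der_test.
have h6 q : test_supp d q -> [/\ 0 < rho q, continuous_at (c * nr q) p,
    continuous_at (c * nr q) Q, continuous_at (bs p c q) phi &
    continuous_at (bs p c q) dphi].
  move=> /(test_suppP d0)[Bq _ rq r0 _]; have [_ cp _] := V_cont (B_in Bq).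
  have [_ _ _ cQ] := V_der r0; have bq := bs_pos Bq rq r0.
  by split=> //; [exact: phi_cts|exact: phi'_cont].
have h7 q : test_supp d q -> is_derive (c * nr q) (1 : R) p (Q (c * nr q)) /\
    is_derive (bs p c q) (1 : R) phi (dphi (bs p c q)).
  move=> /(test_suppP d0)[Bq _ rq r0 _]; have [_ _ dp _] := V_der r0.
  by split=> //; apply: phi_der; exact: bs_pos.
have [cW cD wW] := weak_divW (@closed_test_supp d) h1 h2 h3 h4 h5 h6 h7.
have ce := Cc_cut_err d0; have cx := Cc_excess_test d0.
have i1 : RI (fun q => excess q * test d q) <=
    RI (fun q => source f h g u (e / 2) q * test d q - divW phi p Q c q * test d q).
  apply: RI_le => // [|q]; first exact: CcB.
  rewrite -mulrBl; have [qs|/(test_off d0)[-> _ _]] := pselect (test_supp d q); last by rewrite !mulr0.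
  have [Bq lq rq _ _] := test_suppP d0 qs; have [_ _ eV] := V_cont (B_in Bq).
  apply: ler_wpM2r; first exact: test_ge0.
  rewrite /excess lerD2l lerN2 max_l; first exact: divW_le.
  exact: ltW (lt_le_trans e_gt0 eV).
have i2 : RI (cut_err d) <= RI (fun q => flux_dot phi u (dtest d) q -
    \sum_(j < m) (WX phi p c j q * Xd j (dtest d) q + WY phi p c j q * Yd j (dtest d) q)).
  apply: RI_le => // [|q]; first exact: CcB.
  have [qs|nq] := pselect (test_supp d q); last first.
    have [_ dt0 _] := test_off d0 nq.
    rewrite cut_err_off// /flux_dot -sumrB big1// => j _.
    by rewrite /Xd /Yd !dt0 !mulr0 addr0 subr0 !mulr0 addr0 subrr.
  have [Bq lq rq r0 _] := test_suppP d0 qs; have [pq _ _ _] := V_der r0.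
  (* The nonnegative weight of grad u - grad v in the gradient of the test function. *)
  pose k := axcut j0 d q * dsqpos (gap q - l).
  have k0 : 0 <= k by rewrite mulr_ge0 ?axcut_ge0 ?dsqpos_ge0.
  have := flux_monotone phi0 phi_ge0 phi_le (a := fun j => XH j u q) (b := fun j => YH j u q)
    (a' := fun j => Xd j (dbv p c) q) (b' := fun j => Yd j (dbv p c) q) (erefl _) (erefl _).
  rewrite (norm_dbv rq c_gt0 pq) -/(hdot u u q) -/(hnorm u q) => mono.
  rewrite -subr_ge0; apply: le_trans (mulr_ge0 k0 mono) _.
  rewrite le_eqVlt; apply/orP; left; apply/eqP.
  rewrite /cut_err /flux_dot Bq -sumrB /pair_dot !mulr_sumr -sumrB; apply: eq_bigr => j _.
  have -> : Xd j (dtest d) q = sqpos (gap q - l) * Xd j (daxcut j0 d) q +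
      k * (XH j u q - Xd j (dbv p c) q).
    by rewrite XHE /Xd /dtest Bq /k; ring.
  have -> : Yd j (dtest d) q = sqpos (gap q - l) * Yd j (daxcut j0 d) q +
      k * (YH j u q - Yd j (dbv p c) q).
    by rewrite YHE /Yd /dtest Bq /k; ring.
  rewrite (WX_E phi rq c_gt0 pq) (WY_E phi rq c_gt0 pq) /FX /FY /fluxc.
  move: (_ * phi (hnorm u q)) (_ * phi (bs p c q)) => a b; ring.
rewrite RIB// wW opprK in i2; rewrite RIB// in i1.
by move: i1 i2 wC; lra.
Qed.

(* The integrand is O(1/d) and supported where |x_j0|, |y_j0| <= 2 d, a set of
   measure O(d^2): this is why the center can be removed. *)
Lemma cut_err_bound : exists2 C, 0 <= C & forall d, 0 < d -> `|RI (cut_err d)| <= C * d.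
Proof.
have [S S0 hS] := bounded_on cts_sq.
have [B1 B10 hB1] : exists2 M, 0 <= M & forall q, B q -> `|phi (Num.max (hnorm u q) 0)| <= M.
  apply: bounded_on => q _; apply: (cts_comp (h := fun y => phi (Num.max y 0))).
    exact: cts_hnorm.
  exact: within0y_continuous.
have [B2 B20 hB2] : exists2 M, 0 <= M &
    forall q, B q -> `|phi (Num.max (c * p (c * nr q)) 0)| <= M.
  apply: bounded_on => q Bq; apply: (cts_comp (h := fun y => phi (Num.max y 0))).
    apply: ctsM; first exact: ctsC.
    have [_ cp _] := V_cont (B_in Bq).
    by apply: (cts_comp (h := p)) => //; exact: cnr_cts.
  exact: within0y_continuous.
have [C C0 hC] := @dcutoff_bounded R.
pose bd := 1 + (r1 / c) ^+ 2.
have bd0 : 0 <= bd by rewrite addr_ge0 ?sqr_ge0.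
pose P := \prod_(i < n | (i != ix j0) && (i != iy j0)) (2 * bd).
have P0 : 0 <= P by apply: prodr_ge0 => i _; rewrite mulr_ge0.
(* Each index contributes an X and a Y term, each with fluxes at most B1 + B2 and a cutoff
   derivative at most 2 C / d by [daxcut_bound]. *)
pose MM := S * \sum_(j < m) (4 * (B1 + B2) * C).
have MM0 : 0 <= MM.
  by rewrite mulr_ge0//; apply: sumr_ge0 => j _; rewrite !mulr_ge0 ?addr_ge0// ltW.
exists (16 * MM * P) => [|d d0]; first by apply: mulr_ge0 => //; apply: mulr_ge0.
(* The two cut coordinates give sides of length 4 d, hence 16 d^2; the bound [MM / d] on the
   integrand leaves one factor [d]. *)
pose b i := if (i == ix j0) || (i == iy j0) then 2 * d else bd.
have -> : 16 * MM * P * d = MM / d * \prod_i (2 * b i).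
  rewrite (bigD1 (ix j0))//= (bigD1 (iy j0)) ?iy_ix//= /b !eqxx orbT/=.
  under eq_bigr => i /andP[/negbTE -> /negbTE ->] do rewrite /=.
  by rewrite -/P; field; rewrite gt_eqF.
apply: RI_bound.
- by move=> i; rewrite /b; case: ifP => // _; rewrite mulr_ge0 ?(ltW d0).
- exact: Cc_cut_err.
- move=> q; have [qs|nq] := pselect (test_supp d q); last first.
    by rewrite cut_err_off// normr0 divr_ge0// ltW.
  have [Bq lq rq r0 _] := test_suppP d0 qs; have [pq _ _ _] := V_der r0.
  have FB j : `|FX j q| <= B1 /\ `|FY j q| <= B1.
    have := hB1 q Bq; rewrite max_l ?sqrtr_ge0// => hb.
    have key (a : R) : `|a| <= hnorm u q -> `|fluxc phi u q * a| <= B1.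
      move=> ha; apply: le_trans hb; rewrite /fluxc mulrAC normrM ler_piMl//.
      have [->|hn0] := eqVneq (hnorm u q) 0; first by rewrite invr0 mul0r normr0.
      have hn : 0 < hnorm u q by rewrite lt_neqAle eq_sym hn0 sqrtr_ge0.
      by rewrite normrM normfV (gtr0_norm hn) ler_pdivrMl// mulr1.
    by have [h1 h2] := XH_le_hnorm u q j; split; exact: key.
  have WB j : `|WX phi p c j q| <= B2 /\ `|WY phi p c j q| <= B2.
    have bq := bs_pos Bq rq r0.
    have cp0 : 0 <= c * p (c * nr q) by rewrite mulr_ge0 ?ltW.
    have hb : phi (bs p c q) <= B2.
      apply: le_trans (le_trans (ler_norm _) (hB2 q Bq)); rewrite max_l//.
      apply: phi_le; first exact: ltW.
      rewrite /bs -mulrA ler_piMr// ler_pdivrMr ?(nr_gt0 (N4_gt0 rq))// mul1r.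
      exact: ra_le_nr.
    have key (a : R) : `|a| <= bs p c q -> `|(bs p c q)^-1 * phi (bs p c q) * a| <= B2.
      move=> ha; apply: le_trans hb; rewrite mulrAC normrM -[leRHS]mul1r ler_pM//.
        by rewrite normrM normfV (gtr0_norm bq) ler_pdivrMl// mulr1.
      by rewrite ger0_norm// phi_ge0// ltW.
    have := pair_dot_coord (fun j => Xd j (dbv p c) q) (fun j => Yd j (dbv p c) q) j.
    rewrite (norm_dbv rq c_gt0 pq) => -[h1 h2].
    by rewrite (WX_E phi rq c_gt0 pq) (WY_E phi rq c_gt0 pq); split; exact: key.
  rewrite /cut_err Bq normrM -[MM / d]mulrA; apply: ler_pM => //; first exact: hS.
  rewrite mulr_suml; apply: (le_trans (ler_norm_sum _ _ _)); apply: ler_sum => j _.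
  have [fx fy] := FB j; have [wx wy] := WB j.
  have -> : 4 * (B1 + B2) * C / d = (B1 + B2) * (2 * C / d) + (B1 + B2) * (2 * C / d) by ring.
  apply: (le_trans (ler_normD _ _)); rewrite /Xd /Yd daxcut_it !mulr0 addr0 subr0.
  apply: lerD; rewrite normrM; apply: ler_pM => //; try exact: daxcut_bound.
    by apply: (le_trans (ler_normB _ _)); exact: lerD.
  by apply: (le_trans (ler_normB _ _)); exact: lerD.
- move=> q i; rewrite /b; case: ifP => [/orP hi bq|_ bq].
    rewrite /cut_err; case: ifP => // _.
    have dk0 i' : daxcut j0 d i' q = 0.
      by apply: daxcut_supp => //; case: hi bq => /eqP -> bq; [left|right].
    rewrite big1 ?mulr0// => j _.
    by rewrite /Xd /Yd !dk0 !mulr0 addr0 subr0 !mulr0 addr0.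
  apply: cut_err_off => // /(supp_bound d0); rewrite leNgt => /negP; apply.
  exact: lt_le_trans bq (rV_coord_le _ _).
Qed.

(** As [d] tends to 0 the tested integral stays above a fixed positive number, whereas [cut_err] is
    O(d). *)
Lemma no_level (q1 : 'rV[R]_n) : B q1 -> l < gap q1 -> False.
Proof.
move=> Bq1 lq1.
(* The point [q1] may lie on the hyperplane where the cutoff can vanish; a small move along x_j0
   preserves the strict inequalities. *)
have [q2 [Bq2 lq2 x2]] : exists q, [/\ B q, l < gap q & q 0 (ix j0) != 0].
  have [x1|x1] := eqVneq (q1 0 (ix j0)) 0; last by exists q1.
  have qr : c * nr q1 < r1 by apply: gap_interior => //; exact: lt_trans lq1.
  have n1 := near_cmp_ball qr.
  have n2 : \forall y \near q1, l < gap y by exact: (cvgr_gt _ (cts_gap Bq1) _ lq1).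
  have n3 : \forall y \near q1, B y /\ l < gap y by apply: filterI.
  have hv : q1 + t *: e_ (ix j0) @[t --> (0 : R)] --> q1.
    rewrite -[X in _ --> X](_ : q1 + 0 *: e_ (ix j0) = q1); last by rewrite scale0r addr0.
    have h1 : t *: e_ (ix j0) @[t --> (0 : R)] --> 0 *: e_ (ix j0) by apply: cvgZr_tmp; exact: cvg_id.
    exact: (cvgD (cvg_cst q1) h1).
  have n4 : \forall t \near (0 : R)^', B (q1 + t *: e_ (ix j0)) /\ l < gap (q1 + t *: e_ (ix j0)).
    by apply: nbhs_dnbhs; exact: (hv _ n3).
  have n5 : \forall t \near (0 : R)^', t != 0 by exact: nbhs_dnbhs_neq.
  have [t [[Bt lt] t0]] := filter_ex (filterI n4 n5).
  exists (q1 + t *: e_ (ix j0)); split=> //.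
  by rewrite !mxE x1 add0r !eqxx/= mulr1.
(* The largest [d] for which [axcut1] gives the value 1 at [q2]. *)
pose d0 := `|q2 0 (ix j0)| / 2.
have d00 : 0 < d0 by rewrite divr_gt0// normr_gt0.
have pos d q : 0 < d -> 0 <= excess q * test d q.
  move=> d1; have [qs|/(test_off d1)[-> _ _]] := pselect (test_supp d q); last by rewrite mulr0.
  have [Bq lq _ _ _] := test_suppP d1 qs.
  by rewrite mulr_ge0 ?test_ge0// ltW// excess_pos.
have mu0 : 0 < RI (fun q => excess q * test d0 q).
  apply: (RI_gt0 (q0 := q2)) => [||].
  - exact: Cc_excess_test.
  - by move=> q; exact: pos.
  - rewrite mulr_gt0 ?excess_pos// ?ltW// /test [_ <= _]Bq2 axcut1//.
      by rewrite mulr1 sqpos_gt0// subr_gt0.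
    by rewrite mulrC divfK.
set mu := RI _ in mu0.
have [C C0 hC] := cut_err_bound.
have small d : 0 < d -> d <= d0 -> mu <= C * d.
  move=> d1 dd; apply: (@le_trans _ _ (RI (fun q => excess q * test d q))).
    apply: RI_le; [exact: Cc_excess_test|exact: Cc_excess_test|] => q.
    have [qs|/(test_off d00)[-> _ _]] := pselect (test_supp d0 q).
      have [Bq lq _ _ _] := test_suppP d00 qs.
      apply: ler_wpM2l; first by rewrite ltW// excess_pos.
      by rewrite /test Bq; apply: ler_wpM2l; [exact: sqpos_ge0|exact: axcut_anti].
    by rewrite mulr0 pos.
  apply: (le_trans (test_inequality d1)); apply: le_trans (hC d d1).
  by rewrite -normrN ler_norm.
have C1 : 0 < C + 1 by rewrite ltr_wpDl.
(* At this [d] the error [C * d] is less than [mu]; [C + 1] avoids a division by zero. *)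
have k0 : 0 < Num.min d0 (mu / (C + 1) / 2) by rewrite lt_min d00 !divr_gt0.
have k1 : Num.min d0 (mu / (C + 1) / 2) <= d0 by rewrite ge_min lexx.
have := small _ k0 k1; rewrite leNgt => /negP; apply.
apply: (@le_lt_trans _ _ (C * (mu / (C + 1) / 2))).
  by apply: ler_wpM2l => //; rewrite ge_min lexx orbT.
rewrite -!mulrA -invfM mulrCA gtr_pMr// ltr_pdivrMr ?mul1r; last by rewrite mulr_gt0.
by rewrite mulrDl; move: C0; lra.
Qed.

End test.

Lemma comparison (j0 : 'I_m) (q0 : 'rV[R]_n) : c * nr q0 <= r1 -> u q0 <= V (c * nr q0).
Proof.
move=> Bq0; rewrite leNgt; apply/negP => Vu.
have [|q1 [l [Bq1 l0 lq1 hl]]] := @level_exists q0 Bq0; first by rewrite subr_gt0.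
exact: no_level j0 l l0 hl q1 Bq1 lq1.
Qed.

End comparison.

(** * Smallness of the scaling factor *)

Section smallness.
Context {R : realType} {m : nat} (phi h g p Y : R -> R) (D tau D' lam c : R).
Notation n := (m + m + 1)%N.
Notation dphi := (derive1 phi).
Context (phi_le : forall s t : R, 0 <= s -> s <= t -> phi s <= phi t)
  (phi'_gt0 : forall t : R, 0 < t -> 0 < dphi t)
  (D_gt0 : 0 < D) (tau_ge0 : 0 <= tau)
  (phi'_upper : forall s t : R, 0 < s <= 1 -> 0 < t ->
    s * dphi (s * t) <= D * s `^ tau * dphi t)
  (D'_gt0 : 0 < D') (lam_gt0 : 0 < lam)
  (g_upper : forall s t : R, 0 <= s <= 1 -> 0 < t ->
    g (s * t) <= D' * s `^ (tau + 1) * t ^+ 2 * dphi t).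
Context (q : 'rV[R]_n) (rq : 0 < rho q) (c_gt0 : 0 < c) (pq : 0 < p (c * nr q)).
Let r := c * nr q.

Let N0 := nr_gt0 (N4_gt0 rq).
Let A0 := ra_gt0 rq.
Let s := c * (ra q / nr q).
Let s0 : 0 < s. Proof. by rewrite mulr_gt0// divr_gt0. Qed.
Let sc : s <= c.
Proof. by rewrite ler_piMr ?(ltW c_gt0)// ler_pdivrMr// mul1r ra_le_nr. Qed.
Let bsE : bs p c q = s * p r.
Proof. by rewrite /bs /s /r; ring. Qed.

(** With [s = c * ra / nr <= c], one factor [s] is spent on s phi'(s p) <= D phi'(p), which cancels
    the denominator of p' = Y / phi'(p); the other yields [c]. In the first-order term phi(bs) <=
    phi(p) <= r F, and r = c nr cancels one 1 / nr. *)
Lemma divW_le_half (F : R) : c <= 1 -> c * (D + (2 * m%:R + 1)) <= 2^-1 ->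
  0 <= Y r <= F -> phi (p r) <= r * F ->
  divW phi p (fun r => Y r / dphi (p r)) c q <= F / 2.
Proof.
move=> c1 csmall /andP[Y0 YF] phiF; have F0 := le_trans Y0 YF.
have s1 : 0 < s <= 1 by rewrite s0 (le_trans sc).
have dP := phi'_gt0 pq.
have i1 : s * dphi (s * p r) <= D * dphi (p r).
  apply: (le_trans (phi'_upper s1 pq)); rewrite ler_wpM2r ?(ltW dP)//.
  rewrite -[leRHS]mulr1; apply: ler_wpM2l; first exact: ltW.
  have /andP[_ s1'] := s1; exact: powR_le1 (ltW s0) s1' tau_ge0.
have i2 : dphi (bs p c q) * c ^+ 2 * (Y r / dphi (p r)) * (ra q / nr q) ^+ 2 <= D * c * F.
  have -> : dphi (bs p c q) * c ^+ 2 * (Y r / dphi (p r)) * (ra q / nr q) ^+ 2 =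
      (s * dphi (s * p r)) * (s * (Y r / dphi (p r))) by rewrite bsE /s; ring.
  apply: (@le_trans _ _ (D * dphi (p r) * (s * (Y r / dphi (p r))))).
    by apply: ler_wpM2r => //; rewrite mulr_ge0 ?(ltW s0)// divr_ge0// ltW.
  have -> : D * dphi (p r) * (s * (Y r / dphi (p r))) = D * (s * Y r).
    by field; rewrite gt_eqF.
  rewrite -[leRHS]mulrA; apply: ler_wpM2l; first exact: ltW.
  by apply: ler_pM => //; exact: ltW.
have i3 : phi (bs p c q) * ra q / nr q ^+ 2 <= c * F.
  have hp : phi (bs p c q) <= r * F.
    apply: le_trans phiF; rewrite bsE; apply: phi_le; first by rewrite mulr_ge0// ltW.
    by rewrite ler_piMl ?(ltW pq)// (le_trans sc).
  rewrite ler_pdivrMr ?exprn_gt0//.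
  apply: (@le_trans _ _ (r * F * ra q)); first by apply: ler_wpM2r => //; exact: ltW.
  have -> : c * F * nr q ^+ 2 = r * F * nr q by rewrite /r; ring.
  by apply: ler_wpM2l (ra_le_nr q); rewrite !mulr_ge0// ltW.
rewrite divWE//.
have -> : (2 * m%:R + 1) * phi (bs p c q) * ra q / nr q ^+ 2 =
  (2 * m%:R + 1) * (phi (bs p c q) * ra q / nr q ^+ 2) by rewrite !mulrA.
apply: (@le_trans _ _ (D * c * F + (2 * m%:R + 1) * (c * F))).
  by apply: lerD => //; apply: ler_wpM2l => //; rewrite addr_ge0// mulr_ge0.
have -> : D * c * F + (2 * m%:R + 1) * (c * F) = c * (D + (2 * m%:R + 1)) * F by ring.
by rewrite [F / 2]mulrC ler_wpM2r.
Qed.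

(** The slope is written as 2 s times p/2, because [K_half] controls the bound on [g] at p/2 only;
    then (2 s)^(tau + 1) <= 2 s <= 2 c. *)
Lemma hg_le_quarter (hV F : R) : c <= 2^-1 -> 2 * c * D' * D / lam <= 4^-1 ->
  0 <= hV -> 0 <= F ->
  hV * ((p r / 2) ^+ 2 * dphi (p r / 2)) <= D * (F / lam) ->
  hV * g (bs p c q) <= F / 4.
Proof.
move=> c1 csmall hV0 F0 hVF.
have s2 : 2 * s <= 1 by move: sc c1; lra.
have s20 : 0 <= 2 * s <= 1 by rewrite s2 mulr_ge0// ltW.
have s2p : 0 < 2 * s by rewrite mulr_gt0.
have p2 : 0 < p r / 2 by rewrite divr_gt0.
have -> : bs p c q = 2 * s * (p r / 2) by rewrite bsE; field.
set X := (p r / 2) ^+ 2 * dphi (p r / 2) in hVF.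
have i1 : g (2 * s * (p r / 2)) <= D' * (2 * c) * X.
  apply: (le_trans (g_upper s20 p2)); rewrite -mulrA -/X ler_wpM2r//.
    by rewrite mulr_ge0 ?sqr_ge0// ltW// phi'_gt0.
  rewrite ler_wpM2l ?(ltW D'_gt0)// powRD; last by rewrite (gt_eqF s2p) /= implybT.
  rewrite powRr1 ?(ltW s2p)//; apply: (@le_trans _ _ (1 * (2 * s))).
    by apply: ler_wpM2r; rewrite ?(ltW s2p)// powR_le1// ltW.
  by rewrite mul1r ler_wpM2l.
apply: (@le_trans _ _ (hV * (D' * (2 * c) * X))); first exact: ler_wpM2l.
have -> : hV * (D' * (2 * c) * X) = D' * (2 * c) * (hV * X) by ring.
apply: (@le_trans _ _ (D' * (2 * c) * (D * (F / lam)))).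
  by apply: ler_wpM2l => //; rewrite !mulr_ge0// ltW.
have -> : D' * (2 * c) * (D * (F / lam)) = 2 * c * D' * D / lam * F by ring.
by rewrite [F / 4]mulrC ler_wpM2r.
Qed.

End smallness.

Theorem theorem6p3 (R : realType) (m : nat) (hm : (1 <= m)%N)
  (phi f h g : R -> R) (D tau B theta D' : R)
  (phi_cont : {within `[0, +oo[, continuous phi})
  (phi_derivable : forall t, 0 < t -> derivable phi t 1)
  (phi'_cont : forall t, 0 < t -> {for t, continuous (derive1 phi)})
  (phi0 : phi 0 = 0)
  (phi'_gt0 : forall t, 0 < t -> 0 < derive1 phi t)
  (phi'_L1 : L1_0 (fun t => t * derive1 phi t))
  (D_gt0 : 0 < D) (tau_ge0 : 0 <= tau)
  (phi'_upper : forall s t, 0 < s <= 1 -> 0 < t ->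
    s * derive1 phi (s * t) <= D * s `^ tau * derive1 phi t)
  (B_gt0 : 0 < B) (theta_lt2 : theta < 2)
  (phi'_lower : forall t s, 0 < t -> 1 <= s ->
    B * derive1 phi t * s `^ (- theta) <= derive1 phi (t * s))
  (f_cont : {within `[0, +oo[, continuous f})
  (f_incr : forall s t, 0 <= s -> s < t -> f s < f t)
  (f_gt0 : forall t, 0 < t -> 0 < f t)
  (h_cont : forall t, 0 < t -> {for t, continuous h})
  (h_ge0 : forall t, 0 < t -> 0 <= h t)
  (h_noninc : forall s t, 0 < s -> s <= t -> h t <= h s)
  (h_L1 : L1_0 h)
  (g_cont : {within `[0, +oo[, continuous g})
  (g_ge0 : forall t, 0 <= t -> 0 <= g t)
  (D'_gt0 : 0 < D')
  (g_upper : forall s t, 0 <= s <= 1 -> 0 < t ->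
    g (s * t) <= D' * s `^ (tau + 1) * t ^+ 2 * derive1 phi t)
  (Keller_Osserman :
    L1_infty (fun t => expR (int0 h t) / Kinv phi (Fhat theta f h t)))
  (u : 'rV[R]_(m + m + 1) -> R)
  (u_ge0 : forall q, 0 <= u q)
  (u_sol : weak_solution phi f h g u) :
  forall q, u q = 0.
Proof.
move=> q0; apply/eqP/negPn/negP => uq0.
have u0 : 0 < u q0 by rewrite lt_neqAle eq_sym uq0 u_ge0.
have e0 : 0 < u q0 / 2 by rewrite divr_gt0.
have phi_mono := phi_le phi_cont phi_derivable phi'_gt0.
have phi_pos := phi_ge0 phi_cont phi_derivable phi0 phi'_gt0.
have [T [dom [V [p [Y [[dom0 [ra0 ra0_gt0 dom_ra]] dom_le dom_down V_unb
    [V0 p0 Vdom Vder]]]]]]] :=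
  barrier_profile phi_cont phi_derivable phi'_cont phi0 phi'_gt0 phi'_L1 D_gt0 tau_ge0
    phi'_upper B_gt0 theta_lt2 phi'_lower f_cont f_incr f_gt0 h_cont h_ge0 h_noninc h_L1
    Keller_Osserman e0.
have lam0 : 0 < 2 - theta by rewrite subr_gt0.
have [cV0 _ _ _ _] := Vdom 0 dom0.
have [d d0 hd] : exists2 d, 0 < d & forall r : R, `|r| <= d -> V r < u q0.
  have u40 : 0 < u q0 / 4 by rewrite divr_gt0.
  have [d d0 hd] := (cts_epsP V 0).1 cV0 _ u40.
  exists d => // r rd; have := hd r; rewrite sub0r normrN V0 ler_distl => /(_ rd).
  by move=> /andP[]; move: u0; lra.
(* Up to this radius the profile is defined and stays below [u q0]. *)
pose r2 := Num.min d ra0.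
have r20 : 0 < r2 by rewrite lt_min d0.
have r2d : r2 <= d by rewrite ge_min lexx.
have r2a : r2 <= ra0 by rewrite ge_min lexx orbT.
have Vr2 r : 0 <= r -> r <= r2 -> V r < u q0.
  by move=> ? rr2; apply: hd; rewrite ger0_norm// (le_trans rr2).
(* These conditions do not involve the radius [r1], which is chosen later and depends on [c]. *)
have [c [c0 c1 c2 c3 c4]] : exists c, [/\ 0 < c, c <= 2^-1,
    c * (D + (2 * m%:R + 1)) <= 2^-1, 2 * c * D' * D / (2 - theta) <= 4^-1 &
    c * nr q0 <= r2].
  pose k1 := D + (2 * m%:R + 1); pose k2 := 2 * D' * D / (2 - theta).
  have k10 : 0 < k1 by rewrite addr_gt0// ltr_wpDl// mulr_ge0.
  have k20 : 0 < k2 by rewrite divr_gt0// !mulr_gt0.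
  have k30 : 0 < nr q0 + 1 by rewrite ltr_wpDl ?nr_ge0.
  exists (Num.min (Num.min 2^-1 (2^-1 / k1)) (Num.min (4^-1 / k2) (r2 / (nr q0 + 1)))).
  set c := Num.min _ _.
  have c0 : 0 < c.
    have i2 : 0 < 2^-1 :> R by rewrite invr_gt0.
    have i4 : 0 < 4^-1 :> R by rewrite invr_gt0.
    have [[h1 h2] h3] := (divr_gt0 i2 k10, divr_gt0 i4 k20, divr_gt0 r20 k30).
    by rewrite /c !lt_min i2 h1 h2 h3.
  have [h1 h2 h3 h4] : [/\ c <= 2^-1, c <= 2^-1 / k1, c <= 4^-1 / k2 & c <= r2 / (nr q0 + 1)].
    by rewrite /c !ge_min !lexx !orbT.
  split=> //.
  - by rewrite -ler_pdivlMr.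
  - have -> : 2 * c * D' * D / (2 - theta) = c * k2 by rewrite /k2; ring.
    by rewrite -ler_pdivlMr.
  - apply: (@le_trans _ _ (c * (nr q0 + 1))); last by rewrite -ler_pdivlMr.
    by apply: ler_wpM2l; [exact: ltW|rewrite lerDl].
(* [T] bounds every radius in the domain of the profile, so one bound on [u] serves for all
   candidate balls. *)
pose bd := 1 + (T / c) ^+ 2.
have cu : continuous u by case: u_sol => /Ck_continuous.
have r2T : r2 <= T.
  by have /dom_le/andP[_] : dom r2 by apply: dom_down dom_ra _ r2a; exact: ltW.
have nr_bd q : c * nr q <= T -> `|q| <= bd.
  move=> qT; apply: (le_trans (norm_le_nr q)); rewrite lerD2l.
  have hq : nr q <= T / c by rewrite ler_pdivlMr// mulrC.
  by apply: lerXn2r; rewrite ?nnegrE ?nr_ge0//; exact: le_trans (nr_ge0 q) hq.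
have ball0 : [set q : 'rV[R]_(m + m + 1) | `|q| <= bd] !=set0.
  by exists q0; apply: nr_bd; exact: le_trans c4 r2T.
have cu' : {within [set q | `|q| <= bd], continuous u} by exact: continuous_subspaceT.
have [q1 _ hq1] := EVT_max_rV ball0 (@compact_ball_rV _ _ bd) cu'.
have u_le q : c * nr q <= T -> u q <= u q1.
  by move=> qT; apply: hq1; apply/mem_set; exact: nr_bd.
(* Stops just short of the blow-up, at a radius where the barrier already exceeds the maximum of
   [u]. *)
have [r1 dom_r1 Vr1] := V_unb (u q1).
have /andP[r1_ge0 r1T] := dom_le _ dom_r1.
have r21 : r2 < r1.
  rewrite ltNge; apply/negP => r12; have := Vr2 _ r1_ge0 r12.
  by rewrite ltNge (ltW (le_lt_trans (u_le _ (le_trans c4 r2T)) Vr1)).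
have r10 := lt_trans r20 r21.
(* The growth bound with s = 0 and t = 1: the power 0^(tau + 1) is 0 since tau + 1 > 0. *)
have g0 : g 0 = 0.
  apply/eqP; rewrite eq_le g_ge0// andbT.
  have h01 : 0 <= (0 : R) <= 1 by rewrite lexx ler01.
  have := g_upper _ _ h01 ltr01; rewrite mul0r powR0 ?mulr0 ?mul0r//.
  by rewrite gt_eqF// ltr_wpDl.
have dom_r r : 0 <= r <= r1 -> dom r.
  by move=> /andP[? ?]; apply: dom_down dom_r1 _ _.
have at_q (q : 'rV[R]_(m + m + 1)) : 0 < rho q -> c * nr q <= r1 ->
    [/\ dom (c * nr q), 0 < c * nr q & 0 < p (c * nr q)].
  move=> rq qr; have cn : 0 < c * nr q by rewrite mulr_gt0// nr_gt0// N4_gt0.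
  have dq : dom (c * nr q) by apply: dom_r; rewrite ltW.
  by have [pq _] := Vder _ dq cn.
have : u q0 <= V (c * nr q0).
  apply: (comparison phi_cont phi_derivable phi'_cont phi0 phi_pos phi_mono f_cont f_incr
    f_gt0 h_cont h_noninc g_cont g_ge0 g0 u_ge0 u_sol c0 r10 e0 p0
    (Q := fun r => Y r / derive1 phi (p r))) => //.
  - by move=> r /dom_r /Vdom[].
  - move=> r /andP[r0 rr1]; have dr : dom r by apply: dom_r; rewrite ltW.
    have [pr [hV hp cY _ _]] := Vder r dr r0; have [_ cp _ _ _] := Vdom r dr.
    split=> //; apply: ctsM => //; apply: ctsV; first by rewrite gt_eqF// phi'_gt0.
    by apply: (cts_comp (h := derive1 phi)) => //; exact: phi'_cont.
  - move=> q rq qr; have [dq cn pq] := at_q q rq qr.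
    have [_ _ _ _ phiF] := Vdom _ dq; have [_ [_ _ _ YF _]] := Vder _ dq cn.
    apply: (divW_le_half phi_mono phi'_gt0 D_gt0 tau_ge0 phi'_upper) => //.
    by apply: (le_trans c1); rewrite invf_le1// ler1n.
  - move=> q rq qr; have [dq cn pq] := at_q q rq qr.
    have [_ _ eV _ _] := Vdom _ dq; have [_ [_ _ _ _ hY]] := Vder _ dq cn.
    have Vq := lt_le_trans e0 eV.
    apply: (hg_le_quarter phi'_gt0 tau_ge0 D'_gt0 g_upper rq c0 pq c1 c3 _ _ hY).
    + exact: h_ge0.
    + by rewrite ltW// f_gt0.
  - by move=> q qr1; apply: le_lt_trans Vr1; apply: u_le; rewrite qr1.
  - exact: Ordinal hm.
  - exact: le_trans c4 (ltW r21).
by rewrite leNgt (Vr2 _ _ c4)// mulr_ge0 ?nr_ge0// ltW.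
Qed.
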